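(* For every $T>2$ there exists a constant $C(T)>0$ such that for every odd $N\in\mathbb{N}$, with $h=1/(N+1)$ (so $C(T)$ is independent of $h$), and for all initial data $(\mathbf{U}_h^0,\mathbf{U}_h^1)\in\mathcal{S}_h:=(\mathcal{L}_h\cap\mathcal{B}_h)\times(\mathcal{L}_h\cap\mathcal{B}_h)$, the corresponding solution $\mathbf{U}_h(t)$ of the discrete adjoint system satisfies $$\mathcal{E}_h(\mathbf{U}_h^0,\mathbf{U}_h^1)\le C(T)\int_0^T\|B_h\mathbf{U}_h(t)\|_{\mathbb{C}^{2N+1}}^2\,dt=C(T)\int_0^T\Big|\frac{U_N(t)}{h}\Big|^2dt.$$
   Context: Discretization. Let $N$ be an odd natural number, $h=1/(N+1)$, $x_j=jh$ $(0\le j\le N+1)$, $x_{j+1/2}=(j+1/2)h$ $(0\le j\le N)$, $I_j=(x_j,x_{j+1})$. Basis of the continuous piecewise quadratic functions vanishing at $0$ and $1$: for $1\le j\le N$, $\phi_j(x)=\frac{2}{h^2}(x-x_{j-1/2})(x-x_{j-1})$ on $I_{j-1}$, $\phi_j(x)=\frac{2}{h^2}(x-x_{j+1/2})(x-x_{j+1})$ on $I_j$, $0$ elsewhere; for $0\le j\le N$, $\phi_{j+1/2}(x)=-\frac{4}{h^2}(x-x_j)(x-x_{j+1})$ on $I_j$, $0$ elsewhere. Vectors of $\mathbb{C}^{2N+1}$ are written $\mathbf{F}_h=(F_{j/2})_{1\le j\le 2N+1}$ with the convention $F_0=F_{N+1}=0$. The mass and stiffness matrices are $(M_h)_{ij}=\int_0^1\phi_{i/2}\phi_{j/2}\,dx$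 and $(S_h)_{ij}=\int_0^1\phi_{i/2}'\phi_{j/2}'\,dx$, $1\le i,j\le 2N+1$. Norms: $\|\mathbf{F}_h\|_{h,1}^2=(S_h\mathbf{F}_h,\mathbf{F}_h)_{\mathbb{C}^{2N+1}}$, $\|\mathbf{F}_h\|_{h,0}^2=(M_h\mathbf{F}_h,\mathbf{F}_h)_{\mathbb{C}^{2N+1}}$. Adjoint system: $M_h\mathbf{U}_{h,tt}(t)+S_h\mathbf{U}_h(t)=0$, $\mathbf{U}_h(T)=\mathbf{U}_h^0$, $\mathbf{U}_{h,t}(T)=\mathbf{U}_h^1$. Its conserved energy is $\mathcal{E}_h(\mathbf{U}_h^0,\mathbf{U}_h^1)=\frac12(\|\mathbf{U}_h(t)\|_{h,1}^2+\|\mathbf{U}_{h,t}(t)\|_{h,0}^2)$. The observation matrix $B_h$ is the $(2N+1)\times(2N+1)$ matrix whose only nonzero entry is $-1/h$ at position $(2N+1,2N)$; thus the only nontrivial component of $B_h\mathbf{U}_h$ is the last one, $-U_N/h$, where $U_N$ is the component of $\mathbf{U}_h$ at the node $x_N$. Filtered spaces (with $F_0=F_{N+1}=0$): $\mathcal{L}_h=\{\mathbf{F}_h\in\mathbb{C}^{2N+1}:\ F_{j+1/2}=(F_j+F_{j+1})/2,\ 0\le j\le N\}$ (piecewise linear data), and $\mathcal{B}_h=\{\mathbf{F}_h\in\mathbb{C}^{2N+1}:\ F_{2j+1}=(F_{2j}+F_{2j+2})/2,\ 0\le j\le (N-1)/2\}$ (nodal components given by a bi-grid algorithm). *)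

(* Defs.v *)
From HB Require Import structures.
From mathcomp Require Import all_boot all_order all_algebra.
From mathcomp Require Import all_classical all_reals all_analysis.
From mathcomp Require Import complex.

Set Implicit Arguments.
Unset Strict Implicit.
Unset Printing Implicit Defensive.

Import Order.TTheory GRing.Theory Num.Theory.
Import numFieldNormedType.Exports.

Local Open Scope classical_set_scope.
Local Open Scope ring_scope.
Local Open Scope complex_scope.

(* C^(2N+1).  The paper's index j/2, 1 <= j <= 2N+1, is the ordinal j - 1. *)
Notation cvec R N := 'cV[R[i]]_((2 * N).+1).

Section Discretization.
Variables (R : realType) (N : nat).
Implicit Types (j k : nat) (s x t T : R) (F G : cvec R N).

Definition meshsize : R := (N.+1%:R)^-1.

(* x_s for an integer or half-integer subscript s. *)
Definition xpt s : R := s * meshsize.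

(* The elements are taken closed: the two formulas agree (with value 1) at x_j,
   so that the basis functions are continuous on the whole line. *)
Definition phi_node j x : R :=
  if xpt (j%:R - 1) <= x <= xpt j%:R then
    2 / meshsize ^+ 2 * (x - xpt (j%:R - 2^-1)) * (x - xpt (j%:R - 1))
  else if xpt j%:R <= x <= xpt (j%:R + 1) then
    2 / meshsize ^+ 2 * (x - xpt (j%:R + 2^-1)) * (x - xpt (j%:R + 1))
  else 0.

Definition phi_mid j x : R :=
  if xpt j%:R <= x <= xpt (j%:R + 1) then
    - (4 / meshsize ^+ 2) * (x - xpt j%:R) * (x - xpt (j%:R + 1))
  else 0.

(* phi_half k is the basis function with half-integer subscript k/2. *)
Definition phi_half k : R -> R :=
  if odd k then phi_mid k./2 else phi_node k./2.

Definition mass_mx : 'M[R]_((2 * N).+1) :=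
  \matrix_(i, j) \int[lebesgue_measure]_(x in `[0, 1])
    (phi_half i.+1 x * phi_half j.+1 x).

(* phi' is the classical derivative off the finitely many nodes; the value of
   the total operator ^`() at the kinks does not affect the integral. *)
Definition stiff_mx : 'M[R]_((2 * N).+1) :=
  \matrix_(i, j) \int[lebesgue_measure]_(x in `[0, 1])
    ((phi_half i.+1)^`()%classic x * (phi_half j.+1)^`()%classic x).

(* The only nonzero entry is at the 1-based position (2N+1, 2N). *)
Definition obs_mx : 'M[R]_((2 * N).+1) :=
  \matrix_(i, j) (if (i.+1 == (2 * N).+1)%N && (j.+1 == (2 * N)%N)
                  then - meshsize^-1 else 0).

Definition cmulmx (A : 'M[R]_((2 * N).+1)) F : cvec R N :=
  map_mx (real_complex R) A *m F.

Definition cdot F G : R[i] := \sum_i F i 0 * (G i 0)^*.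

(* For F = G, and for (A F, F) with A real symmetric, cdot is real, so taking
   the real part only changes the type. *)
Definition cnorm_sq F : R := complex.Re (cdot F F).
Definition norm1_sq F : R := complex.Re (cdot (cmulmx stiff_mx F) F).
Definition norm0_sq F : R := complex.Re (cdot (cmulmx mass_mx F) F).

Definition energy (U0 U1 : cvec R N) : R :=
  2^-1 * (norm1_sq U0 + norm0_sq U1).

(* comp_half F k is F_(k/2) for 0 <= k <= 2N+2; it is 0 at k = 0 and at
   k = 2N+2, which is the convention F_0 = F_(N+1) = 0. *)
Definition comp_half F k : R[i] :=
  if k is k'.+1 then
    if insub k' is Some i then F i 0 else 0
  else 0.

Definition comp_node F j : R[i] := comp_half F (2 * j).
Definition comp_mid F j : R[i] := comp_half F (2 * j).+1.

Definition linear_data : set (cvec R N) :=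
  [set F | forall j, (j <= N)%N ->
     comp_mid F j = (comp_node F j + comp_node F j.+1) / 2].

Definition bigrid_data : set (cvec R N) :=
  [set F | forall j, (j <= (N - 1) %/ 2)%N ->
     comp_node F (2 * j).+1 =
       (comp_node F (2 * j) + comp_node F (2 * j + 2)) / 2].

Definition filtered_data : set (cvec R N * cvec R N) :=
  (linear_data `&` bigrid_data) `*` (linear_data `&` bigrid_data).

(* R[i] carries no normed R-module structure in the library, so derivative and
   continuity of a curve in C^(2N+1) are expressed on its real coordinates. *)
Definition cvec_deriv (U : R -> cvec R N) t (V : cvec R N) : Prop :=
  forall i,
    is_derive t 1 (fun s => complex.Re (U s i 0)) (complex.Re (V i 0)) /\
    is_derive t 1 (fun s => complex.Im (U s i 0)) (complex.Im (V i 0)).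

Definition cvec_continuous_on (A : set R) (U : R -> cvec R N) : Prop :=
  forall i,
    {within A, continuous (fun s => complex.Re (U s i 0))} /\
    {within A, continuous (fun s => complex.Im (U s i 0))}.

(* Classical solution on [0, T]: twice differentiable inside, and C^1 up to the
   end points, where the final data are prescribed. *)
Definition adjoint_solution T (U0 U1 : cvec R N) (U : R -> cvec R N) : Prop :=
  exists Ut Utt : R -> cvec R N,
    [/\ cvec_continuous_on `[0, T] U,
        cvec_continuous_on `[0, T] Ut,
        (forall t, 0 < t < T -> cvec_deriv U t (Ut t)),
        (forall t, 0 < t < T -> cvec_deriv Ut t (Utt t)) &
        (forall t, 0 < t < T ->
           cmulmx mass_mx (Utt t) + cmulmx stiff_mx (U t) = 0) /\
        U T = U0 /\ Ut T = U1].

End Discretization.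

(* Main.v *)
Require Import Defs.
From HB Require Import structures.
From mathcomp Require Import all_boot all_order all_algebra.
From mathcomp Require Import all_classical all_reals all_analysis.
From mathcomp Require Import complex.
From mathcomp Require Import measurable_realfun ring lra zify.

(* The discrete sine transform diagonalizes the scheme: at the wave number
   eta = k pi h the symbols of M_h and S_h are 2 x 2 matrices, and the dispersion
   relation has an acoustic root L < 10 and an optical root L > 12, the frequency
   being sqrt L / h.  For piecewise linear data both amplitudes are explicit
   multiples of the nodal sine coefficient at eta, and the bi-grid condition
   bounds the coefficient at pi - eta by tan^2 (eta/2) times the one at eta, so
   the acoustic modes with eta <= pi/2, for which L < 5/2, control the energy.

   The acoustic frequencies with L <= 4 have gap at least pi, hence Ingham's
   inequality holds for them in every time T > 2.  The other modes have no
   uniform gap.  They are damped beforehand by composing maps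
   f |-> (f(. + s) + f(. - s)) / 2 - c f, which multiply the mode of frequency w
   by cos (w s) - c and use an arbitrarily small extra time.  What remains of
   them is absorbed by a Schur test: the trace at x_N carries the weight sin eta,
   and frequencies separate like sqrt (sin eta sin eta') |k - k'|. *)

Set Implicit Arguments.
Unset Strict Implicit.
Unset Printing Implicit Defensive.

Import Order.TTheory GRing.Theory Num.Theory.
Import numFieldNormedType.Exports.

Local Open Scope classical_set_scope.
Local Open Scope ring_scope.

(** * Integration on segments *)

(** The obstacle is uniformity in h. Filtered data still excite acoustic modes of small group
    velocity and the optical branch, and their energy is bounded by that of the low modes only up to
    a large constant. Damping makes this constant small at a cost independent of h: on fine meshes
    the number of factors is fixed and the shifts have length of order h, while the finitely many
    coarse meshes are treated one by one. The modes with 5/2 <= L <= 4 form a buffer: they stay in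
    the Ingham family, so no control of the filter on them is required, and they separate the
    frequencies to keep from those to damp. Since the trace at x_N sees a low mode with the
    degenerate weight sin^2 eta, every other quantity has to be compared with this weight. The
    factors sin^2 (eta/2) that make this possible come from three sources: the stiffness of the
    data, the bi-grid reflection eta -> pi - eta, and the optical amplitudes of piecewise linear
    data. *)

Lemma continuous_integrable (R : realType) (f : R -> R) (a b : R) :
  continuous f -> (@lebesgue_measure R).-integrable `[a, b] (EFin \o f).
Proof.
move=> cf; apply: continuous_compact_integrable; first exact: segment_compact.
exact: continuous_subspaceT.
Qed.

Lemma exists_antiderivative (R : realType) (f : R -> R) (a b : R) :
  continuous f ->
  exists F : R -> R, forall x, a < x < b -> is_derive x 1 F (f x).
Proof.
move=> cf; exists (fun x => \int[lebesgue_measure]_(t in `[a, x]) f t).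
move=> x /andP[ax xb].
have := @continuous_FTC1_closed R f a x b xb (@continuous_integrable _ _ _ _ cf) ax (cf x).
move=> [dF <-]; rewrite derive1E; exact: derivableP.
Qed.

Lemma Rintegral_FTC (R : realType) (f F : R -> R) (a b : R) :
  a <= b -> continuous f ->
  (forall x, a <= x <= b -> is_derive x 1 F (f x)) ->
  \int[lebesgue_measure]_(x in `[a, b]) f x = F b - F a.
Proof.
move=> ab cf dF; move: ab; rewrite le_eqVlt => /orP[/eqP <-|ab].
  by rewrite subrr set_itv1 Rintegral_set1.
have cF x : a <= x <= b -> {for x, continuous F}.
  by move=> /dF h; apply: differentiable_continuous; exact/derivable1_diffP.
rewrite /Rintegral (@continuous_FTC2 _ f F a b) //.
- exact: continuous_subspaceT.
- split.
  + by move=> x; rewrite in_itv /= => /andP[/ltW ? /ltW ?];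
      apply: (@ex_derive _ _ _ _ _ _ _ (dF x _)); apply/andP.
  + by apply: cvg_at_right_filter; apply: cF; rewrite lexx ltW.
  + by apply: cvg_at_left_filter; apply: cF; rewrite lexx ltW.
- move=> x; rewrite in_itv /= => /andP[/ltW ax /ltW xb]; rewrite derive1E.
  by apply: derive_val; apply: dF; rewrite ax xb.
Qed.

Lemma Rintegral_shift (R : realType) (f : R -> R) (a b s : R) :
  a <= b -> continuous f ->
  \int[lebesgue_measure]_(x in `[a, b]) f (x + s) =
  \int[lebesgue_measure]_(x in `[a + s, b + s]) f x.
Proof.
(* The margin 1 puts the closed segment inside the open interval where the antiderivative is
   differentiable. *)
move=> ab cf; have [F dF] := exists_antiderivative (a + s - 1) (b + s + 1) cf.
have cfs : continuous (fun x : R => f (x + s)).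
  move=> x; apply: (@continuous_comp _ _ _ (fun x => x + s) f); last exact: cf.
  by apply: continuousD; [exact: id|exact: cst_continuous].
transitivity (F (b + s) - F (a + s)).
  apply: (Rintegral_FTC (F := fun x : R => F (x + s)) ab cfs) => x /andP[ax xb].
  have h : is_derive (x + s) 1 F (f (x + s)) by apply: dF; lra.
  rewrite -[f (x + s)]mulr1.
  apply: (@is_derive1_comp _ F (fun x => x + s)).
  by apply: is_derive_eq; rewrite addr0.
apply/esym/Rintegral_FTC => //; first lra.
by move=> x /andP[? ?]; apply: dF; lra.
Qed.

(** The domain is an arbitrary topological space so that the same lemma serves on the line and on
    the subspace of a segment, where continuity within the segment lives. *)
Lemma continuous_mul (R : realType) (X : topologicalType) (f g : X -> R) :
  continuous f -> continuous g -> continuous (fun t : X => f t * g t).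
Proof. by move=> cf cg t; apply: continuousM; [exact: cf|exact: cg]. Qed.

Lemma continuous_add (R : realType) (X : topologicalType) (f g : X -> R) :
  continuous f -> continuous g -> continuous (fun t : X => f t + g t).
Proof. by move=> cf cg t; apply: continuousD; [exact: cf|exact: cg]. Qed.

Lemma continuous_cst (R : realType) (X : topologicalType) (k : R) :
  continuous (fun _ : X => k).
Proof. exact: cst_continuous. Qed.

Lemma continuous_sum (R : realType) (X : topologicalType) (I : Type)
    (r : seq I) (P : pred I) (f : I -> X -> R) :
  (forall i, continuous (f i)) ->
  continuous (fun x : X => \sum_(i <- r | P i) f i x).
Proof. by move=> cf; apply: continuous_big => // -[x y]; exact: add_continuous. Qed.

Lemma Rintegral_sum_continuous (R : realType) (I : Type) (r : seq I)
    (P : pred I) (f : I -> R -> R) (a b : R) :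
  (forall i, continuous (f i)) ->
  \int[lebesgue_measure]_(x in `[a, b]) (\sum_(i <- r | P i) f i x) =
  \sum_(i <- r | P i) \int[lebesgue_measure]_(x in `[a, b]) f i x.
Proof.
move=> cf.
elim: r => [|i r IH].
  under eq_Rintegral do rewrite big_nil.
  by rewrite big_nil Rintegral_cst // mul0r.
under eq_Rintegral do rewrite big_cons.
rewrite big_cons; case: ifP => // _.
by rewrite RintegralD ?IH //; apply: continuous_integrable => // x; exact: continuous_sum.
Qed.

Lemma Rintegral_scale (R : realType) (f : R -> R) (a b k : R) :
  continuous f ->
  \int[lebesgue_measure]_(x in `[a, b]) (k * f x) =
  k * \int[lebesgue_measure]_(x in `[a, b]) f x.
Proof. by move=> cf; apply: RintegralZl => //; exact: continuous_integrable. Qed.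

Lemma le_Rintegral_continuous (R : realType) (f g : R -> R) (a b : R) :
  continuous f -> continuous g -> (forall x, a <= x <= b -> f x <= g x) ->
  \int[lebesgue_measure]_(x in `[a, b]) f x <=
  \int[lebesgue_measure]_(x in `[a, b]) g x.
Proof.
by move=> cf cg fg; apply: le_Rintegral => //; exact: continuous_integrable.
Qed.

Lemma Rintegral_odd (R : realType) (f : R -> R) (t : R) :
  0 <= t -> continuous f -> (forall x, f (- x) = - f x) ->
  \int[lebesgue_measure]_(x in `[- t, t]) f x = 0.
Proof.
move=> t0 cf odd_f.
have E : \int[lebesgue_measure]_(x in `[- t, t]) f x =
         \int[lebesgue_measure]_(x in `[- t, t]) (-1 * f x).
  have tt : - t <= t by lra.
  have := @integration_by_substitution_oppr _ f (- t) t tt.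
  rewrite opprK => h.
  rewrite {1}/Rintegral h; last exact: continuous_subspaceT.
  congr fine; apply: eq_integral => x _ /=.
  by rewrite odd_f mulN1r.
move: E; rewrite Rintegral_scale //; lra.
Qed.

(** * Ingham's inequality *)

Lemma is_derive_cos_scale (R : realType) (k t : R) :
  is_derive t 1 (fun s : R => cos (k * s)) (- (k * sin (k * t))).
Proof.
have h : is_derive t 1 (fun s : R => k * s) k.
  by apply: is_derive_eq; rewrite /GRing.scale /= mulr1.
apply: (is_derive_eq (is_derive1_comp (is_derive_cos (k * t)) h)); ring.
Qed.

Lemma is_derive_sin_scale (R : realType) (k t : R) :
  is_derive t 1 (fun s : R => sin (k * s)) (k * cos (k * t)).
Proof.
have h : is_derive t 1 (fun s : R => k * s) k.
  by apply: is_derive_eq; rewrite /GRing.scale /= mulr1.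
apply: (is_derive_eq (is_derive1_comp (is_derive_sin (k * t)) h)); ring.
Qed.

Lemma is_derive_continuous (R : realType) (f df : R -> R) :
  (forall t : R, is_derive t 1 f (df t)) -> continuous f.
Proof.
move=> h t; apply: differentiable_continuous.
by apply/derivable1_diffP; case: (h t).
Qed.

Lemma continuous_cos_scale (R : realType) (k : R) :
  continuous (fun t : R => cos (k * t)).
Proof. exact: is_derive_continuous (is_derive_cos_scale k). Qed.

Lemma continuous_sin_scale (R : realType) (k : R) :
  continuous (fun t : R => sin (k * t)).
Proof. exact: is_derive_continuous (is_derive_sin_scale k). Qed.

(** Fourier transform of Ingham's weight [cos (p * t)], cut to the half-period around 0 on which it
    is nonnegative. *)
Definition ingham_kernel (R : realType) (p x : R) : R :=
  \int[lebesgue_measure]_(t in `[- (pi / (2 * p)), pi / (2 * p)])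
    (cos (p * t) * cos (x * t)).

(** Multiplying by [x ^+ 2 - p ^+ 2] avoids excluding x = p and x = -p. The weight vanishes at both
    ends of the interval, so only one boundary term survives and the kernel decays quadratically. *)
Lemma ingham_kernel_eq (R : realType) (p x : R) : 0 < p ->
  (x ^+ 2 - p ^+ 2) * ingham_kernel p x = - (2 * p) * cos (x * (pi / (2 * p))).
Proof.
move=> p0; rewrite /ingham_kernel -Rintegral_scale; last first.
  by move=> t; apply: continuousM; exact: continuous_cos_scale.
have pi0 := pi_gt0 R.
have tau0 : 0 < pi / (2 * p) by rewrite divr_gt0 // mulr_gt0.
rewrite (_ : - (2 * p) * _ =
   (x * (cos (p * (pi / (2 * p))) * sin (x * (pi / (2 * p))))
    - p * (sin (p * (pi / (2 * p))) * cos (x * (pi / (2 * p))))) -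
   (x * (cos (p * - (pi / (2 * p))) * sin (x * - (pi / (2 * p))))
    - p * (sin (p * - (pi / (2 * p))) * cos (x * - (pi / (2 * p)))))); last first.
  rewrite !mulrN !cosN !sinN.
  have -> : p * (pi / (2 * p)) = pi / 2 by field; lra.
  by rewrite cos_pihalf sin_pihalf; ring.
apply: (@Rintegral_FTC _ _ (fun t : R => x * (cos (p * t) * sin (x * t)) -
    p * (sin (p * t) * cos (x * t)))).
- lra.
- have c : continuous (fun t : R =>
      (x ^+ 2 - p ^+ 2) * (cos (p * t) * cos (x * t))).
    apply: continuous_mul; first exact: continuous_cst.
    by apply: continuous_mul; exact: continuous_cos_scale.
  exact: c.
- move=> t _.
  have h1 := is_derive_cos_scale p t; have h2 := is_derive_sin_scale x t.
  have h3 := is_derive_sin_scale p t; have h4 := is_derive_cos_scale x t.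
  apply: is_derive_eq.
  rewrite /GRing.scale /=; ring.
Qed.

Lemma ingham_kernel0 (R : realType) (p : R) : 0 < p ->
  ingham_kernel p 0 = 2 / p.
Proof.
move=> p0; have := ingham_kernel_eq 0 p0.
rewrite mul0r cos0 expr0n /= sub0r mulr1 => h.
apply: (mulfI (x := - p ^+ 2)); first by rewrite oppr_eq0 expf_neq0 // gt_eqF.
by rewrite h; field; rewrite gt_eqF.
Qed.

Lemma cos_weight_ge0 (R : realType) (p t : R) : 0 < p ->
  - (pi / (2 * p)) <= t <= pi / (2 * p) -> 0 <= cos (p * t).
Proof.
move=> p0 /andP[t1 t2]; apply: cos_ge0_pihalf.
have -> : pi / 2 = p * (pi / (2 * p)) :> R by field; lra.
by rewrite -mulrN !ler_pM2l // t1 t2.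
Qed.

Lemma le_ingham_kernel0 (R : realType) (p x : R) : 0 < p ->
  `|ingham_kernel p x| <= 2 / p.
Proof.
move=> p0; rewrite -ingham_kernel0 // /ingham_kernel.
have cc y : continuous (fun t : R => cos (p * t) * cos (y * t)).
  by move=> t; apply: continuousM; exact: continuous_cos_scale.
apply: (le_trans (le_normr_Rintegral _ _)) => //.
  exact: continuous_integrable.
apply: le_Rintegral_continuous => //.
  have c : continuous (fun t : R => `|cos (p * t) * cos (x * t)|).
    by move=> t; apply: continuous_comp (cc x t) _; exact: norm_continuous.
  exact: c.
move=> t /(cos_weight_ge0 p0) ct.
by rewrite normrM (ger0_norm ct) mul0r cos0 ler_wpM2l // cos_max.
Qed.

Lemma ingham_kernel_gap (R : realType) (p x : R) : 0 < p -> p < `|x| ->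
  `|ingham_kernel p x| <= 2 * p / (x ^+ 2 - p ^+ 2).
Proof.
move=> p0 px.
have d0 : 0 < x ^+ 2 - p ^+ 2.
  by rewrite subr_gt0 -(real_normK (num_real x)) ltr_pXn2r // ?nnegrE // ltW.
rewrite ler_pdivlMr // mulrC -{1}(gtr0_norm d0) -normrM ingham_kernel_eq //.
rewrite mulNr normrN normrM gtr0_norm ?mulr_gt0 //.
by rewrite ler_piMr ?cos_max // mulr_ge0 // ltW.
Qed.

(** Below [2 * p] the trivial bound [2 / p] gives exactly [8 * p]; above it [x ^+ 2 - p ^+ 2] is
    comparable to [x ^+ 2]. No gap hypothesis enters, which suits the modes without a uniform
    gap. *)
Lemma ingham_kernel_decay (R : realType) (p x : R) : 0 < p ->
  x ^+ 2 * `|ingham_kernel p x| <= 8 * p.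
Proof.
move=> p0; have [xp|xp] := ltrP `|x| (2 * p).
  have x2 : x ^+ 2 <= (2 * p) ^+ 2.
    by rewrite -(real_normK (num_real x)) lerXn2r // ?nnegrE // ltW // mulr_gt0.
  apply: (le_trans (ler_pM _ _ x2 (le_ingham_kernel0 x p0))) => //.
    exact: sqr_ge0.
  rewrite [leLHS](_ : _ = 8 * p) //; field; lra.
have px : p < `|x| by apply: lt_le_trans xp; lra.
have x2 : (2 * p) ^+ 2 <= x ^+ 2.
  by rewrite -(real_normK (num_real x)) lerXn2r // ?nnegrE // ?mulr_ge0 // ltW.
have d0 : 0 < x ^+ 2 - p ^+ 2 by nra.
apply: (le_trans (ler_wpM2l (sqr_ge0 x) (ingham_kernel_gap p0 px))).
rewrite mulrA ler_pdivrMr //; nra.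
Qed.

(** Each product is split by the arithmetic-geometric mean inequality, and the symmetry of [c] turns
    the two halves into the same row sums. *)
Lemma schur_test (R : realFieldType) (I : finType) (P : pred I)
    (c : I -> I -> R) (x : I -> R) (r : R) :
  (forall i j, 0 <= c i j) -> (forall i j, c i j = c j i) ->
  (forall i, P i -> \sum_(j | P j) c i j <= r) ->
  \sum_(i | P i) \sum_(j | P j) c i j * `|x i * x j| <=
  r * \sum_(i | P i) x i ^+ 2.
Proof.
move=> c0 cC cr.
have le1 : \sum_(i | P i) \sum_(j | P j) c i j * `|x i * x j| <=
    \sum_(i | P i) \sum_(j | P j)
      (2^-1 * (c i j * x i ^+ 2) + 2^-1 * (c i j * x j ^+ 2)).
  apply: ler_sum => i _; apply: ler_sum => j _.
  rewrite normrM -(real_normK (num_real (x i))) -(real_normK (num_real (x j))).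
  have := c0 i j; set u := `|x i|; set v := `|x j|; set d := c i j => d0.
  have := mulr_ge0 d0 (sqr_ge0 (u - v)); nra.
apply: (le_trans le1); under eq_bigr do rewrite big_split /=.
rewrite big_split /= [X in _ + X]exchange_big /= -big_split /= mulr_sumr.
apply: ler_sum => i Pi.
under [X in _ + X]eq_bigr do rewrite cC.
rewrite -big_split /= (eq_bigr (fun j => c i j * x i ^+ 2)); last by move=> j _; lra.
by rewrite -mulr_suml ler_wpM2r ?sqr_ge0 ?cr.
Qed.

Definition trig_sum (R : realType) (I : finType) (P : pred I) (w a b : I -> R)
    (t : R) : R :=
  \sum_(i | P i) (a i * cos (w i * t) + b i * sin (w i * t)).

Lemma continuous_trig_sum (R : realType) (I : finType) (P : pred I)
    (w a b : I -> R) : continuous (trig_sum P w a b).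
Proof.
apply: continuous_sum => i; apply: continuous_add; apply: continuous_mul;
  by [exact: continuous_cst | exact: continuous_cos_scale |
      exact: continuous_sin_scale].
Qed.

Lemma ingham_kernel_sin (R : realType) (p x : R) : 0 < p ->
  \int[lebesgue_measure]_(t in `[- (pi / (2 * p)), pi / (2 * p)])
    (cos (p * t) * sin (x * t)) = 0.
Proof.
move=> p0; apply: Rintegral_odd.
- by rewrite divr_ge0 ?pi_ge0 // mulr_ge0 // ltW.
- by apply: continuous_mul; [exact: continuous_cos_scale|exact: continuous_sin_scale].
- by move=> t; rewrite !mulrN cosN sinN mulrN.
Qed.

Lemma Rintegral_add (R : realType) (f g : R -> R) (a b : R) :
  continuous f -> continuous g ->
  \int[lebesgue_measure]_(x in `[a, b]) (f x + g x) =
  \int[lebesgue_measure]_(x in `[a, b]) f x +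
  \int[lebesgue_measure]_(x in `[a, b]) g x.
Proof. by move=> cf cg; apply: RintegralD => //; exact: continuous_integrable. Qed.

Lemma weighted_trig_sum_sqr (R : realType) (p : R) (I : finType) (P : pred I)
    (w a b : I -> R) : 0 < p ->
  \int[lebesgue_measure]_(t in `[- (pi / (2 * p)), pi / (2 * p)])
    (cos (p * t) * trig_sum P w a b t ^+ 2) =
  2^-1 * \sum_(i | P i) \sum_(j | P j)
    (ingham_kernel p (w i - w j) * (a i * a j + b i * b j) +
     ingham_kernel p (w i + w j) * (a i * a j - b i * b j)).
Proof.
move=> p0.
(* Product-to-sum expansion of one term of the square; its sine part is odd in t and integrates to
   0. *)
pose g i j (t : R) :=
  (2^-1 * (a i * a j + b i * b j)) * (cos (p * t) * cos ((w i - w j) * t)) +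
  (2^-1 * (a i * a j - b i * b j)) * (cos (p * t) * cos ((w i + w j) * t)) +
  ((2^-1 * (b i * a j + a i * b j)) * (cos (p * t) * sin ((w i + w j) * t)) +
   (2^-1 * (b i * a j - a i * b j)) * (cos (p * t) * sin ((w i - w j) * t))).
have ccc y : continuous (fun t : R => cos (p * t) * cos (y * t)).
  by apply: continuous_mul; exact: continuous_cos_scale.
have ccs y : continuous (fun t : R => cos (p * t) * sin (y * t)).
  by apply: continuous_mul; [exact: continuous_cos_scale|exact: continuous_sin_scale].
have kcc k y : continuous (fun t : R => k * (cos (p * t) * cos (y * t))).
  by apply: continuous_mul; [exact: continuous_cst|exact: ccc].
have kcs k y : continuous (fun t : R => k * (cos (p * t) * sin (y * t))).
  by apply: continuous_mul; [exact: continuous_cst|exact: ccs].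
have cg i j : continuous (g i j).
  by do 2 apply: continuous_add => //; apply: continuous_add.
have Eg t : cos (p * t) * trig_sum P w a b t ^+ 2 =
    \sum_(i | P i) \sum_(j | P j) g i j t.
  rewrite /trig_sum expr2 mulr_suml mulr_sumr; apply: eq_bigr => i _.
  rewrite mulr_sumr mulr_sumr; apply: eq_bigr => j _.
  rewrite /g [(w i - w j) * t]mulrBl [(w i + w j) * t]mulrDl cosB sinB cosD sinD.
  by field.
under eq_Rintegral do rewrite Eg.
rewrite Rintegral_sum_continuous; last first.
  by move=> i; exact: continuous_sum.
rewrite mulr_sumr; apply: eq_bigr => i _.
rewrite Rintegral_sum_continuous // mulr_sumr; apply: eq_bigr => j _.
rewrite /g Rintegral_add; [|exact: continuous_add..].
rewrite !Rintegral_add // !Rintegral_scale // !ingham_kernel_sin //.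
rewrite -/(ingham_kernel p (w i - w j)) -/(ingham_kernel p (w i + w j)); ring.
Qed.

Lemma ingham_kernelN (R : realType) (p x : R) :
  ingham_kernel p (- x) = ingham_kernel p x.
Proof. by apply: eq_Rintegral => t _; rewrite mulNr cosN. Qed.

(** Only the zero difference frequency, j = i, gives the main term [2 / p]; all the rest, including
    the sum frequency [w i + w i], is a perturbation absorbed by the Schur test. *)
Lemma weighted_trig_sum_ge (R : realType) (p r : R) (I : finType) (P : pred I)
    (w a b : I -> R) : 0 < p ->
  (forall i, P i ->
     \sum_(j | P j) ((if j == i then 0 else `|ingham_kernel p (w i - w j)|) +
                     `|ingham_kernel p (w i + w j)|) <= r) ->
  2^-1 * (2 / p - r) * \sum_(i | P i) (a i ^+ 2 + b i ^+ 2) <=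
  \int[lebesgue_measure]_(t in `[- (pi / (2 * p)), pi / (2 * p)])
    (cos (p * t) * trig_sum P w a b t ^+ 2).
Proof.
move=> p0 rowr; rewrite weighted_trig_sum_sqr // -mulrA ler_wpM2l //.
pose c i j := (if j == i then 0 else `|ingham_kernel p (w i - w j)|) +
                     `|ingham_kernel p (w i + w j)|.
have c0 i j : 0 <= c i j by rewrite /c; case: ifP => _; rewrite addr_ge0.
have cC i j : c i j = c j i.
  rewrite /c eq_sym addrC [RHS]addrC [w i + _]addrC; congr (_ + _).
  by case: ifP => // _; rewrite -opprB ingham_kernelN.
have ha := schur_test a c0 cC rowr; have hb := schur_test b c0 cC rowr.
have -> : (2 / p - r) * \sum_(i | P i) (a i ^+ 2 + b i ^+ 2) =
    \sum_(i | P i) (2 / p * (a i ^+ 2 + b i ^+ 2)) -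
    (r * (\sum_(i | P i) a i ^+ 2) + r * (\sum_(i | P i) b i ^+ 2)).
  by rewrite -mulr_sumr big_split /=; ring.
apply: (@le_trans _ _ (\sum_(i | P i) (2 / p * (a i ^+ 2 + b i ^+ 2)) -
   (\sum_(i | P i) \sum_(j | P j) c i j * `|a i * a j| +
    \sum_(i | P i) \sum_(j | P j) c i j * `|b i * b j|))).
  by rewrite lerD2l lerN2 lerD.
rewrite -big_split /= -sumrB; apply: ler_sum => i Pi.
rewrite -big_split /=.
have -> : 2 / p * (a i ^+ 2 + b i ^+ 2) =
  \sum_(j | P j) (if j == i then 2 / p * (a i * a j + b i * b j) else 0).
  by rewrite -big_mkcondr /= (big_pred1 i) ?expr2 // => j /=; case: eqP => [->|];
    rewrite ?Pi ?andbF ?andbT.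
rewrite -sumrB; apply: ler_sum => j Pj; rewrite /c.
have K2 := ler_norm (- (ingham_kernel p (w i + w j) * (a i * a j - b i * b j))).
have K2' : `|- (ingham_kernel p (w i + w j) * (a i * a j - b i * b j))| <=
   `|ingham_kernel p (w i + w j)| * (`|a i * a j| + `|b i * b j|).
  by rewrite normrN normrM ler_wpM2l // ler_normB.
move: K2 K2'; case: eqP => [->|_] K2 K2'.
  by rewrite subrr ingham_kernel0 // !add0r; move: K2 K2'; lra.
have K1 := ler_norm (- (ingham_kernel p (w i - w j) * (a i * a j + b i * b j))).
have K1' : `|- (ingham_kernel p (w i - w j) * (a i * a j + b i * b j))| <=
   `|ingham_kernel p (w i - w j)| * (`|a i * a j| + `|b i * b j|).
  by rewrite normrN normrM ler_wpM2l // ler_normD.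
move: K1 K1' K2 K2'; rewrite !mulrDr !mulrDl; lra.
Qed.

(** The weights [s] are put into the Schur kernel and not into the coefficients, so a separation of
    order sqrt (s i * s j) is enough to bound the rows. *)
Lemma weighted_trig_sum_le (R : realType) (p r : R) (I : finType) (P : pred I)
    (w a b s : I -> R) : 0 < p -> (forall i, 0 <= s i) ->
  (forall i, P i ->
     \sum_(j | P j) (s i * s j * (`|ingham_kernel p (w i - w j)| +
                                  `|ingham_kernel p (w i + w j)|)) <= r) ->
  \int[lebesgue_measure]_(t in `[- (pi / (2 * p)), pi / (2 * p)])
    (cos (p * t) *
     trig_sum P w (fun i => s i * a i) (fun i => s i * b i) t ^+ 2) <=
  2^-1 * r * \sum_(i | P i) (a i ^+ 2 + b i ^+ 2).
Proof.
move=> p0 s0 rowr; rewrite weighted_trig_sum_sqr // -mulrA ler_wpM2l //.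
pose c i j := s i * s j * (`|ingham_kernel p (w i - w j)| +
                                  `|ingham_kernel p (w i + w j)|).
have c0 i j : 0 <= c i j by rewrite /c !mulr_ge0 // addr_ge0.
have cC i j : c i j = c j i.
  by rewrite /c [s i * _]mulrC [w i + w j]addrC -[w i - w j]opprB ingham_kernelN.
have ha := schur_test a c0 cC rowr; have hb := schur_test b c0 cC rowr.
rewrite big_split /= mulrDr; apply: (le_trans _ (lerD ha hb)).
rewrite -big_split /=; apply: ler_sum => i Pi.
rewrite -big_split /=; apply: ler_sum => j Pj; rewrite /c.
have ss : 0 <= s i * s j by rewrite mulr_ge0.
have K2 := ler_norm (ingham_kernel p (w i + w j) * (a i * a j - b i * b j)).
have K2' : `|ingham_kernel p (w i + w j) * (a i * a j - b i * b j)| <=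
   `|ingham_kernel p (w i + w j)| * (`|a i * a j| + `|b i * b j|).
  by rewrite normrM ler_wpM2l // ler_normB.
have K1 := ler_norm (ingham_kernel p (w i - w j) * (a i * a j + b i * b j)).
have K1' : `|ingham_kernel p (w i - w j) * (a i * a j + b i * b j)| <=
   `|ingham_kernel p (w i - w j)| * (`|a i * a j| + `|b i * b j|).
  by rewrite normrM ler_wpM2l // ler_normD.
have H := ler_wpM2l ss (lerD (le_trans K1 K1') (le_trans K2 K2')).
by clear -H; lra.
Qed.

(** Telescoping by 1/(4 d^2 - 1) = (1/(2 d - 1) - 1/(2 d + 1))/2; the two cases tell whether the
    omitted index k has been passed. *)
Lemma sum_gap_diff (R : realFieldType) (k n : nat) :
  \sum_(l < n) (if l == k :> nat then 0
                else (4 * (k%:R - l%:R) ^+ 2 - 1)^-1 : R) =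
  if (n <= k)%N then 2^-1 * ((2 * (k%:R - n%:R) + 1)^-1 - (2 * k%:R + 1)^-1)
  else 1 - 2^-1 * (2 * k%:R + 1)^-1 - 2^-1 * (2 * (n%:R - k%:R) - 1)^-1.
Proof.
have k0 : 0 <= k%:R :> R by [].
elim: n => [|n IH].
  by rewrite big_ord0 leq0n subr0 subrr mulr0.
have n0 : 0 <= n%:R :> R by [].
rewrite big_ord_recr /= IH -(natr1 n); case: (ltngtP n k) => [nk|kn|->].
- have h : n%:R + 1 <= k%:R :> R by rewrite natr1 ler_nat.
  by field; rewrite /= ?andbT; apply/and4P; split; nra.
- have h : k%:R + 1 <= n%:R :> R by rewrite natr1 ler_nat.
  by field; apply/and4P; split; nra.
- by field; apply/andP; split; lra.
Qed.

Lemma sum_gap_sum (R : realFieldType) (k n : nat) :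
  \sum_(l < n) ((4 * (k%:R + l%:R + 2) ^+ 2 - 1)^-1 : R) =
  2^-1 * ((2 * k%:R + 3)^-1 - (2 * (k%:R + n%:R) + 3)^-1).
Proof.
have k0 : 0 <= k%:R :> R by [].
elim: n => [|n IH]; first by rewrite big_ord0 addr0 subrr mulr0.
have n0 : 0 <= n%:R :> R by [].
rewrite big_ord_recr /= IH -(natr1 n); field; rewrite ?andbT.
by apply/and4P; split; nra.
Qed.

Lemma sum_gap_diff_le (R : realFieldType) (k n : nat) :
  \sum_(l < n) (if l == k :> nat then 0
                else (4 * (k%:R - l%:R) ^+ 2 - 1)^-1 : R) <=
  1 - 2^-1 * (2 * k%:R + 1)^-1.
Proof.
have k0 : 0 <= k%:R :> R by [].
have kV : (2 * k%:R + 1)^-1 <= 1 :> R by rewrite invf_le1; lra.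
rewrite sum_gap_diff; case: leqP => nk.
  have h : n%:R <= k%:R :> R by rewrite ler_nat.
  have V : (2 * (k%:R - n%:R) + 1)^-1 <= 1 :> R by rewrite invf_le1; lra.
  lra.
have h : k%:R + 1 <= n%:R :> R by rewrite natr1 ler_nat.
have : 0 <= (2 * (n%:R - k%:R) - 1)^-1 :> R by rewrite invr_ge0; lra.
lra.
Qed.

(** The numbers k - l for l different from k, and k + l + 2, are distinct nonzero integers, and the
    sum of 1/(4 d^2 - 1) over all nonzero integers d is 1. *)
Lemma sum_gap_le1 (R : realFieldType) (k n : nat) :
  \sum_(l < n) (((if l == k :> nat then 0
                else (4 * (k%:R - l%:R) ^+ 2 - 1)^-1) +
     (4 * (k%:R + l%:R + 2) ^+ 2 - 1)^-1 : R)) <= 1.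
Proof.
have k0 : 0 <= k%:R :> R by [].
have n0 : 0 <= n%:R :> R by [].
rewrite big_split /= sum_gap_sum.
have := sum_gap_diff_le R k n.
have : (2 * k%:R + 3)^-1 <= (2 * k%:R + 1)^-1 :> R by rewrite lef_pV2 ?posrE; lra.
have : 0 <= (2 * (k%:R + n%:R) + 3)^-1 :> R by rewrite invr_ge0; lra.
lra.
Qed.

(** Since [2 * p < g], one has 4 (x^2 - p^2) >= g^2 (4 r^2 - 1): the kernel is majorized by the
    terms of the telescoping sum. *)
Lemma ingham_kernel_le_gap (R : realType) (p g x r : R) :
  0 < p -> 2 * p < g -> 1 <= r -> g * r <= `|x| ->
  `|ingham_kernel p x| <= 8 * p / g ^+ 2 * (4 * r ^+ 2 - 1)^-1.
Proof.
move=> p0 pg r1 gx.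
have gr : g <= g * r by nra.
have px : p < `|x| by lra.
apply: (le_trans (ingham_kernel_gap p0 px)).
have x2 : (g * r) ^+ 2 <= x ^+ 2.
  by rewrite -(real_normK (num_real x)) lerXn2r // nnegrE; nra.
have r2 : 1 <= r ^+ 2 by nra.
rewrite -[leRHS]mulrA -invfM ler_pdivrMr; last by nra.
have -> : 8 * p * (g ^+ 2 * (4 * r ^+ 2 - 1))^-1 * (x ^+ 2 - p ^+ 2) =
  2 * p * (4 * (x ^+ 2 - p ^+ 2) / (g ^+ 2 * (4 * r ^+ 2 - 1))).
  by field; apply/andP; split; nra.
rewrite ler_peMr; [by []|lra|].
have g2 : 4 * p ^+ 2 <= g ^+ 2 by nra.
rewrite ler_pdivlMr; last by apply: mulr_gt0; nra.
rewrite mul1r; move: x2; rewrite exprMn; nra.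
Qed.

(** The interval has length pi / p, so [2 * p < g] is Ingham's condition that it exceed 2 pi / g.
    The gap is measured by the index difference, which lets [P] select a family with holes. *)
Lemma ingham_inequality (R : realType) (p g : R) (N : nat) (P : pred 'I_N)
    (w a b : 'I_N -> R) :
  0 < p -> 2 * p < g ->
  (forall i j : 'I_N, P i -> P j -> (i < j)%N ->
     g * (j%:R - i%:R) <= w j - w i) ->
  (forall i : 'I_N, P i -> g * (i%:R + 1) <= w i) ->
  (1 - (2 * p / g) ^+ 2) / p * \sum_(i | P i) (a i ^+ 2 + b i ^+ 2) <=
  \int[lebesgue_measure]_(t in `[- (pi / (2 * p)), pi / (2 * p)])
    (cos (p * t) * trig_sum P w a b t ^+ 2).
Proof.
move=> p0 pg gapw w0.
have g0 : 0 < g by lra.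
rewrite (_ : (1 - _) / p = 2^-1 * (2 / p - 8 * p / g ^+ 2)); last first.
  by field; apply/andP; split; rewrite gt_eqF.
apply: weighted_trig_sum_ge => // i Pi.
(* A majorant of the row defined for all j: being nonnegative, it may be summed over the indices
   outside [P] too, and then telescopes. *)
pose h (j : 'I_N) := 8 * p / g ^+ 2 * ((if j == i :> nat then 0
                else (4 * (i%:R - j%:R) ^+ 2 - 1)^-1) +
     (4 * (i%:R + j%:R + 2) ^+ 2 - 1)^-1).
have c0 : 0 < 8 * p / g ^+ 2 by rewrite divr_gt0 ?mulr_gt0 ?exprn_gt0.
have i0 : 0 <= i%:R :> R by [].
have h0 j : 0 <= h j.
  have j0 : 0 <= j%:R :> R by [].
  rewrite /h mulr_ge0 ?(ltW c0) // addr_ge0 //; last by rewrite invr_ge0; nra.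
  case: ltngtP => // ij; rewrite invr_ge0.
    have : j%:R + 1 <= i%:R :> R by rewrite natr1 ler_nat.
    nra.
  have : i%:R + 1 <= j%:R :> R by rewrite natr1 ler_nat.
  nra.
apply: (@le_trans _ _ (\sum_j h j)); last first.
  rewrite -mulr_sumr -[leRHS]mulr1 ler_wpM2l ?(ltW c0) //.
  exact: sum_gap_le1.
rewrite [leRHS](bigID P) /= ler_wpDr ?sumr_ge0 //.
apply: ler_sum => j Pj; rewrite /h mulrDr lerD //; last first.
  have j0 : 0 <= j%:R :> R by [].
  apply: ingham_kernel_le_gap => //; first by lra.
  have := w0 _ Pi; have := w0 _ Pj; move=> hj hi.
  by rewrite ger0_norm; nra.
rewrite -val_eqE; case: ltngtP => ij.
- have ij' : j%:R + 1 <= i%:R :> R by rewrite natr1 ler_nat.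
  apply: ingham_kernel_le_gap => //; first by lra.
  have hh := gapw _ _ Pj Pi ij.
  by rewrite ger0_norm; nra.
- have ij' : i%:R + 1 <= j%:R :> R by rewrite natr1 ler_nat.
  have hh := gapw _ _ Pi Pj ij.
  rewrite -opprB ingham_kernelN -[(i%:R - _)]opprB sqrrN.
  apply: ingham_kernel_le_gap => //; first by lra.
  by rewrite ger0_norm; nra.
- by rewrite mulr0.
Qed.

(** The quadratic decay of the kernel cancels the weight: s_i s_j |K(w_i - w_j)| <= 8 p / (k (i -
    j)^2), whose rows are summable. The sum frequencies obey the same bound because the frequencies
    are nonnegative, and the diagonal is bounded by the value of the kernel at 0. *)
Lemma trig_sum_upper_bound (R : realType) (p k : R) (N : nat) (P : pred 'I_N)
    (w a b s : 'I_N -> R) :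
  0 < p -> 0 < k -> (forall i, 0 <= s i <= 1) -> (forall i, P i -> 0 <= w i) ->
  (forall i j : 'I_N, P i -> P j ->
     k * (s i * s j * (i%:R - j%:R) ^+ 2) <= (w i - w j) ^+ 2) ->
  \int[lebesgue_measure]_(t in `[- (pi / (2 * p)), pi / (2 * p)])
    (cos (p * t) *
     trig_sum P w (fun i => s i * a i) (fun i => s i * b i) t ^+ 2) <=
  (2 / p + 32 * p / k) * \sum_(i | P i) (a i ^+ 2 + b i ^+ 2).
Proof.
move=> p0 k0 s01 w0 sep.
have s0 i : 0 <= s i by have /andP[] := s01 i.
rewrite (_ : 2 / p + 32 * p / k = 2^-1 * (4 / p + 16 * p / k * 4)); last first.
  by field; rewrite !gt_eqF.
apply: weighted_trig_sum_le => // i Pi.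
pose h (j : 'I_N) := (if j == i then 4 / p else 0) +
  16 * p / k * 4 * (if j == i :> nat then 0
                else (4 * (i%:R - j%:R) ^+ 2 - 1)^-1).
have c0 : 0 < 16 * p / k * 4 by rewrite mulr_gt0 ?divr_gt0 ?mulr_gt0.
have i0 : 0 <= i%:R :> R by [].
have ineq (j : 'I_N) : i != j :> nat -> 1 <= (i%:R - j%:R) ^+ 2 :> R.
  case: ltngtP => // ij _.
    have : i%:R + 1 <= j%:R :> R by rewrite natr1 ler_nat.
    nra.
  have : j%:R + 1 <= i%:R :> R by rewrite natr1 ler_nat.
  nra.
have h0 j : 0 <= h j.
  rewrite /h addr_ge0 //; first by case: ifP => // _; rewrite divr_ge0 // ltW.
  rewrite mulr_ge0 ?(ltW c0) //; case: ifPn => // ji; rewrite invr_ge0.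
  by have := ineq j; rewrite eq_sym ji => /(_ isT); lra.
apply: (@le_trans _ _ (\sum_j h j)); last first.
  rewrite big_split /= -big_mkcond /= (big_pred1 i) //= lerD2l.
  rewrite -mulr_sumr -[leRHS]mulr1 ler_wpM2l ?(ltW c0) //.
  apply: (le_trans (sum_gap_diff_le R i N)).
  by rewrite gerBl mulr_ge0 // invr_ge0; lra.
rewrite [leRHS](bigID P) /= ler_wpDr ?sumr_ge0 //.
apply: ler_sum => j Pj; rewrite /h -val_eqE; case: eqP => [ji|/eqP ji].
  rewrite mulr0 addr0 (_ : 4 / p = 1 * (2 / p + 2 / p)); last by field; lra.
  have s1 : s i * s j <= 1.
    by have /andP[? ?] := s01 i; have /andP[? ?] := s01 j; rewrite mulr_ile1.
  by apply: ler_pM; rewrite ?mulr_ge0 ?addr_ge0 ?lerD ?le_ingham_kernel0.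
rewrite add0r; have := ineq j; rewrite eq_sym ji => /(_ isT) d1.
have := sep _ _ Pi Pj; set d := (i%:R - j%:R) ^+ 2 in d1 *.
have wi := w0 _ Pi; have wj := w0 _ Pj.
set S := s i * s j; have S0 : 0 <= S by rewrite mulr_ge0.
move=> kS.
have kS' : k * (S * d) <= (w i + w j) ^+ 2 by nra.
have bound x : k * (S * d) <= x ^+ 2 ->
    S * `|ingham_kernel p x| <= 16 * p / k * 2 * (4 * d - 1)^-1.
  move=> hx; apply: (@le_trans _ _ (8 * p / k * d^-1)).
    rewrite -mulrA -invfM ler_pdivlMr; last by nra.
    apply: le_trans (ingham_kernel_decay x p0).
    rewrite (_ : _ * (k * d) = k * (S * d) * `|ingham_kernel p x|); last by ring.
    by rewrite ler_wpM2r.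
  rewrite (_ : 8 * p / k * d^-1 = 16 * p / k * 2 * (4 * d)^-1); last first.
    by field; apply/andP; split; lra.
  rewrite ler_wpM2l //; first by rewrite mulr_ge0 // divr_ge0 ?mulr_ge0 // ltW.
  by rewrite lef_pV2 ?posrE; lra.
have b1 := bound _ kS; have b2 := bound _ kS'.
rewrite mulrDr; lra.
Qed.

Lemma Rintegral_subset (R : realType) (f : R -> R) (a b c d : R) :
  continuous f -> (forall x, 0 <= f x) -> c <= a -> b <= d ->
  \int[lebesgue_measure]_(x in `[a, b]) f x <=
  \int[lebesgue_measure]_(x in `[c, d]) f x.
Proof.
move=> cf f0 ca bd; rewrite /Rintegral fine_le //.
- by apply: integrable_fin_num => //; exact: continuous_integrable.
- by apply: integrable_fin_num => //; exact: continuous_integrable.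
apply: ge0_subset_integral => //=.
- exact: measurable_int (@continuous_integrable _ f c d cf).
- by move=> x _; rewrite lee_fin.
- by apply: subset_itv; rewrite bnd_simp.
Qed.

(** * Filtering by time shifts *)

Lemma trig_sum_filter_step (R : realType) (I : finType) (P : pred I)
    (w a b : I -> R) (s c X : R) :
  0 <= s -> -1 <= c <= 1 -> 0 <= X ->
  \int[lebesgue_measure]_(t in `[- X, X])
    (trig_sum P w (fun i => (cos (w i * s) - c) * a i)
                  (fun i => (cos (w i * s) - c) * b i) t ^+ 2) <=
  4 * \int[lebesgue_measure]_(t in `[- (X + s), X + s])
    (trig_sum P w a b t ^+ 2).
Proof.
move=> s0 c1 X0; set f := trig_sum P w a b.
have Ef t : trig_sum P w (fun i => (cos (w i * s) - c) * a i)
                  (fun i => (cos (w i * s) - c) * b i) t =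
    2^-1 * (f (t + s) + f (t + - s)) - c * f t.
  rewrite /f /trig_sum -big_split /= !mulr_sumr -sumrB; apply: eq_bigr => i _.
  by rewrite !mulrDr mulrN !cosB !sinB !cosD !sinD; field.
have cf : continuous f by exact: continuous_trig_sum.
have cfs u : continuous (fun t : R => f (t + u)).
  move=> x0; apply: (@continuous_comp _ _ _ (fun x => x + u) f); last exact: cf.
  by apply: continuousD; [exact: id|exact: cst_continuous].
have csq (g : R -> R) : continuous g -> continuous (fun t : R => g t ^+ 2).
  by move=> cg; apply: continuous_mul.
have shift_le u : - s <= u <= s ->
   \int[lebesgue_measure]_(t in `[- X, X]) (f (t + u) ^+ 2) <=
   \int[lebesgue_measure]_(t in `[- (X + s), X + s]) (f t ^+ 2).
  move=> us; rewrite (@Rintegral_shift _ (fun t => f t ^+ 2)); [|lra|exact: csq].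
  apply: Rintegral_subset; [exact: csq|by move=> x; exact: sqr_ge0|lra|lra].
(* From ((x + y)/2 - c z)^2 <= x^2 + y^2 + 2 z^2. Each of the three integrals is at most the one
   over the enlarged interval, and 1 + 1 + 2 = 4. *)
apply: (@le_trans _ _ (\int[lebesgue_measure]_(t in `[- X, X])
   (f (t + s) ^+ 2 + f (t + - s) ^+ 2 + 2 * f (t + 0) ^+ 2))).
  apply: le_Rintegral_continuous.
  - by apply: csq; exact: continuous_trig_sum.
  - apply: continuous_add; first by apply: continuous_add; exact: csq.
    by apply: continuous_mul; [exact: continuous_cst|exact: csq].
  move=> t _; rewrite Ef addr0.
  set x := f (t + s); set y := f (t + - s); set z := f t.
  have c2 : c ^+ 2 <= 1 by nra.
  have z2 := sqr_ge0 z; have cz : c ^+ 2 * z ^+ 2 <= z ^+ 2 by nra.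
  have := sqr_ge0 (2^-1 * (x + y) + c * z); have := sqr_ge0 (x - y); nra.
rewrite Rintegral_add; last 2 first.
- by apply: continuous_add; exact: csq.
- by apply: continuous_mul; [exact: continuous_cst|exact: csq].
rewrite Rintegral_add; [|exact: csq..].
rewrite Rintegral_scale; last exact: csq.
have h1 := shift_le s; have h2 := shift_le (- s); have h3 := shift_le 0.
lra.
Qed.

Lemma trig_sum_filter (R : realType) (I : finType) (P : pred I)
    (w a b : I -> R) (s X : R) (cs : seq R) :
  0 <= s -> all (fun c => -1 <= c <= 1) cs -> 0 <= X ->
  \int[lebesgue_measure]_(t in `[- X, X])
    (trig_sum P w (fun i => (\prod_(c <- cs) (cos (w i * s) - c)) * a i)
                  (fun i => (\prod_(c <- cs) (cos (w i * s) - c)) * b i) t ^+ 2)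
  <= 4 ^+ (size cs) *
  \int[lebesgue_measure]_(t in `[- (X + s *+ size cs), X + s *+ size cs])
    (trig_sum P w a b t ^+ 2).
Proof.
move=> s0; elim: cs X => [|c cs IH] X /=.
  move=> _ X0; rewrite mulr0n addr0 expr0 mul1r.
  rewrite le_eqVlt; apply/orP; left; apply/eqP; apply: eq_Rintegral => t _.
  by congr (_ ^+ 2); apply: eq_bigr => i _; rewrite !big_nil !mul1r.
move=> /andP[c1 cs1] X0.
under eq_Rintegral => t _.
  rewrite (_ : trig_sum _ _ _ _ t = trig_sum P w
    (fun i => (cos (w i * s) - c) * ((\prod_(c <- cs) (cos (w i * s) - c)) * a i))
    (fun i => (cos (w i * s) - c) * ((\prod_(c <- cs) (cos (w i * s) - c)) * b i)) t); last first.
    by apply: eq_bigr => i _; rewrite !big_cons !mulrA.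
  over.
apply: (le_trans (trig_sum_filter_step _ _ _ _ s0 c1 X0)).
rewrite exprS -mulrA ler_wpM2l // [s *+ _]mulrS addrA.
by apply: IH => //; rewrite addr_ge0.
Qed.

(** * Dispersion relation *)

(** By the mean value theorem sin (x/2) >= (x/2) cos (x/2), so sin x >= x cos^2 (x/2), and cos^2
    (x/2) >= 1/2 because cos x >= 0. *)
Lemma sin_ge_half (R : realType) (x : R) : 0 <= x <= pi / 2 -> x / 2 <= sin x.
Proof.
move=> /andP[]; rewrite le_eqVlt => /orP[/eqP <- _|x0 xpi].
  by rewrite mul0r sin0.
have pi0 := pi_gt0 R.
have y0 : 0 < x / 2 by lra.
have [c] := @MVT R sin cos 0 (x / 2) y0 (fun z _ => is_derive_sin z)
  (continuous_subspaceT (@continuous_sin R)).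
rewrite in_itv /= sin0 !subr0 => /andP[c0 cx] Es.
have cc : cos (x / 2) <= cos c.
  rewrite le_eqVlt; apply/orP; right; rewrite ltr_cos ?in_itv //=; lra.
have Ex : x = x / 2 + x / 2 by lra.
have sE : sin x = 2 * sin (x / 2) * cos (x / 2) by rewrite {1}Ex sinD; ring.
have cE : cos x = 2 * cos (x / 2) ^+ 2 - 1.
  by rewrite {1}Ex cosD -!expr2 [sin _ ^+ 2]sin2cos2; ring.
have cx0 : 0 <= cos x by rewrite cos_ge0_pihalf //; lra.
have cy0 : 0 <= cos (x / 2) by rewrite cos_ge0_pihalf //; lra.
rewrite sE Es; set u := cos (x / 2) in cc cE cy0 *; set v := cos c in cc *.
have u2 : 1 <= 2 * u ^+ 2 by lra.
have uv : u ^+ 2 <= v * u by nra.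
have : x * (2 * u ^+ 2) <= x * (2 * (v * u)) by nra.
nra.
Qed.

(* The dispersion relation of the scheme: with y = cos^2(eta/2), the roots L are
   the two values of h^2 lambda on the wave number eta (acoustic: L < 10,
   optical: L > 12). *)
Definition disp_poly (R : nzRingType) (y L : R) : R :=
  (2 - y) * L ^+ 2 - (44 + 16 * y) * L + 240 * (1 - y).

(** [disp_poly y L] is affine in y. Solving it for y = cos^2 (eta/2) gives cos eta =
    [disp_num L / disp_den L], a single-valued function of L covering both branches. *)
Definition disp_den (R : nzRingType) (L : R) : R := L ^+ 2 + 16 * L + 240.
Definition disp_num (R : nzRingType) (L : R) : R := 3 * L ^+ 2 - 104 * L + 240.

(** The factor [s] is a sign: one intermediate value argument covers the decreasing acoustic
    crossing and the increasing optical one. *)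
Lemma disp_root (R : realType) (y s a b : R) :
  a < b -> s * disp_poly y a < 0 -> 0 < s * disp_poly y b ->
  exists L, [/\ a < L, L < b & disp_poly y L = 0].
Proof.
move=> ab fa fb.
pose p : {poly R} := s *: ((2 - y) *: 'X^2 - (44 + 16 * y) *: 'X + (240 * (1 - y))%:P).
have Ep x : p.[x] = s * disp_poly y x by rewrite !hornerE /disp_poly /=; ring.
have [|x /andP[ax xb] /rootP] := @poly_ivt R p a b (ltW ab).
  by rewrite !Ep !ltW.
rewrite Ep => px0.
have s0 : s != 0 by apply: contraTneq fa => ->; rewrite mul0r ltxx.
have x0 : disp_poly y x = 0 by move/eqP: px0; rewrite mulf_eq0 (negPf s0) => /eqP.
exists x; split => //.
- by rewrite lt_neqAle ax andbT; apply: contraTneq fa => ->; rewrite x0 mulr0 ltxx.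
- by rewrite lt_neqAle xb andbT; apply: contraTneq fb => <-; rewrite x0 mulr0 ltxx.
Qed.

Lemma acoustic_root (R : realType) (y : R) : 0 < y < 1 ->
  exists L, [/\ 0 < L, L < 10, disp_poly y L = 0 & 1 / 2 <= y -> L < 5 / 2].
Proof.
move=> /andP[y0 y1]; have [y2|y2] := lerP (1 / 2) y.
  (* At y = 1/2, that is eta = pi/2, the acoustic root is about 2.49. The end points 0, 10 and 12,
     60 of the branches are the roots at y = 1 and y = 0: {0, 60} and {10, 12}. *)
  have [|||L [L0 L1 PL]] := @disp_root R y (-1) 0 (5 / 2); rewrite /disp_poly; try lra.
  by exists L; split => //; lra.
have [|||L [L0 L1 PL]] := @disp_root R y (-1) 0 10; rewrite /disp_poly; try lra.
exists L; split => //; lra.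
Qed.

Lemma optical_root (R : realType) (y : R) : 0 < y < 1 ->
  exists L, [/\ 12 < L, L < 60 & disp_poly y L = 0].
Proof.
move=> /andP[y0 y1].
by apply: (@disp_root R y 1 12 60); rewrite /disp_poly; lra.
Qed.

Lemma disp_den_gt0 (R : realType) (L : R) : 0 <= L -> 0 < disp_den L.
Proof. by move=> L0; rewrite /disp_den; nra. Qed.

Lemma disp_cos (R : realType) (y L : R) : 0 <= L -> disp_poly y L = 0 ->
  2 * y - 1 = disp_num L / disp_den L.
Proof.
move=> L0 PL; have D0 := disp_den_gt0 L0.
apply/eqP; rewrite -subr_eq0 -(mulrI_eq0 _ (lregP (lt0r_neq0 D0))); apply/eqP.
rewrite mulrBr mulrCA divff ?gt_eqF // mulr1.
by move: PL; rewrite /disp_poly /disp_num /disp_den; lra.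
Qed.

Lemma disp_quot_sub (R : realType) (x y : R) : 0 <= x -> 0 <= y ->
  disp_num x / disp_den x - disp_num y / disp_den y =
  (x - y) * (8 * (19 * (x * y) + 60 * (x + y) - 60 ^+ 2)) / (disp_den x * disp_den y).
Proof.
move=> x0 y0; have := disp_den_gt0 x0; have := disp_den_gt0 y0.
rewrite /disp_num /disp_den => dy dx; field.
by rewrite !gt_eqF.
Qed.

Lemma disp_quot_lt (R : realType) (x y : R) : 0 <= x -> x < y -> y <= 4 ->
  disp_num y / disp_den y < disp_num x / disp_den x.
Proof.
move=> x0 xy y4; have y0 : 0 <= y by lra.
rewrite -subr_lt0 disp_quot_sub //.
have dx := disp_den_gt0 x0; have dy := disp_den_gt0 y0.
have xy16 : y * x <= 16 by nra.
rewrite pmulr_llt0 ?invr_gt0 ?mulr_gt0 // pmulr_rlt0 ?subr_gt0 //; lra.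
Qed.

(** At x = y = 60 the second factor of the numerator is 8 * 20 * 60^2 = 10 * 240^2, while both
    denominators are at least 240. *)
Lemma disp_quot_lipschitz (R : realType) (x y : R) :
  0 <= x <= 60 -> 0 <= y <= 60 ->
  `|disp_num x / disp_den x - disp_num y / disp_den y| <= 10 * `|x - y|.
Proof.
move=> /andP[x0 x1] /andP[y0 y1]; rewrite disp_quot_sub // -mulrA normrM mulrC.
rewrite ler_wpM2r //.
have dx : 240 <= disp_den x by rewrite /disp_den; nra.
have dy : 240 <= disp_den y by rewrite /disp_den; nra.
have dd : 240 ^+ 2 <= disp_den x * disp_den y by nra.
have xy : 0 <= x * y <= 60 ^+ 2 by apply/andP; split; nra.
rewrite normrM normfV [`|_ * disp_den y|]ger0_norm; last lra.
rewrite ler_pdivrMr; last lra.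
by rewrite ler_norml; apply/andP; split; lra.
Qed.

(* The group velocity of the low acoustic modes is at least 1. *)
Lemma disp_velocity (R : realType) (L : R) : 0 <= L <= 4 ->
  32 * (60 ^+ 2 - 120 * L - 19 * L ^+ 2) ^+ 2 <=
  (60 - L) * (10 - L) * (12 - L) * disp_den L ^+ 2.
Proof.
move=> /andP[L0 L4]; rewrite -subr_ge0.
have -> : (60 - L) * (10 - L) * (12 - L) * disp_den L ^+ 2 -
  32 * (60 ^+ 2 - 120 * L - 19 * L ^+ 2) ^+ 2 =
  L ^+ 2 * (120 ^+ 2 * (200 - 28 * L) + 20 * 112 * L ^+ 2 + 448 * L ^+ 3
            + L ^+ 4 * (50 - L)) by rewrite /disp_den; ring.
apply: mulr_ge0; first exact: sqr_ge0.
have h1 : 0 <= 200 - 28 * L by lra.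
have h2 : 0 <= 50 - L by lra.
apply: addr_ge0; last exact: mulr_ge0 (exprn_ge0 4 L0) h2.
apply: addr_ge0; last exact: mulr_ge0 (ler0n _ 448) (exprn_ge0 3 L0).
apply: addr_ge0; first exact: mulr_ge0 (sqr_ge0 120) h1.
exact: mulr_ge0 (mulr_ge0 (ler0n _ 20) (ler0n _ 112)) (exprn_ge0 2 L0).
Qed.

(** The inverse dispersion relation: the wave number as a function of w = sqrt L. Frequency gaps
    follow from bounding its slope by 1, without expressing L through eta. *)
Definition disp_phase (R : realType) (w : R) : R :=
  acos (disp_num (w ^+ 2) / disp_den (w ^+ 2)).

Lemma disp_quot_bounds (R : realType) (w : R) : 0 < w <= 2 ->
  -1 < disp_num (w ^+ 2) / disp_den (w ^+ 2) < 1.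
Proof.
move=> /andP[w0 w2]; have L0 : 0 < w ^+ 2 by nra.
have L4 : w ^+ 2 <= 4 by nra.
have D0 := disp_den_gt0 (ltW L0).
rewrite ltr_pdivlMr // ltr_pdivrMr // /disp_num /disp_den.
by apply/andP; split; nra.
Qed.

Lemma is_derive_disp_quot (R : realType) (w : R) :
  is_derive w 1 (fun v : R => disp_num (v ^+ 2) / disp_den (v ^+ 2))
    (16 * w * (19 * w ^+ 4 + 120 * w ^+ 2 - 60 ^+ 2) / disp_den (w ^+ 2) ^+ 2).
Proof.
have D0 v : disp_den (v ^+ 2 : R) != 0.
  by rewrite gt_eqF // disp_den_gt0 // sqr_ge0.
have h1 : is_derive w 1 (fun v : R => disp_num (v ^+ 2)) (12 * w ^+ 3 - 208 * w).
  by apply: is_derive_eq; rewrite /GRing.scale /=; ring.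
have h2 : is_derive w 1 (fun v : R => disp_den (v ^+ 2)) (4 * w ^+ 3 + 32 * w).
  by apply: is_derive_eq; rewrite /GRing.scale /=; ring.
have h3 := @is_deriveV _ (fun v : R => disp_den (v ^+ 2)) w _ 1 (D0 w) h2.
have h := is_deriveM h1 h3.
apply: (is_derive_eq h); move: (D0 w); rewrite /GRing.scale /= /disp_num /disp_den.
by move=> d0; field.
Qed.

(** With q the cosine of the phase, a slope at most 1 means q'^2 <= 1 - q^2. The difference of the
    two sides factors as 8 L / [disp_den L ^+ 4] times the difference in [disp_velocity]. *)
Lemma disp_phase_lipschitz (R : realType) (w1 w2 : R) :
  0 < w1 -> w1 <= w2 -> w2 <= 2 ->
  disp_phase w2 - disp_phase w1 <= w2 - w1.
Proof.
move=> w10 w12 w2le.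
pose q (v : R) := disp_num (v ^+ 2) / disp_den (v ^+ 2).
pose dphi (w : R) := - (Num.sqrt (1 - q w ^+ 2))^-1 *
  (16 * w * (19 * w ^+ 4 + 120 * w ^+ 2 - 60 ^+ 2) / disp_den (w ^+ 2) ^+ 2).
have dd w : w1 <= w <= w2 -> is_derive w 1 (@disp_phase R) (dphi w).
  move=> /andP[h1 h2].
  have qb : -1 < q w < 1 by apply: disp_quot_bounds; apply/andP; split; lra.
  exact: is_derive1_comp (is_derive1_acos qb) (is_derive_disp_quot w).
have [| |c] := @MVT_segment R (@disp_phase R) dphi w1 w2 w12.
- move=> x; rewrite in_itv /= => /andP[/ltW ? /ltW ?]; apply: dd; exact/andP.
- apply: derivable_within_continuous => x; rewrite in_itv /= => xw.
  by case: (dd x xw).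
rewrite in_itv /= => /andP[c1 c2] ->.
rewrite -[leRHS]mul1r ler_wpM2r ?subr_ge0 // /dphi.
have c0 : 0 < c by lra.
have L0 : 0 < c ^+ 2 by nra.
have L4 : c ^+ 2 <= 4 by nra.
have D0 := disp_den_gt0 (ltW L0).
have /andP[q1 q2] : -1 < q c < 1 by apply: disp_quot_bounds; apply/andP; split; lra.
have q0 : 0 < 1 - q c ^+ 2 by nra.
rewrite mulNr -mulrN ler_pdivrMl ?sqrtr_gt0 // mulr1.
set z := - _; have z0 : 0 <= z.
  rewrite /z -mulNr divr_ge0 ?sqr_ge0 //; set c2' := c ^+ 2 in L0 L4 *.
  have -> : c ^+ 4 = c2' ^+ 2 by rewrite /c2'; ring.
  by rewrite -mulrN mulr_ge0 //; nra.
rewrite -(ger0_norm z0) -sqrtr_sqr; apply: ler_wsqrtr; rewrite /z /q /disp_num.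
have vel := @disp_velocity R (c ^+ 2) _.
have {}vel : 32 * (60 ^+ 2 - 120 * c ^+ 2 - 19 * (c ^+ 2) ^+ 2) ^+ 2 <=
  (60 - c ^+ 2) * (10 - c ^+ 2) * (12 - c ^+ 2) * disp_den (c ^+ 2) ^+ 2.
  by apply: vel; rewrite ltW.
rewrite -subr_ge0.
set L := c ^+ 2 in L0 L4 D0 vel *.
have -> : 1 - ((3 * L ^+ 2 - 104 * L + 240) / disp_den L) ^+ 2 -
   (- (16 * c * (19 * c ^+ 4 + 120 * L - 60 ^+ 2) / disp_den L ^+ 2)) ^+ 2 =
   8 * L / disp_den L ^+ 4 * ((60 - L) * (10 - L) * (12 - L) * disp_den L ^+ 2 -
     32 * (60 ^+ 2 - 120 * L - 19 * L ^+ 2) ^+ 2).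
  move: (D0); rewrite /disp_den /L => D0'; field; by rewrite gt_eqF.
rewrite mulr_ge0 ?subr_ge0 // divr_ge0 ?exprn_ge0 ?mulr_ge0 //; exact: ltW.
Qed.

Lemma disp_phase_le (R : realType) (w : R) : 0 < w <= 2 -> disp_phase w <= w.
Proof.
move=> /andP[w0 w2]; rewrite leNgt; apply/negP => ww.
have pi2 := pi_ge2 R.
(* The arccosine is not differentiable at 1, so the Lipschitz bound starts at a small e > 0 instead
   of 0. There the crude bound [disp_phase e <= 2 * e] is enough for a contradiction, as e is at
   most half the assumed excess. *)
pose e := Num.min w ((disp_phase w - w) / 2).
have e0 : 0 < e by rewrite lt_min w0 /=; lra.
have ew : e <= w by rewrite ge_min lexx.
have ed : e <= (disp_phase w - w) / 2 by rewrite ge_min lexx orbT.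
have := disp_phase_lipschitz e0 ew w2.
suff : disp_phase e <= 2 * e by lra.
have L0 : 0 < e ^+ 2 by nra.
have L4 : e ^+ 2 <= 4 by nra.
have D0 := disp_den_gt0 (ltW L0).
have eb : 0 < e <= 2 by apply/andP; split; lra.
have /andP[q1 q2] := disp_quot_bounds eb.
have [epi|epi] := lerP e (pi / 2); last first.
  apply: (le_trans (@acos_lepi _ _ _)); last lra.
  by rewrite !ltW.
have se := @sin_ge_half R e; have {}se : e / 2 <= sin e by apply: se; lra.
have cE : cos (2 * e) = 1 - 2 * sin e ^+ 2.
  by rewrite (_ : 2 * e = e + e) ?cosD -?expr2 ?cos2sin2; ring.
have cq : cos (2 * e) <= disp_num (e ^+ 2) / disp_den (e ^+ 2).
  rewrite cE ler_pdivlMr //.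
  have s2 : e ^+ 2 / 4 <= sin e ^+ 2 by nra.
  apply: (@le_trans _ _ ((1 - e ^+ 2 / 2) * disp_den (e ^+ 2))).
    by apply: ler_wpM2r; [exact: ltW|lra].
  by rewrite /disp_num /disp_den; set L := e ^+ 2 in L0 L4 *; nra.
rewrite leNgt; apply/negP => lt1.
have ab : cos (disp_phase e) < cos (2 * e).
  have m1 : disp_phase e \in `[0, pi] by rewrite in_itv /= acos_ge0 ?acos_lepi // !ltW.
  have m2 : 2 * e \in `[0, pi] by rewrite in_itv /=; apply/andP; split; lra.
  by rewrite ltr_cos.
move: ab; rewrite /disp_phase acosK ?in_itv /= ?ltW // ltNge cq //.
Qed.

(** * Wave numbers, gaps and separation of the discrete frequencies *)

Definition wavenumber (R : realType) (N k : nat) : R :=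
  k.+1%:R * pi / N.+1%:R.

Definition disp_roots (R : realType) (N : nat) (La Lo : 'I_N -> R) : Prop :=
  (forall k : 'I_N, let y := cos (wavenumber R N k / 2) ^+ 2 in
     [/\ 0 < La k, La k < 10, disp_poly y (La k) = 0 &
         1 / 2 <= y -> La k < 5 / 2]) /\
  (forall k : 'I_N, [/\ 12 < Lo k, Lo k < 60 &
     disp_poly (cos (wavenumber R N k / 2) ^+ 2) (Lo k) = 0]).

Lemma wavenumber_bounds (R : realType) (N : nat) (k : 'I_N) :
  0 < wavenumber R N k < pi.
Proof.
have pi0 := pi_gt0 R; rewrite /wavenumber divr_gt0 ?mulr_gt0 //=.
by rewrite ltr_pdivrMr // mulrC ltr_pM2l // ltr_nat ltnS ltn_ord.
Qed.

Lemma cos_half_sqr (R : realType) (x : R) : 2 * cos (x / 2) ^+ 2 - 1 = cos x.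
Proof.
have {2}-> : x = x / 2 + x / 2 by lra.
by rewrite cosD -!expr2 [sin _ ^+ 2]sin2cos2; ring.
Qed.

Lemma cos_half_sqr_bounds (R : realType) (N : nat) (k : 'I_N) :
  0 < cos (wavenumber R N k / 2) ^+ 2 < 1.
Proof.
have /andP[x0 xpi] := @wavenumber_bounds R N k.
have c0 : 0 < cos (wavenumber R N k / 2) by apply: cos_gt0_pihalf; lra.
have s0 : 0 < sin (wavenumber R N k / 2) by apply: sin_gt0_pi; lra.
have := cos2Dsin2 (wavenumber R N k / 2); set c := cos _ in c0 *; set s := sin _ in s0 *.
by move=> E; apply/andP; split; nra.
Qed.

Lemma disp_roots_exist (R : realType) (N : nat) :
  exists La Lo : 'I_N -> R, disp_roots La Lo.
Proof.
have [La hLa] := choice (fun k => acoustic_root (@cos_half_sqr_bounds R N k)).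
have [Lo hLo] := choice (fun k => optical_root (@cos_half_sqr_bounds R N k)).
by exists La, Lo.
Qed.

Lemma disp_root_cos (R : realType) (N : nat) (k : nat) (L : R) : 0 <= L ->
  disp_poly (cos (wavenumber R N k / 2) ^+ 2) L = 0 ->
  cos (wavenumber R N k) = disp_num L / disp_den L.
Proof. by move=> L0 /(disp_cos L0); rewrite cos_half_sqr. Qed.

Definition frequency (R : realType) (N : nat) (L : R) : R :=
  Num.sqrt L * N.+1%:R.

Lemma wavenumber_sub (R : realType) (N k l : nat) :
  wavenumber R N k - wavenumber R N l = (k%:R - l%:R) * pi / N.+1%:R.
Proof. by rewrite /wavenumber -!natr1; field; rewrite natr1 pnatr_eq0. Qed.

(** Write cos x - cos y as a product of sines: sin^2 ((x+y)/2) >= sin x sin y supplies the weight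
    and sin^2 ((x-y)/2) the index difference. Conversely |cos x - cos y| <= 10 |L - L'| <= 160 |sqrt
    L - sqrt L'|, since sqrt 60 < 8. *)
Lemma frequency_separation (R : realType) (N : nat) (L : 'I_N -> R) :
  (forall k, 0 < L k < 60) ->
  (forall k : 'I_N, disp_poly (cos (wavenumber R N k / 2) ^+ 2) (L k) = 0) ->
  forall k l : 'I_N,
  (160 ^+ 2)^-1 * (sin (wavenumber R N k) * sin (wavenumber R N l) *
                  (k%:R - l%:R) ^+ 2) <=
  (frequency N (L k) - frequency N (L l)) ^+ 2.
Proof.
move=> L60 PL k l.
have /andP[k0 k60] := L60 k; have /andP[l0 l60] := L60 l.
have /andP[ek0 ek_pi] := @wavenumber_bounds R N k.
have /andP[el0 el_pi] := @wavenumber_bounds R N l.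
have sk : 0 < sin (wavenumber R N k) by apply: sin_gt0_pi; apply/andP.
have sl : 0 < sin (wavenumber R N l) by apply: sin_gt0_pi; apply/andP.
set x := wavenumber R N k in ek0 ek_pi sk *; set y := wavenumber R N l in el0 el_pi sl *.
have kk : 0 <= L k <= 60 by rewrite !ltW.
have ll : 0 <= L l <= 60 by rewrite !ltW.
have := disp_quot_lipschitz kk ll.
rewrite -(disp_root_cos (ltW k0) (PL k)) -(disp_root_cos (ltW l0) (PL l)).
rewrite -/x -/y => lip.
pose u := Num.sqrt (L k); pose v := Num.sqrt (L l).
have u2 : u ^+ 2 = L k by rewrite sqr_sqrtr // ltW.
have v2 : v ^+ 2 = L l by rewrite sqr_sqrtr // ltW.
have u0 : 0 <= u by exact: sqrtr_ge0.
have v0 : 0 <= v by exact: sqrtr_ge0.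
have u8 : u <= 8 by nra.
have v8 : v <= 8 by nra.
have {}lip : (cos x - cos y) ^+ 2 <= 160 ^+ 2 * (u - v) ^+ 2.
  rewrite -exprMn -(real_normK (num_real (cos x - cos y))).
  rewrite -(real_normK (num_real (160 * (u - v)))) lerXn2r ?nnegrE //.
  apply: (le_trans lip); rewrite -u2 -v2 subr_sqr normrM.
  rewrite (ger0_norm (addr_ge0 u0 v0)) normrM (ger0_norm (ler0n _ 160)).
  have := normr_ge0 (u - v); nra.
have cE : (cos x - cos y) ^+ 2 =
    4 * sin ((x + y) / 2) ^+ 2 * sin ((x - y) / 2) ^+ 2.
  rewrite (_ : cos x = cos ((x + y) / 2 + (x - y) / 2)); last by congr cos; lra.
  rewrite (_ : cos y = cos ((x + y) / 2 - (x - y) / 2)); last by congr cos; lra.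
  by rewrite cosB cosD; ring.
have s1 : sin x * sin y <= sin ((x + y) / 2) ^+ 2.
  have h := cos_half_sqr (x + y).
  have h2 := cos_le1 (x - y).
  rewrite sin2cos2; move: h h2; rewrite cosB cosD; lra.
have s2 : ((x - y) / 4) ^+ 2 <= sin ((x - y) / 2) ^+ 2.
  have half z : 0 <= z <= pi / 2 -> (z / 2) ^+ 2 <= sin z ^+ 2.
    by move=> zb; have := sin_ge_half zb; have /andP[z0 _] := zb; nra.
  have -> : (x - y) / 4 = ((x - y) / 2) / 2 by lra.
  have [xy|xy] := lerP y x.
    by apply: half; lra.
  have -> : (x - y) / 2 = - ((y - x) / 2) by lra.
  by rewrite mulNr sinN !sqrrN; apply: half; lra.
have n0 : 0 < N.+1%:R :> R by [].
have -> : (frequency N (L k) - frequency N (L l)) ^+ 2 =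
    N.+1%:R ^+ 2 * (u - v) ^+ 2 by rewrite /frequency -/u -/v; ring.
have xyE : x - y = (k%:R - l%:R) * pi / N.+1%:R by exact: wavenumber_sub.
have pi2 := pi_ge2 R.
rewrite ler_pdivrMl ?exprn_gt0 // [leRHS]mulrCA.
apply: (@le_trans _ _ (N.+1%:R ^+ 2 * (cos x - cos y) ^+ 2)); last first.
  by apply: ler_wpM2l => //; exact: sqr_ge0.
rewrite cE.
apply: (@le_trans _ _ (N.+1%:R ^+ 2 * (4 * (sin x * sin y) * ((x - y) / 4) ^+ 2))).
  rewrite xyE.
  have -> : N.+1%:R ^+ 2 * (4 * (sin x * sin y) *
     ((k%:R - l%:R) * pi / N.+1%:R / 4) ^+ 2) =
     sin x * sin y * (k%:R - l%:R) ^+ 2 * (pi / 2) ^+ 2.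
    by field; rewrite gt_eqF.
  rewrite ler_peMr //; first by rewrite mulr_ge0 ?sqr_ge0 // mulr_ge0 // ltW.
  nra.
apply: ler_wpM2l; first exact: sqr_ge0.
apply: ler_pM => //; first by rewrite mulr_ge0 // mulr_ge0 // ltW.
  exact: sqr_ge0.
by rewrite ler_wpM2l.
Qed.

Lemma disp_phase_root (R : realType) (N : nat) (k : 'I_N) (L : R) : 0 < L ->
  disp_poly (cos (wavenumber R N k / 2) ^+ 2) L = 0 ->
  disp_phase (Num.sqrt L) = wavenumber R N k.
Proof.
move=> L0 PL; have /andP[e0 epi] := @wavenumber_bounds R N k.
rewrite /disp_phase sqr_sqrtr ?ltW // -(disp_root_cos (ltW L0) PL) cosK //.
by rewrite in_itv /= !ltW.
Qed.

Lemma frequency_ge (R : realType) (N : nat) (k : 'I_N) (L : R) : 0 < L <= 4 ->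
  disp_poly (cos (wavenumber R N k / 2) ^+ 2) L = 0 ->
  pi * (k%:R + 1) <= frequency N L.
Proof.
move=> /andP[L0 L4] PL.
have s0 : 0 < Num.sqrt L by rewrite sqrtr_gt0.
have s2 : Num.sqrt L ^+ 2 = L by rewrite sqr_sqrtr // ltW.
have := @disp_phase_le R (Num.sqrt L); rewrite (disp_phase_root L0 PL) s0 /=.
move=> h; have {}h := h ltac:(nra).
have -> : pi * (k%:R + 1) = wavenumber R N k * N.+1%:R :> R.
  by rewrite /wavenumber divfK ?pnatr_eq0 // natr1 mulrC.
by rewrite ler_wpM2r.
Qed.

(** The phase grows at most as fast as the frequency, so phases pi h (l - k) apart give frequencies
    at least pi (l - k) apart. The slope bound is one-sided, hence L <= L' is first obtained from
    the monotonicity of the cosine quotient. *)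
Lemma frequency_gap (R : realType) (N : nat) (k l : 'I_N) (L L' : R) :
  (k < l)%N -> 0 < L <= 4 -> 0 < L' <= 4 ->
  disp_poly (cos (wavenumber R N k / 2) ^+ 2) L = 0 ->
  disp_poly (cos (wavenumber R N l / 2) ^+ 2) L' = 0 ->
  pi * (l%:R - k%:R) <= frequency N L' - frequency N L.
Proof.
move=> kl /andP[L0 L4] /andP[L'0 L'4] PL PL'.
have pi0 := pi_gt0 R.
have /andP[ek0 ek_pi] := @wavenumber_bounds R N k.
have /andP[el0 el_pi] := @wavenumber_bounds R N l.
have ekl : wavenumber R N k < wavenumber R N l.
  by rewrite /wavenumber ltr_pM2r ?invr_gt0 // ltr_pM2r // ltr_nat.
have LL : L <= L'.
  rewrite leNgt; apply/negP => LL.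
  have := disp_quot_lt (ltW L'0) LL L4.
  rewrite -(disp_root_cos (ltW L'0) PL') -(disp_root_cos (ltW L0) PL).
  rewrite ltr_cos ?in_itv /=; [lra|by rewrite !ltW|by rewrite !ltW].
have s0 : 0 < Num.sqrt L by rewrite sqrtr_gt0.
have ss : Num.sqrt L <= Num.sqrt L' by rewrite ler_wsqrtr.
have s2 : Num.sqrt L' <= 2.
  have := sqr_sqrtr (ltW L'0); have := sqrtr_ge0 L'; nra.
have := disp_phase_lipschitz s0 ss s2.
rewrite (disp_phase_root L0 PL) (disp_phase_root L'0 PL') wavenumber_sub.
rewrite /frequency -mulrBl => h.
rewrite -ler_pdivrMr // mulrC [_ * pi]mulrC in h *.
by rewrite mulrC.
Qed.

(** * Damping of the high frequencies *)

Definition filter_gain (R : realType) (s : R) (cs : seq R) (w : R) : R :=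
  \prod_(c <- cs) (cos (w * s) - c).

(* All acoustic modes with eta <= pi/2 have L < 5/2; the acoustic modes with
   4 < L and the optical ones have no uniform spectral gap. *)
Definition adapted_filter (R : realType) (N : nat) (K d th : R) : Prop :=
  forall La Lo : 'I_N -> R, disp_roots La Lo ->
  exists (s g : R) (cs : seq R),
    [/\ 0 <= s, all (fun c => -1 <= c <= 1) cs, s *+ size cs <= d,
        0 < g & 4 ^+ size cs <= K * g ^+ 2] /\
    [/\ forall k, La k < 5 / 2 ->
          g ^+ 2 <= filter_gain s cs (frequency N (La k)) ^+ 2,
        forall k, 4 < La k ->
          filter_gain s cs (frequency N (La k)) ^+ 2 <= th * g ^+ 2 &
        forall k, filter_gain s cs (frequency N (Lo k)) ^+ 2 <= th * g ^+ 2].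

Lemma cos_le_pi (R : realType) (x y : R) :
  0 <= x -> x <= y -> y <= pi -> cos y <= cos x.
Proof.
move=> x0; rewrite le_eqVlt => /orP[/eqP -> //|xy] ypi.
rewrite ltW // ltr_cos ?in_itv //=; apply/andP; split; lra.
Qed.

Lemma sqrt_lt_sqr (R : realType) (L c : R) : 0 <= c -> L < c ^+ 2 ->
  Num.sqrt L <= c.
Proof. by move=> c0 Lc; rewrite -(ger0_norm c0) -sqrtr_sqr ler_wsqrtr // ltW. Qed.

Lemma lt_sqrt_sqr (R : realType) (L c : R) : 0 <= c -> c ^+ 2 < L ->
  c <= Num.sqrt L.
Proof. by move=> c0 Lc; rewrite -(ger0_norm c0) -sqrtr_sqr ler_wsqrtr // ltW. Qed.

Lemma bad_sqrt (R : realType) (L : R) : 4 < L -> L < 60 ->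
  2 <= Num.sqrt L <= 8.
Proof. by move=> h1 h2; rewrite lt_sqrt_sqr ?sqrt_lt_sqr //; lra. Qed.

Lemma low_sqrt (R : realType) (L : R) : L < 5 / 2 -> 0 <= Num.sqrt L <= 8 / 5.
Proof. by move=> h; rewrite sqrtr_ge0 sqrt_lt_sqr //; lra. Qed.

(* The step pi h / 10 puts 2 h w and 8 h w, the ends of the range of the
   frequencies to be damped, symmetrically with respect to pi / 2. *)
Lemma large_filter (R : realType) (d th : R) : 0 < d -> 0 < th ->
  exists (N0 : nat) (K : R), 0 <= K /\
    forall N, (N0 <= N)%N -> adapted_filter N K d th.
Proof.
move=> d0 th0; have pi0 := pi_gt0 R.
(* The phases to keep are at most (8/5) pi/10, so their cosine is at least g; those to damp lie
   between 2 pi/10 and 8 pi/10, so their cosine is at most l < g in absolute value. *)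
pose g : R := cos (8 / 50 * pi); pose l : R := cos (2 / 10 * pi).
have l0 : 0 < l by apply: cos_gt0_pihalf; lra.
have lg : l < g by rewrite /l /g ltr_cos ?in_itv /=; lra.
have g0 : 0 < g by lra.
pose z := (l / g) ^+ 2.
have z1 : `|z| < 1.
  rewrite ger0_norm ?sqr_ge0 // /z expr_lt1 // ?ltr_pdivrMr ?mul1r //.
  by rewrite divr_ge0 // ltW.
have [m _ /(_ m (leqnn m)) zm] : \forall n \near \oo, z ^+ n < th.
  have /cvgrPdist_lt /(_ th th0) := cvg_expr z1.
  apply: filterS => n; rewrite sub0r normrN; apply: le_lt_trans; exact: ler_norm.
(* From this N on, m shifts of length pi h / 10 fit into the extra time d. *)
pose N0 := (Num.truncn (m%:R * pi / (10 * d) : R)).+1.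
have hN0 : m%:R * pi / (10 * d) < N0%:R by rewrite truncnS_gt.
exists N0, (4 ^+ m / (g ^+ m) ^+ 2); split.
  by rewrite divr_ge0 ?sqr_ge0 ?exprn_ge0.
move=> N NN0 La Lo [hLa hLo].
have n0 : 0 < N.+1%:R :> R by [].
exists (pi / (10 * N.+1%:R)), (g ^+ m), (nseq m 0).
have gain (L : R) : filter_gain (pi / (10 * N.+1%:R)) (nseq m 0) (frequency N L) =
    cos (Num.sqrt L / 10 * pi) ^+ m.
  rewrite /filter_gain big_nseq subr0 /frequency.
  rewrite (_ : Num.sqrt L * _ * _ = Num.sqrt L / 10 * pi); last first.
    by field; rewrite gt_eqF.
  by elim: (m) => //= k ->; rewrite exprS.
have damp (L : R) : 4 < L -> L < 60 -> cos (Num.sqrt L / 10 * pi) ^+ m ^+ 2 <=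
    th * (g ^+ m) ^+ 2.
  move=> h1 h2; have /andP[b1 b2] := bad_sqrt h1 h2.
  have c1 : cos (Num.sqrt L / 10 * pi) <= l by apply: cos_le_pi; nra.
  have c2 : - l <= cos (Num.sqrt L / 10 * pi).
    rewrite (_ : - l = cos (8 / 10 * pi)); last first.
      by rewrite (_ : 8 / 10 * pi = - (2 / 10 * pi) + pi) ?cosDpi ?cosN //; lra.
    by apply: cos_le_pi; nra.
  have c3 : cos (Num.sqrt L / 10 * pi) ^+ 2 <= l ^+ 2 by nra.
  rewrite -!exprM ![(m * 2)%N]mulnC !exprM.
  apply: (@le_trans _ _ ((l ^+ 2) ^+ m)).
    by apply: lerXn2r; rewrite ?nnegrE ?sqr_ge0.
  have -> : l ^+ 2 = z * g ^+ 2 by rewrite /z; field; lra.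
  by rewrite exprMn ler_wpM2r ?exprn_ge0 ?sqr_ge0 // ltW.
split; split.
- by rewrite divr_ge0 ?mulr_ge0 // ltW.
- by rewrite all_nseq; apply/orP; right; lra.
- rewrite size_nseq -[_ *+ m]mulr_natr.
  have nN : m%:R * pi / (10 * d) <= N.+1%:R.
    by apply: (le_trans (ltW hN0)); rewrite ler_nat leqW.
  move: nN; rewrite ler_pdivrMr; last by lra.
  rewrite mulrAC ler_pdivrMr; last by lra.
  nra.
- exact: exprn_gt0.
- by rewrite size_nseq divfK // expf_neq0 // expf_neq0 // gt_eqF.
- move=> k hk; rewrite gain; have /andP[r0 r1] := low_sqrt hk.
  have c1 : g <= cos (Num.sqrt (La k) / 10 * pi) by apply: cos_le_pi; nra.
  have gm0 : 0 < g ^+ m by exact: exprn_gt0.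
  have gm : g ^+ m <= cos (Num.sqrt (La k) / 10 * pi) ^+ m.
    by apply: lerXn2r => //; rewrite nnegrE; lra.
  nra.
- by move=> k hk; rewrite gain; apply: damp => //; have [_ ? _ _] := hLa k; lra.
- by move=> k; rewrite gain; have [? ? _] := hLo k; apply: damp; lra.
Qed.

Lemma prod_ge_const (R : realFieldType) (d : R) (l : seq R) : 0 <= d ->
  all (fun x => d <= x) l -> d ^+ size l <= \prod_(x <- l) x.
Proof.
move=> d0; elim: l => [|x l IH] /=; first by rewrite big_nil.
move=> /andP[dx dl]; rewrite big_cons exprS; apply: ler_pM => //.
  exact: exprn_ge0.
exact: IH.
Qed.

(* For fixed N all the unwanted frequencies can be annihilated exactly. *)
Lemma small_filter (R : realType) (N : nat) (d th : R) : 0 < d -> 0 < th ->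
  exists K : R, 0 <= K /\ adapted_filter N K d th.
Proof.
move=> d0 th0; have pi0 := pi_gt0 R; have pi2 := pi_ge2 R.
have n0 : 0 < N.+1%:R :> R by [].
(* The first bound makes all 2 N factors fit into the time d; the second keeps every phase, at most
   8 s / h, within [0, pi], where the cosine decreases. *)
pose s : R := Num.min (d / (N + N).+1%:R) (pi / (8 * N.+1%:R)).
have s0 : 0 < s by rewrite lt_min !divr_gt0 // mulr_gt0.
have sd : s * (N + N).+1%:R <= d.
  by rewrite -ler_pdivlMr // ge_min lexx.
have sp : 8 * N.+1%:R * s <= pi.
  by rewrite mulrC -ler_pdivlMr ?mulr_gt0 // ge_min lexx orbT.
pose q := N.+1%:R * s.
have q0 : 0 < q by rewrite mulr_gt0.
have sq : 8 * q <= pi by rewrite /q mulrA.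
pose g1 : R := cos (8 / 5 * q) - cos (2 * q).
have g10 : 0 < g1.
  by rewrite subr_gt0 ltr_cos ?in_itv /=; lra.
exists (4 ^+ (N + N) / (g1 ^+ (N + N)) ^+ 2); split.
  by rewrite divr_ge0 ?exprn_ge0 // ltW.
move=> La Lo [hLa hLo].
(* An acoustic mode that needs no damping is replaced by the optical one of the same index, so that
   the number of factors is always 2 N. *)
pose f (k : 'I_N) := if 4 < La k then La k else Lo k.
have fbad k : 2 <= Num.sqrt (f k) <= 8.
  have [? ? _ _] := hLa k; have [? ? _] := hLo k.
  by rewrite /f; case: ifP => ?; apply: bad_sqrt; lra.
have obad k : 2 <= Num.sqrt (Lo k) <= 8.
  by have [? ? _] := hLo k; apply: bad_sqrt; lra.
pose ws := [seq frequency N (f k) | k <- enum 'I_N] ++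
           [seq frequency N (Lo k) | k <- enum 'I_N].
have szws : size ws = (N + N)%N by rewrite size_cat !size_map -enumT size_enum_ord.
exists s, (g1 ^+ (N + N)), [seq cos (w * s) | w <- ws].
have gainE w : filter_gain s [seq cos (w * s) | w <- ws] w =
    \prod_(v <- ws) (cos (w * s) - cos (v * s)) by rewrite /filter_gain big_map.
have kill w : w \in ws -> filter_gain s [seq cos (w * s) | w <- ws] w = 0.
  by move=> wws; rewrite gainE (big_rem w) //= subrr mul0r.
have nul : 0 <= th * (g1 ^+ (N + N)) ^+ 2.
  by rewrite mulr_ge0 ?sqr_ge0 // ltW.
rewrite size_map szws; split; split.
- exact: ltW.
- by apply/allP => c /mapP[w _ ->]; rewrite cos_geN1 cos_le1.
- rewrite -[s *+ _]mulr_natr; apply: le_trans sd; apply: ler_wpM2l; first exact: ltW.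
  by rewrite ler_nat leqnSn.
- exact: exprn_gt0.
- by rewrite divfK // expf_neq0 // expf_neq0 // gt_eqF.
- move=> k hk; rewrite gainE.
  have /andP[r0 r1] := low_sqrt hk.
  rewrite -(big_map (fun v => cos (frequency N (La k) * s) - cos (v * s))
              xpredT (fun x => x)).
  rewrite -[in g1 ^+ _]szws -(size_map (fun v => cos (frequency N (La k) * s) - cos (v * s))).
  set l := map _ ws; have gl0 : 0 < g1 ^+ size l by exact: exprn_gt0.
  suff : g1 ^+ size l <= \prod_(x <- l) x by nra.
  apply: prod_ge_const; first exact: ltW.
  apply/allP => x /mapP[v vws ->].
  have [L [Lb ->]] : exists L : R, 2 <= Num.sqrt L <= 8 /\ v = frequency N L.
    move: vws; rewrite mem_cat => /orP[] /mapP[j _ ->].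
      by exists (f j).
    by exists (Lo j).
  have /andP[b1 b2] := Lb.
  have E M : frequency N M * s = Num.sqrt M * q by rewrite /frequency /q mulrA.
  rewrite !E /g1; apply: lerB.
    by apply: cos_le_pi; nra.
  by apply: cos_le_pi; nra.
- move=> k hk; rewrite kill ?expr0n //=.
  rewrite mem_cat; apply/orP; left; apply/mapP; exists k; first by rewrite mem_enum.
  by rewrite /f hk.
- move=> k; rewrite kill ?expr0n //=.
  by rewrite mem_cat; apply/orP; right; apply/mapP; exists k; rewrite ?mem_enum.
Qed.

(** [K] bounds [4 ^+ size cs] against the squared gain on the low modes; it is the price paid in the
    observability constant and must not depend on N. One value serves all fine meshes, and the
    finitely many coarse ones are added. *)
Lemma adapted_filter_exists (R : realType) (d th : R) : 0 < d -> 0 < th ->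
  exists K : R, 0 <= K /\ forall N, adapted_filter N K d th.
Proof.
move=> d0 th0; have [N0 [K0 [K00 hK0]]] := large_filter d0 th0.
have [K hK] := choice (fun N => small_filter N d0 th0).
have Kge0 N : 0 <= K N by case: (hK N).
exists (K0 + \sum_(N < N0) K N); split; first by rewrite addr_ge0 ?sumr_ge0.
have mono N K1 K2 : K1 <= K2 -> adapted_filter N K1 d th -> adapted_filter N K2 d th.
  move=> K12 h La Lo hL; have [s [g [cs [[h1 h2 h3 h4 h5] h6]]]] := h La Lo hL.
  exists s, g, cs; split => //; split => //.
  by apply: (le_trans h5); rewrite ler_wpM2r ?sqr_ge0.
move=> N; have [NN|NN] := leqP N0 N.
  by apply: mono (hK0 _ NN); rewrite lerDl sumr_ge0.
apply: mono (proj2 (hK N)).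
rewrite (bigD1 (Ordinal NN)) //= addrCA lerDl addr_ge0 // sumr_ge0 //.
Qed.

(** * Observability of acoustic and optical trigonometric sums *)

Definition sum_case (A : Type) (N : nat) (f g : 'I_N -> A) (i : 'I_N + 'I_N) : A :=
  match i with inl k => f k | inr k => g k end.

Lemma trig_sum_sum (R : realType) (N : nat) (w w' a a' b b' : 'I_N -> R) (t : R) :
  trig_sum xpredT (sum_case w w') (sum_case a a') (sum_case b b') t =
  trig_sum xpredT w a b t + trig_sum xpredT w' a' b' t.
Proof. by rewrite /trig_sum big_sumType. Qed.

Lemma trig_sum_split (R : realType) (I : finType) (Q : pred I)
    (w a b : I -> R) (t : R) :
  trig_sum xpredT w a b t =
  trig_sum Q w a b t + trig_sum (fun i => ~~ Q i) w a b t.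
Proof. by rewrite /trig_sum (bigID Q). Qed.

Lemma eq_trig_sum (R : realType) (I : finType) (P : pred I)
    (w a b w' a' b' : I -> R) (t : R) :
  w =1 w' -> a =1 a' -> b =1 b' -> trig_sum P w a b t = trig_sum P w' a' b' t.
Proof. by move=> ww aa bb; apply: eq_bigr => i _; rewrite ww aa bb. Qed.

(** The hypothesis allows the undesired modes to be larger than the low ones by any fixed [C2]: the
    damping level is chosen after [C2]. Their coefficients enter it without the weight sin eta,
    whereas the low modes enter with it, as in the trace. *)
Lemma spectral_observability (R : realType) (T C2 : R) : 2 < T -> 0 < C2 ->
  exists C : R, 0 < C /\ forall (N : nat) (La Lo : 'I_N -> R), disp_roots La Lo ->
  forall aa ba ao bo : 'I_N -> R,
  let S := \sum_(k < N | La k < 5 / 2)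
             sin (wavenumber R N k) ^+ 2 * (aa k ^+ 2 + ba k ^+ 2) in
  \sum_(k < N | 4 < La k) (aa k ^+ 2 + ba k ^+ 2) +
    \sum_(k < N) (ao k ^+ 2 + bo k ^+ 2) <= C2 * S ->
  S <= C * \int[lebesgue_measure]_(t in `[- (T / 2), T / 2])
    ((trig_sum xpredT (fun k => frequency N (La k))
        (fun k => sin (wavenumber R N k) * aa k)
        (fun k => sin (wavenumber R N k) * ba k) t +
      trig_sum xpredT (fun k => frequency N (Lo k))
        (fun k => sin (wavenumber R N k) * ao k)
        (fun k => sin (wavenumber R N k) * bo k) t) ^+ 2).
Proof.
move=> T2 C20; have pi0 := pi_gt0 R.
(* X is halfway between 1 and T / 2: the length 2 X > 2 is what Ingham's inequality with gap pi
   demands, and T / 2 - X is left to the filter. *)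
pose X : R := (T + 2) / 4; pose p : R := pi / (2 * X).
have X0 : 1 < X by rewrite /X; lra.
have p0 : 0 < p by rewrite /p divr_gt0 //; lra.
have pX : pi / (2 * p) = X by rewrite /p; field; rewrite !gt_eqF //; lra.
have pp : 2 * p < pi.
  by rewrite /p (_ : 2 * _ = pi / X) ?ltr_pdivrMr ?ltr_pMr //; [lra|field; lra].
pose c1 : R := (1 - (2 * p / pi) ^+ 2) / p.
have c10 : 0 < c1.
  have h1 : 2 * p / pi < 1 by rewrite ltr_pdivrMr // mul1r.
  have h0 : 0 < 2 * p / pi by rewrite divr_gt0 // mulr_gt0.
  by rewrite /c1 divr_gt0 // subr_gt0; nra.
pose Cb : R := 2 / p + 32 * p / (160 ^+ 2)^-1.
have Cb0 : 0 < Cb.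
  have h160 : 0 < (160 ^+ 2)^-1 :> R by rewrite invr_gt0 exprn_gt0.
  by apply: addr_gt0; apply: divr_gt0 => //; apply: mulr_gt0.
(* With this level the damped modes consume at most c1 / 4 of the lower bound c1 / 2 for g^2 S, so
   half of it survives. *)
pose th : R := c1 / (8 * Cb * C2).
have th0 : 0 < th by rewrite /th divr_gt0 // !mulr_gt0.
have thE : Cb * C2 * th = c1 / 8 by rewrite /th; field; rewrite !gt_eqF.
have d0 : 0 < T / 2 - X by rewrite /X; lra.
have [K [K0 hK]] := adapted_filter_exists d0 th0.
exists (4 * K / c1 + 1); split.
  by apply: ltr_wpDl => //; apply: divr_ge0; [exact: mulr_ge0|exact: ltW].
move=> N La Lo roots aa ba ao bo S hS.
have [s [g [cs [[s0 cs1 szd g0 Kg] [low bada bado]]]]] := hK N La Lo roots.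
have [hLa hLo] := roots.
set sn := fun k : 'I_N => sin (wavenumber R N k) in S hS *.
have sn01 k : 0 <= sn k <= 1.
  have /andP[? ?] := @wavenumber_bounds R N k.
  by rewrite sin_le1 andbT sin_ge0_pi //; lra.
pose wa k := frequency N (La k); pose wo k := frequency N (Lo k).
rewrite -/wa -/wo.
pose f t := trig_sum xpredT (sum_case wa wo)
  (sum_case (fun k => sn k * aa k) (fun k => sn k * ao k))
  (sum_case (fun k => sn k * ba k) (fun k => sn k * bo k)) t.
set J := Rintegral _ _ _.
have JE : J = \int[lebesgue_measure]_(t in `[- (T / 2), T / 2]) (f t ^+ 2).
  by apply: eq_Rintegral => t _; rewrite /f trig_sum_sum.
pose ga k := filter_gain s cs (wa k); pose go k := filter_gain s cs (wo k).
pose G := trig_sum (fun k => La k <= 4) wa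
  (fun k => ga k * (sn k * aa k)) (fun k => ga k * (sn k * ba k)).
(* The sine factor stands outside here, since it is the weight of the Schur test; in [G] it remains
   part of the coefficients. *)
pose Ba := trig_sum (fun k => 4 < La k) wa
  (fun k => sn k * (ga k * aa k)) (fun k => sn k * (ga k * ba k)).
pose O := trig_sum xpredT wo
  (fun k => sn k * (go k * ao k)) (fun k => sn k * (go k * bo k)).
have csq (h : R -> R) : continuous h -> continuous (fun t : R => h t ^+ 2).
  by move=> ch; apply: continuous_mul.
have cw (h : R -> R) : continuous h -> continuous (fun t : R => cos (p * t) * h t ^+ 2).
  by move=> ch; apply: continuous_mul; [exact: continuous_cos_scale|exact: csq].
have cG : continuous G by exact: continuous_trig_sum.
have cBa : continuous Ba by exact: continuous_trig_sum.
have cO : continuous O by exact: continuous_trig_sum.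
have cf : continuous f by exact: continuous_trig_sum.
have X00 : 0 <= X by lra.
have filt := @trig_sum_filter R _ xpredT (sum_case wa wo)
  (sum_case (fun k => sn k * aa k) (fun k => sn k * ao k))
  (sum_case (fun k => sn k * ba k) (fun k => sn k * bo k)) s X cs s0 cs1 X00.
set F := (X in \int[_]_(t in _) (X t ^+ 2) <= _) in filt.
have cF : continuous (fun t : R => G t + Ba t + O t).
  by apply: continuous_add => //; apply: continuous_add.
have {}filt : \int[lebesgue_measure]_(t in `[- X, X]) ((G t + Ba t + O t) ^+ 2) <=
    4 ^+ size cs * J.
  apply: le_trans (le_trans filt _).
    rewrite le_eqVlt; apply/orP; left; apply/eqP; apply: eq_Rintegral => t _.
    congr (_ ^+ 2).
    have -> : F t = trig_sum xpredT (sum_case wa wo)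
       (sum_case (fun k => ga k * (sn k * aa k)) (fun k => go k * (sn k * ao k)))
       (sum_case (fun k => ga k * (sn k * ba k)) (fun k => go k * (sn k * bo k))) t.
      by apply: eq_trig_sum => // -[k|k].
    rewrite trig_sum_sum (@trig_sum_split _ _ (fun k => La k <= 4)) /G; congr (_ + _ + _).
    + rewrite /Ba /trig_sum; apply: eq_big => k; first by rewrite -ltNge.
      by move=> _; ring.
    + by apply: eq_trig_sum => // k; ring.
  rewrite ler_wpM2l ?exprn_ge0 // JE; apply: Rintegral_subset.
  - exact: csq.
  - by move=> t; exact: sqr_ge0.
  - by move: szd; lra.
  - by move: szd; lra.
have wF : \int[lebesgue_measure]_(t in `[- X, X]) (cos (p * t) * (G t + Ba t + O t) ^+ 2)
    <= 4 ^+ size cs * J.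
  apply: le_trans filt; apply: le_Rintegral_continuous.
  - exact: cw.
  - exact: csq.
  - by move=> t _; rewrite ler_piMl ?sqr_ge0 ?cos_le1.
(* The Ingham family is L <= 4; its members with L >= 5/2 contribute nonnegative terms that are
   dropped. *)
have lowG : c1 * (g ^+ 2 * S) <= \int[lebesgue_measure]_(t in `[- X, X]) (cos (p * t) * G t ^+ 2).
  rewrite -pX; apply: le_trans (@ingham_inequality R p pi N (fun k => La k <= 4) wa _ _ p0 pp _ _).
  - apply: ler_wpM2l; first exact: ltW.
    rewrite /S mulr_sumr big_mkcond [leRHS]big_mkcond /=.
    apply: ler_sum => k _; case: ifP => h1; case: ifP => h2 //.
    + have := low k h1; rewrite -/(wa k) -/(ga k) => h.
      rewrite !exprMn -mulrDr -mulrDr -/(sn k); apply: ler_wpM2r => //.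
      by rewrite mulr_ge0 ?addr_ge0 ?sqr_ge0.
    + by move: h1 h2; lra.
    + by rewrite addr_ge0 ?sqr_ge0.
  - move=> i j /= hi hj ij; have [? _ Pi _] := hLa i; have [? _ Pj _] := hLa j.
    by apply: frequency_gap => //; apply/andP.
  - move=> i /= hi; have [? _ Pi _] := hLa i.
    by apply: frequency_ge => //; apply/andP.
have k0 : 0 < (160 ^+ 2)^-1 :> R by rewrite invr_gt0 exprn_gt0.
have upBa : \int[lebesgue_measure]_(t in `[- X, X]) (cos (p * t) * Ba t ^+ 2) <=
    Cb * (th * g ^+ 2 * \sum_(k < N | 4 < La k) (aa k ^+ 2 + ba k ^+ 2)).
  rewrite -pX; apply: le_trans (@trig_sum_upper_bound R p _ N (fun k => 4 < La k) wa
    (fun k => ga k * aa k) (fun k => ga k * ba k) sn p0 k0 sn01 _ _) _.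
  - by move=> i _; rewrite mulr_ge0 ?sqrtr_ge0.
  - move=> i j _ _; apply: frequency_separation.
      by move=> k; have [? ? _ _] := hLa k; lra.
    by move=> k; have [] := hLa k.
  - apply: ler_wpM2l; first exact: ltW.
    rewrite mulr_sumr; apply: ler_sum => k hk.
    rewrite !exprMn -mulrDr; apply: ler_wpM2r; first by rewrite addr_ge0 ?sqr_ge0.
    exact: bada.
have upO : \int[lebesgue_measure]_(t in `[- X, X]) (cos (p * t) * O t ^+ 2) <=
    Cb * (th * g ^+ 2 * \sum_(k < N) (ao k ^+ 2 + bo k ^+ 2)).
  rewrite -pX; apply: le_trans (@trig_sum_upper_bound R p _ N xpredT wo
    (fun k => go k * ao k) (fun k => go k * bo k) sn p0 k0 sn01 _ _) _.
  - by move=> i _; rewrite mulr_ge0 ?sqrtr_ge0.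
  - move=> i j _ _; apply: frequency_separation.
      by move=> k; have [? ? _] := hLo k; lra.
    by move=> k; have [] := hLo k.
  - apply: ler_wpM2l; first exact: ltW.
    rewrite mulr_sumr; apply: ler_sum => k hk.
    rewrite !exprMn -mulrDr; apply: ler_wpM2r; first by rewrite addr_ge0 ?sqr_ge0.
    exact: bado.
(* Pointwise, x^2 / 2 <= (x + w)^2 + w^2 with w = y + z, by completing the square, and w^2 <= 2 y^2
   + 2 z^2. *)
have comb : 2^-1 * \int[lebesgue_measure]_(t in `[- X, X]) (cos (p * t) * G t ^+ 2) <=
    \int[lebesgue_measure]_(t in `[- X, X]) (cos (p * t) * (G t + Ba t + O t) ^+ 2) +
    (2 * \int[lebesgue_measure]_(t in `[- X, X]) (cos (p * t) * Ba t ^+ 2) +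
     2 * \int[lebesgue_measure]_(t in `[- X, X]) (cos (p * t) * O t ^+ 2)).
  have c2 (h : R -> R) k : continuous h -> continuous (fun t : R => k * (cos (p * t) * h t ^+ 2)).
    by move=> ch; apply: continuous_mul; [exact: continuous_cst|exact: cw].
  rewrite -!Rintegral_scale; [|exact: cw..].
  rewrite -Rintegral_add; [|exact: c2..].
  rewrite -Rintegral_add; [|exact: cw|by apply: continuous_add; exact: c2].
  apply: le_Rintegral_continuous; first exact: c2.
    by apply: continuous_add; [exact: cw|apply: continuous_add; exact: c2].
  move=> t; rewrite -pX => /(cos_weight_ge0 p0).
  set c := cos _; set x := G t; set y := Ba t; set z := O t => cc.
  have := mulr_ge0 cc (sqr_ge0 (x + 2 * (y + z))).
  have := mulr_ge0 cc (sqr_ge0 (y - z)); lra.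
have S0 : 0 <= S by apply: sumr_ge0 => k _; rewrite mulr_ge0 ?addr_ge0 ?sqr_ge0.
have J0 : 0 <= J by apply: Rintegral_ge0 => t _; exact: sqr_ge0.
have thg0 : 0 <= 2 * (Cb * th) * g ^+ 2 by apply: mulr_ge0; [apply: mulr_ge0 => //; apply: mulr_ge0; exact: ltW|exact: sqr_ge0].
have hS' := ler_wpM2l thg0 hS.
have main : c1 / 4 * (g ^+ 2 * S) <= 4 ^+ size cs * J.
  move: thE comb wF lowG upBa upO hS'.
  set s1 := \sum_(k < N | _) _; set s2 := \sum_(k < N) _ => thE comb wF lowG upBa upO.
  have -> : 2 * (Cb * th) * g ^+ 2 * (C2 * S) = 2 * (Cb * C2 * th) * (g ^+ 2 * S) by ring.
  rewrite thE; lra.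
have g20 : 0 < g ^+ 2 by rewrite exprn_gt0.
have KgJ := ler_wpM2r J0 Kg.
have : c1 / 4 * (g ^+ 2 * S) <= K * g ^+ 2 * J by exact: le_trans main KgJ.
rewrite (_ : c1 / 4 * _ = g ^+ 2 * (c1 / 4 * S)); last by ring.
rewrite (_ : K * _ * _ = g ^+ 2 * (K * J)); last by ring.
rewrite ler_pM2l // => fin.
rewrite mulrDl mul1r ler_wpDr //.
rewrite (_ : 4 * K / c1 * J = (K * J) / (c1 / 4)); last by field; rewrite gt_eqF.
rewrite ler_pdivlMr; last exact: divr_gt0.
by rewrite mulrC.
Qed.

(** * Discrete sine transform *)

Lemma cos_natmul_pi (R : realType) (n : nat) : cos (n%:R * pi) = (-1) ^+ n :> R.
Proof.
elim: n => [|n IH]; first by rewrite mul0r cos0.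
by rewrite -natr1 mulrDl mul1r cosDpi IH exprS mulN1r.
Qed.

Lemma sin_natmul_pi (R : realType) (n : nat) : sin (n%:R * pi) = 0 :> R.
Proof.
elim: n => [|n IH]; first by rewrite mul0r sin0.
by rewrite -natr1 mulrDl mul1r sinDpi IH oppr0.
Qed.

(** Dirichlet kernel: multiplication by 2 sin (x/2) telescopes the sum. The range of r puts x/2
    strictly between 0 and pi, so this factor does not vanish. *)
Lemma sum_cos_wavenumber (R : realType) (N r : nat) : (0 < r < 2 * N.+1)%N ->
  \sum_(k < N) cos (r%:R * wavenumber R N k) = (- (-1) ^+ r - 1) / 2 :> R.
Proof.
move=> /andP[r0 r1]; have pi0 := pi_gt0 R.
have n0 : 0 < N.+1%:R :> R by [].
pose x : R := r%:R * pi / N.+1%:R.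
have sx : 0 < sin (x / 2).
  apply: sin_gt0_pi; rewrite /x !divr_gt0 ?mulr_gt0 ?ltr0n //=.
  rewrite -mulrA -invfM ltr_pdivrMr ?mulr_gt0 // mulrC ltr_pM2l // -natrM ltr_nat.
  by rewrite mulnC.
have tele m : 2 * sin (x / 2) * (\sum_(k < m) cos (r%:R * wavenumber R N k)) =
    sin ((m%:R + 1 / 2) * x) - sin (x / 2).
  elim: m => [|m IH]; first by rewrite big_ord0 mulr0 add0r mul1r [2^-1 * x]mulrC subrr.
  rewrite big_ord_recr /= mulrDr IH.
  have -> : r%:R * wavenumber R N m = (m%:R + 1) * x.
    by rewrite /x /wavenumber -natr1; field; rewrite gt_eqF.
  have -> : (m.+1%:R + 1 / 2) * x = (m%:R + 1) * x + x / 2 by rewrite -natr1; field.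
  have -> : (m%:R + 1 / 2) * x = (m%:R + 1) * x - x / 2 by field.
  by rewrite sinB sinD; ring.
have := tele N.
have -> : (N%:R + 1 / 2) * x = r%:R * pi - x / 2.
  have -> : N%:R = N.+1%:R - 1 :> R by rewrite -natr1 addrK.
  by rewrite /x; field; rewrite gt_eqF.
rewrite sinB sin_natmul_pi cos_natmul_pi mul0r sub0r => E.
apply: (mulfI (x := 2 * sin (x / 2))); first by rewrite mulf_neq0 // gt_eqF.
by rewrite E; field.
Qed.

Lemma sum_sin_sin (R : realType) (N i j : nat) :
  (0 < i < N.+1)%N -> (0 < j < N.+1)%N ->
  \sum_(k < N) sin (i%:R * wavenumber R N k) * sin (j%:R * wavenumber R N k) =
  (if i == j then N.+1%:R / 2 else 0) :> R.
Proof.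
wlog ij : i j / (j <= i)%N.
  move=> H hi hj; have [ji|/ltnW ji] := leqP j i; first exact: H.
  by rewrite eq_sym -H //; apply: eq_bigr => k _; rewrite mulrC.
move=> /andP[i0 i1] /andP[j0 j1].
have E (k : 'I_N) : sin (i%:R * wavenumber R N k) * sin (j%:R * wavenumber R N k) =
   2^-1 * cos ((i - j)%N%:R * wavenumber R N k) -
   2^-1 * cos ((i + j)%N%:R * wavenumber R N k).
  by rewrite natrB // natrD mulrBl mulrDl cosB cosD; field.
rewrite (eq_bigr _ (fun k _ => E k)) sumrB -!mulr_sumr.
rewrite [X in _ - _ * X]sum_cos_wavenumber; last by lia.
case: eqP => [->|/eqP nij].
  rewrite subnn; under eq_bigr do rewrite mul0r cos0.
  rewrite sumr_const card_ord addnn -mul2n exprM sqrrN !expr1n -natr1.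
  by field.
rewrite sum_cos_wavenumber; last by move: nij; lia.
have -> : (-1) ^+ (i + j) = (-1) ^+ (i - j) :> R.
  by rewrite -{1}(subnK ij) -addnA addnn -mul2n exprD exprM sqrrN !expr1n mulr1.
by rewrite subrr.
Qed.

Definition sine_coef (R : realType) (N : nat) (f : nat -> R) (k : nat) : R :=
  \sum_(j < N.+1) sin (j%:R * wavenumber R N k) * f j.

Lemma sine_coef_shift (R : realType) (N k : nat) (f : nat -> R) :
  sine_coef N f k = \sum_(j < N) sin (j.+1%:R * wavenumber R N k) * f j.+1.
Proof. by rewrite /sine_coef big_ord_recl /= mul0r sin0 mul0r add0r. Qed.

Lemma sine_parseval (R : realType) (N : nat) (f g : nat -> R) :
  \sum_(k < N) sine_coef N f k * sine_coef N g k =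
  N.+1%:R / 2 * \sum_(j < N) f j.+1 * g j.+1.
Proof.
under eq_bigr do rewrite !sine_coef_shift mulr_suml.
rewrite exchange_big /= mulr_sumr; apply: eq_bigr => i _.
under eq_bigr do rewrite mulr_sumr.
rewrite exchange_big /= (bigD1 i) //= [X in _ + X]big1 ?addr0 => [|j ji].
  transitivity (\sum_(k < N) sin (i.+1%:R * wavenumber R N k) *
     sin (i.+1%:R * wavenumber R N k) * (f i.+1 * g i.+1)).
    by apply: eq_bigr => k _; ring.
  have hi : (0 < i.+1 < N.+1)%N := ltn_ord i.
  by rewrite -mulr_suml sum_sin_sin // eqxx.
transitivity (\sum_(k < N) sin (i.+1%:R * wavenumber R N k) *
     sin (j.+1%:R * wavenumber R N k) * (f i.+1 * g j.+1)).
  by apply: eq_bigr => k _; ring.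
rewrite -mulr_suml sum_sin_sin ?ltnS ?ltn_ord // eqSS.
by rewrite eq_sym val_eqE (negPf ji) mul0r.
Qed.

Lemma sine_inversion (R : realType) (N : nat) (f : nat -> R) (i : 'I_N) :
  f i.+1 = 2 / N.+1%:R *
    \sum_(k < N) sin (i.+1%:R * wavenumber R N k) * sine_coef N f k.
Proof.
(* Parseval's identity against the indicator of a single node. *)
have := sine_parseval N (fun j => (j == i.+1)%:R) f.
rewrite [X in _ = _ * X](bigD1 i) //= eqxx mul1r [X in _ * (_ + X)]big1; last first.
  by move=> j ji; rewrite eqSS val_eqE (negPf ji) mul0r.
rewrite addr0 => E.
have n0 : N.+1%:R != 0 :> R by rewrite pnatr_eq0.
apply: (mulfI (x := N.+1%:R / 2)); first by rewrite mulf_neq0.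
rewrite -E mulrA (_ : N.+1%:R / 2 * (2 / N.+1%:R) = 1) ?mul1r; last by field.
apply: eq_bigr => k _; congr (_ * _).
have ilt : (i.+1 < N.+1)%N by rewrite ltnS ltn_ord.
rewrite /sine_coef (bigD1 (Ordinal ilt)) //= eqxx mulr1 big1 ?addr0 //.
by move=> j; rewrite -val_eqE /= => /negPf ->; rewrite mulr0.
Qed.

Lemma sin_wavenumber_end (R : realType) (N k : nat) :
  sin (N.+1%:R * wavenumber R N k) = 0 :> R.
Proof. by rewrite /wavenumber mulrC divfK ?pnatr_eq0 // sin_natmul_pi. Qed.

(** The origin of the weight sin eta in the observation at x_N. *)
Lemma sin_wavenumber_last (R : realType) (N k : nat) :
  sin (N%:R * wavenumber R N k) = (-1) ^+ k * sin (wavenumber R N k) :> R.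
Proof.
rewrite (_ : N%:R * _ = k.+1%:R * pi - wavenumber R N k); last first.
  by rewrite /wavenumber -![_.+1%:R]natr1; field; rewrite natr1 pnatr_eq0.
by rewrite sinB sin_natmul_pi cos_natmul_pi exprS; ring.
Qed.

(** Summation by parts; the boundary terms vanish by the end values of [f] and by sin ((N+1) eta) =
    0. *)
Lemma sine_coef_laplace (R : realType) (N k : nat) (f : nat -> R) :
  f 0%N = 0 -> f N.+1 = 0 ->
  \sum_(j < N) sin (j.+1%:R * wavenumber R N k) * (f j + f j.+2) =
  2 * cos (wavenumber R N k) * sine_coef N f k.
Proof.
move=> f0 fN; set x := wavenumber R N k.
have tele m : \sum_(j < m) sin (j.+1%:R * x) * (f j + f j.+2) =
    2 * cos x * (\sum_(j < m) sin (j%:R * x) * f j) +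
    sin (m%:R * x - x) * f m + sin (m%:R * x) * f m.+1.
  elim: m => [|m IH].
    by rewrite !big_ord0 !mulr0 !mul0r sin0 f0; ring.
  rewrite !big_ord_recr /= IH.
  rewrite (_ : m.+1%:R * x - x = m%:R * x); last by rewrite -natr1; ring.
  rewrite (_ : m.+1%:R * x = m%:R * x + x); last by rewrite -natr1; ring.
  rewrite sinB sinD; ring.
rewrite tele /sine_coef big_ord_recr /= fN mulr0 addr0 mulrDr; congr (_ + _).
have := sin_wavenumber_end R N k; rewrite -/x -natr1 mulrDl mul1r sinB sinD => E.
rewrite mulrA; congr (_ * _); lra.
Qed.

Definition mid_coef (R : realType) (N : nat) (g : nat -> R) (k : nat) : R :=
  \sum_(j < N.+1) sin ((j%:R + 1 / 2) * wavenumber R N k) * g j.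

(** The boundary terms vanish through the sines, which are 0 at both end nodes; in the dual identity
    [mid_coef_avg] it is [f] that vanishes there. *)
Lemma sine_coef_avg (R : realType) (N k : nat) (g : nat -> R) :
  \sum_(j < N) sin (j.+1%:R * wavenumber R N k) * (g j + g j.+1) =
  2 * cos (wavenumber R N k / 2) * mid_coef N g k.
Proof.
set x := wavenumber R N k.
have tele m : \sum_(j < m) sin (j.+1%:R * x) * (g j + g j.+1) =
    2 * cos (x / 2) * (\sum_(j < m) sin ((j%:R + 1 / 2) * x) * g j) +
    sin (m%:R * x) * g m.
  elim: m => [|m IH]; first by rewrite !big_ord0 mul0r sin0; ring.
  rewrite !big_ord_recr /= IH.
  rewrite (_ : m.+1%:R * x = (m%:R + 1 / 2) * x + x / 2); last by rewrite -natr1; field.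
  rewrite (_ : m%:R * x = (m%:R + 1 / 2) * x - x / 2); last by field.
  rewrite sinB sinD; ring.
rewrite tele /mid_coef big_ord_recr /= mulrDr; congr (_ + _).
have := sin_wavenumber_end R N k; rewrite -/x.
rewrite (_ : N.+1%:R * x = (N%:R + 1 / 2) * x + x / 2); last by rewrite -natr1; field.
rewrite (_ : N%:R * x = (N%:R + 1 / 2) * x - x / 2); last by field.
by rewrite sinB sinD => E; rewrite mulrA; congr (_ * _); lra.
Qed.

Lemma mid_coef_avg (R : realType) (N k : nat) (f : nat -> R) :
  f 0%N = 0 -> f N.+1 = 0 ->
  mid_coef N (fun j => f j + f j.+1) k =
  2 * cos (wavenumber R N k / 2) * sine_coef N f k.
Proof.
move=> f0 fN; rewrite /mid_coef /sine_coef; set x := wavenumber R N k.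
have tele m : \sum_(j < m) sin ((j%:R + 1 / 2) * x) * (f j + f j.+1) =
    2 * cos (x / 2) * (\sum_(j < m) sin (j%:R * x) * f j) +
    sin (m%:R * x - x / 2) * f m.
  elim: m => [|m IH]; first by rewrite !big_ord0 f0; ring.
  rewrite !big_ord_recr /= IH.
  rewrite (_ : m.+1%:R * x - x / 2 = m%:R * x + x / 2); last by rewrite -natr1; field.
  rewrite (_ : (m%:R + 1 / 2) * x = m%:R * x + x / 2); last by field.
  rewrite sinB sinD; ring.
by rewrite tele fN mulr0 addr0.
Qed.

(** * Eigenvectors of the 2 x 2 symbols *)

Section ModalAlgebra.
Variable R : realType.
Implicit Types (c y L b : R).

(* (1, mode_mid c L) is the eigenvector of the symbol of the pencil (S, M) for
   the root L, and mode_wu, mode_wm are the entries of its image by the symbol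
   [10 - 4 c^2, 4 c; 4 c, 16] of M. *)
Definition mode_mid c L : R := c * (40 + L) / (4 * (10 - L)).
Definition mode_wu c L : R := 10 - 4 * c ^+ 2 + 4 * c * mode_mid c L.
Definition mode_wm c L : R := 4 * c + 16 * mode_mid c L.
(** Square of the eigenvector in the symbol of M, completed so that the lower bound 5 for c^2 <= 1
    is visible. *)
Definition mode_norm c L : R := (4 * mode_mid c L + c) ^+ 2 + 10 - 5 * c ^+ 2.
(** Share of the nodal coefficient carried by the mode for piecewise linear data: their midpoint
    coefficient is c times the nodal one, and [mode_wu c L + c * mode_wm c L] is the numerator. *)
Definition mode_ratio c L : R :=
  (10 + 20 * c * mode_mid c L) / mode_norm c L.

Lemma mode_norm_ge5 c L : c ^+ 2 <= 1 -> 5 <= mode_norm c L.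
Proof. by move=> c1; rewrite /mode_norm; have := sqr_ge0 (4 * mode_mid c L + c); lra. Qed.

Lemma mode_stiff_mid c L : L != 10 ->
  160 * mode_mid c L - 160 * c = L * mode_wm c L.
Proof.
move=> L10; rewrite /mode_wm /mode_mid; field.
by rewrite subr_eq0 eq_sym.
Qed.

(** The midpoint row of the eigenvalue equation is the definition of [mode_mid]; the nodal row is
    then the dispersion relation, up to the factor 5 / (10 - L). *)
Lemma mode_stiff_node c L : L != 10 -> disp_poly (c ^+ 2) L = 0 ->
  120 + 40 * c ^+ 2 - 160 * c * mode_mid c L = L * mode_wu c L.
Proof.
move=> L10 PL; have d0 : 10 - L != 0 by rewrite subr_eq0 eq_sym.
apply/eqP; rewrite -subr_eq0.
rewrite (_ : _ - _ = 5 * disp_poly (c ^+ 2) L / (10 - L)); last first.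
  by rewrite /mode_wu /mode_mid /disp_poly; field.
by rewrite PL mulr0 mul0r.
Qed.

Lemma mode_orthogonal c La Lo : La < 10 -> 12 < Lo -> c ^+ 2 < 1 ->
  disp_poly (c ^+ 2) La = 0 -> disp_poly (c ^+ 2) Lo = 0 ->
  mode_wu c La + mode_mid c Lo * mode_wm c La = 0.
Proof.
move=> La10 Lo12 c1 PLa PLo.
have d1 : 10 - La != 0 by rewrite gt_eqF // subr_gt0.
have d2 : 10 - Lo != 0 by rewrite lt_eqF // subr_lt0; lra.
set y := c ^+ 2 in c1 PLa PLo.
(* Vieta's formulas for the sum and the product of the two roots; the orthogonality relation is
   symmetric in them. *)
have s : (2 - y) * (La + Lo) = 44 + 16 * y.
  have dd : La - Lo != 0 by rewrite lt_eqF // subr_lt0; lra.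
  apply: (mulIf dd); move: PLa PLo; rewrite /disp_poly; lra.
have q : (2 - y) * (La * Lo) = 240 * (1 - y).
  move: PLa s; rewrite /disp_poly => h1 h2.
  have : (2 - y) * (La + Lo) * La = (44 + 16 * y) * La by rewrite h2.
  lra.
apply: (mulIf (x := (2 - y) * ((10 - La) * (10 - Lo)))).
  by rewrite mulf_neq0 ?mulf_neq0 // gt_eqF //; lra.
rewrite mul0r /mode_wu /mode_wm /mode_mid.
rewrite [LHS](_ : _ = (10 - 4 * y) * (100 * (2 - y) - 10 * ((2 - y) * (La + Lo)) + (2 - y) * (La * Lo)) +
  y * ((2 - y) * ((40 + La) * (10 - Lo) + (40 + Lo) * (10 - La) + (40 + La) * (40 + Lo)))); last first.
  by rewrite /y; field; apply/andP.
rewrite s q.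
rewrite (_ : (2 - y) * (_ + _ + _) = 24 * 100 * (2 - y) + 10 * ((2 - y) * (La + Lo)) -
  (2 - y) * (La * Lo)); last by ring.
rewrite s q; ring.
Qed.


Lemma mode_norm_pairing c L :
  mode_wu c L + mode_mid c L * mode_wm c L = mode_norm c L.
Proof. by rewrite /mode_wu /mode_wm /mode_norm; ring. Qed.

(** Expansion of (u, m) in the two eigenvectors, orthogonal for the symbol of M, read on the nodal
    component, where both eigenvectors have entry 1. *)
Lemma mode_decomposition c La Lo (u m : R) : La < 10 -> 12 < Lo -> c ^+ 2 < 1 ->
  disp_poly (c ^+ 2) La = 0 -> disp_poly (c ^+ 2) Lo = 0 ->
  u = (mode_wu c La * u + mode_wm c La * m) / mode_norm c La +
      (mode_wu c Lo * u + mode_wm c Lo * m) / mode_norm c Lo.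
Proof.
move=> La10 Lo12 c1 PLa PLo.
have na := mode_norm_ge5 La (ltW c1); have no := mode_norm_ge5 Lo (ltW c1).
have oa := mode_orthogonal La10 Lo12 c1 PLa PLo.
have ea := mode_norm_pairing c La; have eo := mode_norm_pairing c Lo.
have o2 : mode_wu c Lo + mode_mid c La * mode_wm c Lo = 0.
  by rewrite -oa /mode_wu /mode_wm; ring.
have da : mode_wm c La * (mode_mid c La - mode_mid c Lo) = mode_norm c La.
  by rewrite -ea -[LHS]addr0 -oa; ring.
have db : mode_wm c Lo * (mode_mid c Lo - mode_mid c La) = mode_norm c Lo.
  by rewrite -eo -[LHS]addr0 -o2; ring.
have dd : mode_mid c La - mode_mid c Lo != 0.
  by apply: contraTneq na => d0; rewrite -da d0 mulr0; lra.
have wa : mode_wm c La / mode_norm c La = (mode_mid c La - mode_mid c Lo)^-1.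
  rewrite -da invfM mulrA divff ?mul1r //.
  by apply: contraTneq na => d0; rewrite -da d0 mul0r; lra.
have wo : mode_wm c Lo / mode_norm c Lo = - (mode_mid c La - mode_mid c Lo)^-1.
  rewrite -db -[_ - mode_mid c La]opprB mulrN invrN mulrN invfM mulrA divff ?mul1r //.
  by apply: contraTneq no => d0; rewrite -db d0 mul0r; lra.
have ua : mode_wu c La / mode_norm c La = - mode_mid c Lo * (mode_wm c La / mode_norm c La).
  by rewrite mulrA; congr (_ / _); apply/eqP; rewrite -subr_eq0 mulNr opprK oa.
have uo : mode_wu c Lo / mode_norm c Lo = - mode_mid c La * (mode_wm c Lo / mode_norm c Lo).
  by rewrite mulrA; congr (_ / _); apply/eqP; rewrite -subr_eq0 mulNr opprK o2.
have sp (p q n : R) : (p * u + q * m) / n = p / n * u + q / n * m by ring.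
rewrite !sp ua uo wa wo.
by field.
Qed.

(** The dispersion relation writes c^2 as 2 (10 - L)(12 - L) / [disp_den L], whose factor 10 - L
    cancels the pole of [mode_mid]. The sign on both branches then becomes evident. *)
Lemma mode_kappa c L : 0 <= L -> L != 10 -> disp_poly (c ^+ 2) L = 0 ->
  10 + 20 * c * mode_mid c L = 120 * (60 - L) / disp_den L.
Proof.
move=> L0 L10 PL; have d0 : 10 - L != 0 by rewrite subr_eq0 eq_sym.
have D0 := disp_den_gt0 L0.
have yD : c ^+ 2 * disp_den L = 2 * (10 - L) * (12 - L).
  by move: PL; rewrite /disp_poly /disp_den; lra.
rewrite (_ : 10 + 20 * c * mode_mid c L =
   10 + 5 * (c ^+ 2 * disp_den L) * (40 + L) / (10 - L) / disp_den L); last first.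
  by rewrite /mode_mid; field; rewrite d0 gt_eqF.
rewrite yD; move: (D0); rewrite /disp_den => D0'.
by field; rewrite d0 gt_eqF.
Qed.

Lemma disp_sin_half c s L : 0 <= L -> disp_poly (c ^+ 2) L = 0 ->
  c ^+ 2 + s ^+ 2 = 1 -> s ^+ 2 = L * (60 - L) / disp_den L.
Proof.
move=> L0 PL cs; have D0 := disp_den_gt0 L0.
have yD : c ^+ 2 * disp_den L = 2 * (10 - L) * (12 - L).
  by move: PL; rewrite /disp_poly /disp_den; lra.
rewrite (_ : s ^+ 2 = 1 - c ^+ 2); last by lra.
apply/eqP; rewrite eq_sym -subr_eq0.
rewrite (_ : _ - _ = (L * (60 - L) - disp_den L + c ^+ 2 * disp_den L) / disp_den L); last first.
  by field; rewrite gt_eqF.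
rewrite yD (_ : L * (60 - L) - disp_den L + 2 * (10 - L) * (12 - L) = 0) ?mul0r //.
by rewrite /disp_den; ring.
Qed.

Lemma mode_ratio_bound c L : 0 <= L <= 60 -> L != 10 -> disp_poly (c ^+ 2) L = 0 ->
  c ^+ 2 <= 1 -> 0 <= mode_ratio c L <= 6.
Proof.
move=> /andP[L0 L60] L10 PL c1; have n5 := mode_norm_ge5 L c1.
have D0 := disp_den_gt0 L0.
rewrite /mode_ratio mode_kappa //; apply/andP; split.
  apply: divr_ge0; last lra.
  by apply: divr_ge0; [apply: mulr_ge0; lra|exact: ltW].
rewrite ler_pdivrMr; last lra.
rewrite ler_pdivrMr //; have : 240 <= disp_den L by rewrite /disp_den; nra.
nra.
Qed.

(** The numerator is 120 s^2 / L, at most 10 s^2 for L > 12, and the norm is at least 5. So smooth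
    piecewise linear data hardly excite the optical branch. *)
Lemma mode_ratio_optical c s L : 12 < L <= 60 -> disp_poly (c ^+ 2) L = 0 ->
  c ^+ 2 + s ^+ 2 = 1 -> 0 <= mode_ratio c L <= 2 * s ^+ 2.
Proof.
move=> /andP[L12 L60] PL cs; have c1 : c ^+ 2 <= 1 by have := sqr_ge0 s; lra.
have n5 := mode_norm_ge5 L c1; have L0 : 0 <= L by lra.
have L10 : L != 10 by rewrite gt_eqF //; lra.
have D0 := disp_den_gt0 L0.
have kE := mode_kappa L0 L10 PL.
have k0 : 0 <= 10 + 20 * c * mode_mid c L.
  by rewrite kE divr_ge0 ?mulr_ge0 ?subr_ge0 // ltW.
have k10 : 10 + 20 * c * mode_mid c L <= 10 * s ^+ 2.
  rewrite kE (disp_sin_half L0 PL cs) mulrA ler_pM2r ?invr_gt0 //; nra.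
rewrite /mode_ratio; apply/andP; split; first by rewrite divr_ge0 //; lra.
rewrite ler_pdivrMr; [have := sqr_ge0 s; nra|lra].
Qed.

(** With t <= 6 the norm is at most 59, while the numerator is at least 10. *)
Lemma mode_ratio_low c L : 0 < L < 5 / 2 -> disp_poly (c ^+ 2) L = 0 ->
  c ^+ 2 <= 1 -> 1 / 6 <= mode_ratio c L.
Proof.
move=> /andP[L0 L2] PL c1; have n5 := mode_norm_ge5 L c1.
pose t := (40 + L) / (10 - L).
have t0 : 0 < t by rewrite divr_gt0; lra.
have t6 : t <= 6 by rewrite ler_pdivrMr; lra.
have bE : mode_mid c L = c * t / 4 by rewrite /mode_mid /t; field; rewrite gt_eqF //; lra.
rewrite /mode_ratio ler_pdivlMr; last lra.
have cb : c * mode_mid c L = c ^+ 2 * t / 4 by rewrite bE; ring.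
have c0 := sqr_ge0 c.
have nE : mode_norm c L = c ^+ 2 * (t + 1) ^+ 2 + 10 - 5 * c ^+ 2.
  by rewrite /mode_norm bE; field.
rewrite nE -mulrA cb.
have t7 : (t + 1) ^+ 2 <= 49 by nra.
have : c ^+ 2 * (t + 1) ^+ 2 <= 49 by nra.
have : 0 <= c ^+ 2 * t by rewrite mulr_ge0 // ltW.
lra.
Qed.

End ModalAlgebra.

(** Split f into its even and odd nodes. At pi - eta the even part changes sign, and odd nodes being
    averages of even ones makes the odd coefficient cos eta times the even one. The quotient of the
    coefficients is (cos eta - 1)/(cos eta + 1) = - tan^2 (eta/2). *)
Lemma bigrid_sine_coef (R : realType) (N k : nat) (f : nat -> R) :
  odd N -> (k < N)%N -> f 0%N = 0 -> f N.+1 = 0 ->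
  (forall j, (j <= (N - 1) %/ 2)%N ->
     f (2 * j).+1 = (f (2 * j)%N + f (2 * j + 2)%N) / 2) ->
  cos (wavenumber R N k / 2) ^+ 2 * sine_coef N f (N - k.+1) =
  - sin (wavenumber R N k / 2) ^+ 2 * sine_coef N f k.
Proof.
move=> oddN kN f0 fN bi; set x := wavenumber R N k.
pose e j := if odd j then 0 else f j; pose o j := if odd j then f j else 0.
have eN : e N.+1 = 0 by rewrite /e /= oddN /=.
have QE : sine_coef N o k = cos x * sine_coef N e k.
  have := @sine_coef_laplace R N k e f0 eN; rewrite -/x => E.
  have : 2 * sine_coef N o k = 2 * cos x * sine_coef N e k; last by lra.
  rewrite -E sine_coef_shift mulr_sumr.
  apply: eq_bigr => j _; rewrite mulrCA; congr (_ * _); rewrite /o /e /= negbK.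
  case: (boolP (odd j)) => oj /=; first by rewrite addr0 mulr0.
  have jE : nat_of_ord j = (2 * j./2)%N by have := odd_double_half j; rewrite (negPf oj); lia.
  have hj : (j./2 <= (N - 1) %/ 2)%N by have := ltn_ord j; lia.
  have := bi _ hj; rewrite -jE addn2 => ->; lra.
have PQ : sine_coef N f k = sine_coef N e k + sine_coef N o k.
  rewrite /sine_coef -big_split; apply: eq_bigr => j _ /=.
  by rewrite /e /o -mulrDr; case: ifP; rewrite ?add0r ?addr0.
have xE : wavenumber R N (N - k.+1) = pi - x.
  rewrite /x /wavenumber (_ : (N - k.+1).+1 = (N.+1 - k.+1)%N); last by lia.
  rewrite natrB; last by lia.
  by rewrite !mulrBl [X in X - _]mulrAC divff ?mul1r // pnatr_eq0.
have QP : sine_coef N f (N - k.+1) = sine_coef N o k - sine_coef N e k.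
  rewrite /sine_coef -sumrB; apply: eq_bigr => j _; rewrite xE -/x.
  rewrite mulrBr sinB sin_natmul_pi cos_natmul_pi /e /o -signr_odd.
  by case: (odd j); rewrite /= ?expr1 ?expr0; ring.
have cE : cos x = 1 - 2 * sin (x / 2) ^+ 2.
  by rewrite -(cos_half_sqr x) cos2sin2; ring.
rewrite QP PQ QE cos2sin2 cE; ring.
Qed.

(** * Time evolution of the modal coefficients *)

Lemma is_derive_sum_fun (R : realType) (n : nat) (f : 'I_n -> R -> R)
    (df : 'I_n -> R) (t : R) :
  (forall i, is_derive t 1 (f i) (df i)) ->
  is_derive t 1 (fun s : R => \sum_(i < n) f i s) (\sum_(i < n) df i).
Proof.
move=> h; rewrite (_ : (fun s => _) = \sum_(i < n) f i); last first.
  by apply/funext => s; rewrite fct_sumE.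
exact: is_derive_sum.
Qed.

Lemma eq_end_of_derive0 (R : realType) (f : R -> R) (a b t : R) :
  {within `[a, b], continuous f} ->
  (forall s, a < s < b -> is_derive s 1 f 0) ->
  a <= t <= b -> f t = f b.
Proof.
move=> cf df /andP[at_ tb].
have [| |c _ /eqP] := @MVT_segment R f (fun=> 0) t b tb.
- move=> s; rewrite in_itv /= => /andP[h1 h2]; apply: df; apply/andP; split => //.
  exact: le_lt_trans h1.
- apply: continuous_subspaceW cf => s /=; rewrite !in_itv /= => /andP[h1 h2].
  by rewrite h2 andbT (le_trans at_).
by rewrite mul0r subr_eq0 => /eqP.
Qed.

Lemma harmonic_oscillator (R : realType) (z zt : R -> R) (w T : R) : w != 0 ->
  {within `[0, T], continuous z} -> {within `[0, T], continuous zt} ->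
  (forall t, 0 < t < T -> is_derive t 1 z (zt t)) ->
  (forall t, 0 < t < T -> is_derive t 1 zt (- w ^+ 2 * z t)) ->
  forall t, 0 <= t <= T ->
  z t = z T * cos (w * (t - T)) + zt T / w * sin (w * (t - T)).
Proof.
move=> w0 cz czt dz dzt t tT.
have dc (s : R) : is_derive s 1 (fun s : R => cos (w * (s - T))) (- (w * sin (w * (s - T)))).
  have h : is_derive s 1 (fun s : R => w * (s - T)) w.
    by apply: is_derive_eq; rewrite /GRing.scale /= subr0 mulr1.
  have hh := @is_derive1_comp R cos (fun s : R => w * (s - T)) s _ _ (is_derive_cos _) h.
  apply: (is_derive_eq hh); ring.
have ds (s : R) : is_derive s 1 (fun s : R => sin (w * (s - T))) (w * cos (w * (s - T))).
  have h : is_derive s 1 (fun s : R => w * (s - T)) w.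
    by apply: is_derive_eq; rewrite /GRing.scale /= subr0 mulr1.
  have hh := @is_derive1_comp R sin (fun s : R => w * (s - T)) s _ _ (is_derive_sin _) h.
  apply: (is_derive_eq hh); ring.
have cc : {within `[0, T], continuous (fun s : R => cos (w * (s - T)))}.
  by apply: continuous_subspaceT; exact: is_derive_continuous dc.
have cs : {within `[0, T], continuous (fun s : R => sin (w * (s - T)))}.
  by apply: continuous_subspaceT; exact: is_derive_continuous ds.
(* The coordinates of (z, zt / w) in the rotating frame are constant; their values at T are z T and
   zt T / w. *)
pose e1 (s : R) := z s * cos (w * (s - T)) + (- w^-1) * (zt s * sin (w * (s - T))).
pose e2 (s : R) := z s * sin (w * (s - T)) + w^-1 * (zt s * cos (w * (s - T))).
have ck (k : R) : {within `[0, T], continuous (fun _ : R => k)}.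
  by apply: continuous_subspaceT; exact: continuous_cst.
have E1 : e1 t = e1 T.
  apply: (@eq_end_of_derive0 R e1 0 T) => //.
    rewrite /e1; apply: continuous_add; first exact: continuous_mul.
    by apply: continuous_mul; [exact: ck|exact: continuous_mul].
  move=> s sT; have h1 := dz s sT; have h2 := dzt s sT.
  have h3 := dc s; have h4 := ds s.
  by apply: is_derive_eq; rewrite /GRing.scale /=; field.
have E2 : e2 t = e2 T.
  apply: (@eq_end_of_derive0 R e2 0 T) => //.
    rewrite /e2; apply: continuous_add; first exact: continuous_mul.
    by apply: continuous_mul; [exact: ck|exact: continuous_mul].
  move=> s sT; have h1 := dz s sT; have h2 := dzt s sT.
  have h3 := dc s; have h4 := ds s.
  by apply: is_derive_eq; rewrite /GRing.scale /=; field.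
move: E1 E2; rewrite /e1 /e2 subrr mulr0 cos0 sin0 !mulr0 !mulr1 addr0 add0r.
move=> E1 E2; rewrite -E1 (_ : zt T / w = w^-1 * zt T) -?E2; last by rewrite mulrC.
have := cos2Dsin2 (w * (t - T)); set c := cos _; set s := sin _ => cs1.
transitivity (z t * (c ^+ 2 + s ^+ 2)); first by rewrite cs1 mulr1.
ring.
Qed.

(** Pairing of f with the eigenvector through the symbol of M. Even indices of f are nodes, odd ones
    midpoints. *)
Definition mode_coef (R : realType) (N : nat) (c L : R) (k : nat) (f : nat -> R) : R :=
  mode_wu c L * sine_coef N (fun j => f (2 * j)%N) k +
  mode_wm c L * mid_coef N (fun j => f (2 * j).+1) k.

(** Row stencils of M_h and S_h at a node or a midpoint, with the factors h/30 and 1/(3h) taken out;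
    their quotient is the 10 / h^2 of the equations below. *)
Definition node_mass (R : realType) (f : nat -> R) (j : nat) : R :=
  8 * f (2 * j.+1)%N - (f (2 * j)%N + f (2 * j.+2)%N) +
  2 * (f (2 * j).+1 + f (2 * j.+1).+1).
Definition node_stiff (R : realType) (f : nat -> R) (j : nat) : R :=
  14 * f (2 * j.+1)%N + (f (2 * j)%N + f (2 * j.+2)%N) -
  8 * (f (2 * j).+1 + f (2 * j.+1).+1).
Definition mid_mass (R : realType) (f : nat -> R) (j : nat) : R :=
  16 * f (2 * j).+1 + 2 * (f (2 * j)%N + f (2 * j.+1)%N).
Definition mid_stiff (R : realType) (f : nat -> R) (j : nat) : R :=
  16 * f (2 * j).+1 - 8 * (f (2 * j)%N + f (2 * j.+1)%N).

Definition vanishing_ends (R : realType) (N : nat) (f : nat -> R) : Prop :=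
  f 0%N = 0 /\ f (2 * N.+1)%N = 0.

Lemma sum_lin3 (R : comNzRingType) (n : nat) (s a b d : nat -> R) (x y z : R) :
  \sum_(j < n) s j * (x * a j + y * b j + z * d j) =
  x * (\sum_(j < n) s j * a j) + y * (\sum_(j < n) s j * b j) +
  z * (\sum_(j < n) s j * d j).
Proof.
elim: n => [|n IH]; first by rewrite !big_ord0; ring.
by rewrite !big_ord_recr /= IH; ring.
Qed.

Lemma sum_node_stencil (R : realType) (N k : nat) (f : nat -> R) (x y z : R) :
  vanishing_ends N f ->
  \sum_(j < N) sin (j.+1%:R * wavenumber R N k) *
    (x * f (2 * j.+1)%N + y * (f (2 * j)%N + f (2 * j.+2)%N) +
     z * (f (2 * j).+1 + f (2 * j.+1).+1)) =
  (x + y * (2 * cos (wavenumber R N k))) * sine_coef N (fun j => f (2 * j)%N) k +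
  z * (2 * cos (wavenumber R N k / 2)) * mid_coef N (fun j => f (2 * j).+1) k.
Proof.
move=> [f0 fN].
rewrite (@sum_lin3 R N (fun j => sin (j.+1%:R * wavenumber R N k))
  (fun j => f (2 * j.+1)%N) (fun j => f (2 * j)%N + f (2 * j.+2)%N)
  (fun j => f (2 * j).+1 + f (2 * j.+1).+1)).
rewrite -(sine_coef_shift N k (fun j => f (2 * j)%N)).
rewrite (sine_coef_avg N k (fun j => f (2 * j).+1)).
by rewrite (@sine_coef_laplace _ N k (fun j => f (2 * j)%N)) //; ring.
Qed.

Lemma sum_mid_stencil (R : realType) (N k : nat) (f : nat -> R) (x y : R) :
  vanishing_ends N f ->
  mid_coef N (fun j => x * f (2 * j).+1 + y * (f (2 * j)%N + f (2 * j.+1)%N)) k =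
  x * mid_coef N (fun j => f (2 * j).+1) k +
  y * (2 * cos (wavenumber R N k / 2)) * sine_coef N (fun j => f (2 * j)%N) k.
Proof.
move=> [f0 fN].
have <- : 2 * cos (wavenumber R N k / 2) * sine_coef N (fun j => f (2 * j)%N) k * y =
  y * (2 * cos (wavenumber R N k / 2)) * sine_coef N (fun j => f (2 * j)%N) k by ring.
rewrite -mid_coef_avg // /mid_coef mulr_sumr mulr_suml -big_split.
by apply: eq_bigr => j _ /=; ring.
Qed.

Lemma mode_coef_ode (R : realType) (N k : nat) (L : R) (f g : nat -> R) :
  L != 10 -> disp_poly (cos (wavenumber R N k / 2) ^+ 2) L = 0 ->
  vanishing_ends N f -> vanishing_ends N g ->
  (forall j, (j < N)%N ->
     node_mass g j + 10 * N.+1%:R ^+ 2 * node_stiff f j = 0) ->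
  (forall j, (j <= N)%N ->
     mid_mass g j + 10 * N.+1%:R ^+ 2 * mid_stiff f j = 0) ->
  let c := cos (wavenumber R N k / 2) in
  mode_coef N c L k g = - (L * N.+1%:R ^+ 2) * mode_coef N c L k f.
Proof.
move=> L10 PL vf vg rn rm c.
set ug := sine_coef N (fun j => g (2 * j)%N) k.
set uf := sine_coef N (fun j => f (2 * j)%N) k.
set mg := mid_coef N (fun j => g (2 * j).+1) k.
set mf := mid_coef N (fun j => f (2 * j).+1) k.
set n := N.+1%:R : R.
have cx : cos (wavenumber R N k) = 2 * c ^+ 2 - 1 by rewrite cos_half_sqr.
have e1 : (8 - 2 * (2 * c ^+ 2 - 1)) * ug + 4 * c * mg +
    10 * n ^+ 2 * ((14 + 2 * (2 * c ^+ 2 - 1)) * uf - 16 * c * mf) = 0.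
  have h1 := sum_node_stencil k 8 (-1) 2 vg.
  have h2 := sum_node_stencil k 14 1 (-8) vf.
  rewrite -/ug -/mg -/c cx in h1; rewrite -/uf -/mf -/c cx in h2.
  have : \sum_(j < N) sin (j.+1%:R * wavenumber R N k) *
      (node_mass g j + 10 * n ^+ 2 * node_stiff f j) = 0.
    by rewrite big1 // => j _; rewrite rn // mulr0.
  rewrite (_ : \sum_(j < N) _ =
    ((8 + -1 * (2 * (2 * c ^+ 2 - 1))) * ug + 2 * (2 * c) * mg) +
    10 * n ^+ 2 * ((14 + 1 * (2 * (2 * c ^+ 2 - 1))) * uf + -8 * (2 * c) * mf)).
    by move=> E; rewrite -[RHS]E; ring.
  rewrite -h1 -h2 mulr_sumr -big_split /=; apply: eq_bigr => j _.
  by rewrite /node_mass /node_stiff; ring.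
have e2 : 16 * mg + 4 * c * ug + 10 * n ^+ 2 * (16 * mf - 16 * c * uf) = 0.
  have h1 := sum_mid_stencil k 16 2 vg; have h2 := sum_mid_stencil k 16 (-8) vf.
  rewrite -/ug -/mg -/c in h1; rewrite -/uf -/mf -/c in h2.
  have : \sum_(j < N.+1) sin ((j%:R + 1 / 2) * wavenumber R N k) *
      (mid_mass g j + 10 * n ^+ 2 * mid_stiff f j) = 0.
    by rewrite big1 // => j _; rewrite rm ?mulr0 // -ltnS.
  rewrite (_ : \sum_(j < N.+1) _ =
    (16 * mg + 2 * (2 * c) * ug) + 10 * n ^+ 2 * (16 * mf + -8 * (2 * c) * uf)).
    by move=> E; rewrite -[RHS]E; ring.
  rewrite -h1 -h2 /mid_coef mulr_sumr -big_split /=; apply: eq_bigr => j _.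
  by rewrite /mid_mass /mid_stiff; ring.
have s1 := mode_stiff_mid c L10; have s2 := mode_stiff_node L10 PL.
rewrite -/c in s2.
rewrite /mode_coef -/ug -/uf -/mg -/mf -/n.
rewrite (_ : - (L * n ^+ 2) * _ = - n ^+ 2 *
   ((L * mode_wu c L) * uf + (L * mode_wm c L) * mf)); last by ring.
rewrite -s1 -s2 /mode_wu /mode_wm.
apply/eqP; rewrite -subr_eq0; apply/eqP.
(* The symbols are symmetric, so the eigenvector (1, [mode_mid c L]) also combines the rows: nodal
   equation plus [mode_mid c L] times midpoint equation. *)
rewrite (_ : _ - _ = ((8 - 2 * (2 * c ^+ 2 - 1)) * ug + 4 * c * mg +
    10 * n ^+ 2 * ((14 + 2 * (2 * c ^+ 2 - 1)) * uf - 16 * c * mf)) +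
    mode_mid c L * (16 * mg + 4 * c * ug + 10 * n ^+ 2 * (16 * mf - 16 * c * uf))).
  by rewrite e1 e2 mulr0 addr0.
ring.
Qed.

Lemma mode_coef_sumE (R : realType) (N : nat) (c L : R) (k : nat) (f : nat -> R) :
  mode_coef N c L k f = \sum_(j < N.+1)
    (mode_wu c L * sin (j%:R * wavenumber R N k) * f (2 * j)%N +
     mode_wm c L * sin ((j%:R + 1 / 2) * wavenumber R N k) * f (2 * j).+1).
Proof.
rewrite /mode_coef /sine_coef /mid_coef !mulr_sumr -big_split.
by apply: eq_bigr => j _ /=; ring.
Qed.

Lemma continuous_mode_coef (R : realType) (X : topologicalType) (N : nat)
    (c L : R) (k : nat) (v : nat -> X -> R) : (forall i, continuous (v i)) ->
  continuous (fun t => mode_coef N c L k (v^~ t)).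
Proof.
move=> cv; under eq_fun do rewrite mode_coef_sumE.
apply: continuous_sum => j; apply: continuous_add; apply: continuous_mul => //;
  exact: continuous_cst.
Qed.

Lemma is_derive_mode_coef (R : realType) (N : nat) (c L : R) (k : nat)
    (v : nat -> R -> R) (dv : nat -> R) (t : R) :
  (forall i, is_derive t 1 (v i) (dv i)) ->
  is_derive t 1 (fun s : R => mode_coef N c L k (v^~ s)) (mode_coef N c L k dv).
Proof.
move=> h; rewrite (_ : (fun s => _) = (fun s : R => \sum_(j < N.+1)
    (mode_wu c L * sin (j%:R * wavenumber R N k) * v (2 * j)%N s +
     mode_wm c L * sin ((j%:R + 1 / 2) * wavenumber R N k) * v (2 * j).+1 s))); last first.
  by apply/funext => s; rewrite mode_coef_sumE.
by rewrite mode_coef_sumE; apply: is_derive_sum_fun => j.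
Qed.

Definition real_solution (R : realType) (N : nat) (T : R)
    (v vt : nat -> R -> R) : Prop :=
  [/\ forall t, vanishing_ends N (v^~ t) /\ vanishing_ends N (vt^~ t),
      forall k, {within `[0, T], continuous (v k)},
      forall k, {within `[0, T], continuous (vt k)},
      forall k t, 0 < t < T -> is_derive t 1 (v k) (vt k t) &
      forall t, 0 < t < T -> exists a : nat -> R,
        [/\ forall k, is_derive t 1 (vt k) (a k),
            vanishing_ends N a,
            forall j, (j < N)%N ->
              node_mass a j + 10 * N.+1%:R ^+ 2 * node_stiff (v^~ t) j = 0 &
            forall j, (j <= N)%N ->
              mid_mass a j + 10 * N.+1%:R ^+ 2 * mid_stiff (v^~ t) j = 0]].

Definition piecewise_linear (R : realType) (N : nat) (f : nat -> R) : Prop :=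
  forall j, (j <= N)%N -> f (2 * j).+1 = (f (2 * j)%N + f (2 * j.+1)%N) / 2.

Lemma mode_coef_linear (R : realType) (N k : nat) (L : R) (f : nat -> R) :
  vanishing_ends N f -> piecewise_linear N f ->
  let c := cos (wavenumber R N k / 2) in
  mode_coef N c L k f =
  (10 + 20 * c * mode_mid c L) * sine_coef N (fun j => f (2 * j)%N) k.
Proof.
move=> vf lf c.
have -> : mode_coef N c L k f = mode_wu c L * sine_coef N (fun j => f (2 * j)%N) k +
   mode_wm c L * (2^-1 * (2 * c) * sine_coef N (fun j => f (2 * j)%N) k).
  congr (_ + _ * _); case: vf => f0 fN.
  rewrite -[RHS]mulrA -mid_coef_avg // /mid_coef mulr_sumr; apply: eq_bigr => j _.
  by rewrite (lf j (ltn_ord j)); field.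
by rewrite /mode_wu /mode_wm; field.
Qed.

(** Each modal coefficient is a harmonic oscillator. Linearity of the data at time T, and only
    there, makes both branches share one pair (u0, u1), up to the factor [mode_ratio]. *)
Lemma sine_coef_evolution (R : realType) (N : nat) (k : 'I_N) (T La Lo : R)
    (v vt : nat -> R -> R) :
  real_solution N T v vt -> piecewise_linear N (v^~ T) ->
  piecewise_linear N (vt^~ T) ->
  0 < La < 10 -> 12 < Lo < 60 ->
  let c := cos (wavenumber R N k / 2) in
  disp_poly (c ^+ 2) La = 0 -> disp_poly (c ^+ 2) Lo = 0 ->
  let u0 := sine_coef N (fun j => v (2 * j)%N T) k in
  let u1 := sine_coef N (fun j => vt (2 * j)%N T) k in
  let osc w (t : R) := u0 * cos (w * (t - T)) + u1 / w * sin (w * (t - T)) in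
  forall t, 0 <= t <= T ->
  sine_coef N (fun j => v (2 * j)%N t) k =
  mode_ratio c La * osc (frequency N La) t +
  mode_ratio c Lo * osc (frequency N Lo) t.
Proof.
move=> [ends cv cvt dv ode] l0 l1 /andP[La0 La10] /andP[Lo12 Lo60] c PLa PLo u0 u1 osc t tT.
have c1 : c ^+ 2 < 1 by have /andP[] := @cos_half_sqr_bounds R N k.
have n0 : 0 < N.+1%:R :> R by [].
have evol L : 0 < L -> L != 10 -> disp_poly (c ^+ 2) L = 0 ->
   mode_coef N c L k (v^~ t) = (10 + 20 * c * mode_mid c L) * osc (frequency N L) t.
  move=> L0 L10 PL.
  have w0 : frequency N L != 0 by rewrite gt_eqF // mulr_gt0 // sqrtr_gt0.
  have w2 : frequency N L ^+ 2 = L * N.+1%:R ^+ 2.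
    by rewrite /frequency exprMn sqr_sqrtr // ltW.
  rewrite (@harmonic_oscillator R (fun t => mode_coef N c L k (v^~ t))
     (fun t => mode_coef N c L k (vt^~ t)) (frequency N L) T w0 _ _ _ _ t tT).
  - have [vT vtT] := ends T; rewrite !mode_coef_linear // /osc /u0 /u1 -/c; ring.
  - exact: continuous_mode_coef.
  - exact: continuous_mode_coef.
  - by move=> s sT; apply: is_derive_mode_coef => i; exact: dv.
  - move=> s sT; have [a [da va rn rm]] := ode s sT; have [vs _] := ends s.
    rewrite w2 -(mode_coef_ode L10 PL vs va rn rm).
    exact: is_derive_mode_coef.
rewrite (mode_decomposition (sine_coef N (fun j => v (2 * j)%N t) k)
   (mid_coef N (fun j => v (2 * j).+1 t) k) La10 Lo12 c1 PLa PLo).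
have La10' : La != 10 by rewrite lt_eqF.
have ea := evol La La0 La10' PLa.
have eo : mode_coef N c Lo k (v^~ t) = (10 + 20 * c * mode_mid c Lo) * osc (frequency N Lo) t.
  by apply: evol => //; [lra|rewrite gt_eqF //; lra].
rewrite /mode_coef in ea eo.
by rewrite ea eo /mode_ratio ![(_ * osc _ _) / _]mulrAC.
Qed.

(** * Observability of real-valued solutions *)

Lemma sum_fold_rev (R : realType) (N : nat) (F : 'I_N -> R) :
  (forall k, 0 <= F k) ->
  (forall k : 'I_N, rev_ord k = k -> F k = 0) ->
  \sum_k F k <= \sum_(k < N | (2 * k.+1 < N.+1)%N) (F k + F (rev_ord k)).
Proof.
move=> F0 Fmid; rewrite big_split /= (bigID (fun k : 'I_N => (2 * k.+1 < N.+1)%N)) /=.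
(* [rev_ord] sends eta to pi - eta; an index in neither half is a fixed point, eta = pi/2, where F
   vanishes. *)
rewrite lerD2l (reindex_inj rev_ord_inj) /= big_mkcond [leRHS]big_mkcond /=.
apply: ler_sum => k _; case: ifPn => h1; case: ifPn => h2 //.
rewrite Fmid //; apply: val_inj => /=; have := ltn_ord k; lia.
Qed.

Definition bigrid_nodes (R : realType) (N : nat) (f : nat -> R) : Prop :=
  forall j, (j <= (N - 1) %/ 2)%N ->
    f (2 * j).+1 = (f (2 * j)%N + f (2 * j + 2)%N) / 2.

(* For the two wave numbers coupled by the bi-grid data: s = sin^2(eta/2) and
   (x, y), (x', y') are the squared sine coefficients at eta and pi - eta. *)
Lemma bigrid_pair_le (R : realType) (s x x' : R) : 0 <= s <= 1 / 2 -> 0 <= x ->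
  0 <= x' -> (1 - s) ^+ 2 * x' = s ^+ 2 * x -> x' <= 2 * s * x /\ x' <= x.
Proof.
move=> /andP[s0 s1] x0 x'0 E.
have h : 4^-1 <= (1 - s) ^+ 2 by nra.
have h1 : 4^-1 * x' <= s ^+ 2 * x by rewrite -E ler_wpM2r.
have h2 : s ^+ 2 <= s / 2 by nra.
have h3 : s ^+ 2 * x <= s / 2 * x by rewrite ler_wpM2r.
have h4 : s * x <= x / 2 by nra.
by split; lra.
Qed.

(** [4 * r ^+ 2 * (x + y / L)] is the squared amplitude of a mode in the trace v_N / h, stripped of
    sin eta; x and y stand for the squared sine coefficients of the position and of h times the
    velocity. *)
Lemma mode_energy_ge0 (R : realType) (r x y L : R) :
  0 <= x -> 0 <= y -> 0 <= L -> 0 <= 4 * r ^+ 2 * (x + y / L).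
Proof.
move=> x0 y0 L0; apply: mulr_ge0; first by rewrite mulr_ge0 ?sqr_ge0.
by rewrite addr_ge0 // divr_ge0.
Qed.

Lemma mode_energy_le (R : realType) (r B x y L : R) : 0 <= r <= B ->
  0 <= x -> 0 <= y -> 1 <= L -> 4 * r ^+ 2 * (x + y / L) <= 4 * B ^+ 2 * (x + y).
Proof.
move=> /andP[r0 rB] x0 y0 L1.
have rr : r ^+ 2 <= B ^+ 2 by nra.
have yL : y / L <= y by rewrite ler_pdivrMr; nra.
have yL0 : 0 <= y / L by rewrite divr_ge0 //; lra.
by apply: ler_pM; rewrite ?mulr_ge0 ?addr_ge0 ?sqr_ge0 //; lra.
Qed.

(** Here 2 s c = sin eta, with sin^2 eta >= 2 s^2 as c^2 >= 1/2. The amplitude ratio squared is at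
    least 1/36 and s^2 >= L/6; the velocity term gives the constant, 2 * (4/36) * (1/6) = 1/27. *)
Lemma low_mode_energy_ge (R : realType) (c s L x y : R) : 0 < L < 5 / 2 ->
  disp_poly (c ^+ 2) L = 0 -> c ^+ 2 + s ^+ 2 = 1 -> s ^+ 2 <= 1 / 2 ->
  0 <= x -> 0 <= y ->
  s ^+ 2 * x + y <= 27 * ((2 * s * c) ^+ 2 * (4 * mode_ratio c L ^+ 2 * (x + y / L))).
Proof.
move=> /andP[L0 L2] PL cs s2 x0 y0.
have c1 : c ^+ 2 <= 1 by have := sqr_ge0 s; lra.
have LL : 0 < L < 5 / 2 by rewrite L0.
have r6 := mode_ratio_low LL PL c1; set r := mode_ratio c L in r6 *.
have r2 : 36^-1 <= r ^+ 2 by nra.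
have sE := disp_sin_half (ltW L0) PL cs.
have D0 := disp_den_gt0 (ltW L0).
have sL : L / 6 <= s ^+ 2.
  by rewrite sE ler_pdivlMr //; rewrite /disp_den; nra.
have sc : 2 * s ^+ 2 <= (2 * s * c) ^+ 2.
  rewrite (_ : (2 * s * c) ^+ 2 = 4 * s ^+ 2 * c ^+ 2); last by ring.
  by have := sqr_ge0 s; nra.
have yL0 : 0 <= y / L by rewrite divr_ge0 // ltW.
have e1 : 36^-1 * (x + y / L) <= r ^+ 2 * (x + y / L).
  by rewrite ler_wpM2r // addr_ge0.
have e2 : 2 * s ^+ 2 * (4 * (36^-1 * (x + y / L))) <=
   (2 * s * c) ^+ 2 * (4 * r ^+ 2 * (x + y / L)).
  rewrite -[4 * r ^+ 2 * _]mulrA; apply: ler_pM => //.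
  - by rewrite mulr_ge0 ?sqr_ge0.
  - by rewrite !mulr_ge0 ?addr_ge0 ?invr_ge0.
  - by rewrite ler_wpM2l.
apply: (le_trans _ (ler_wpM2l (ler0n _ 27) e2)).
have e3 : y / 6 <= s ^+ 2 * (y / L).
  by rewrite mulrA ler_pdivlMr //; nra.
have sx : 0 <= s ^+ 2 * x by rewrite mulr_ge0 ?sqr_ge0.
lra.
Qed.

Lemma real_observability (R : realType) (T : R) : 2 < T ->
  exists C : R, 0 < C /\ forall (N : nat), odd N ->
  forall v vt : nat -> R -> R, real_solution N T v vt ->
  let u0 j := v (2 * j)%N T in let u1 j := vt (2 * j)%N T in
  piecewise_linear N (v^~ T) -> piecewise_linear N (vt^~ T) ->
  bigrid_nodes N u0 -> bigrid_nodes N u1 ->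
  N.+1%:R * (\sum_(j < N) u0 j.+1 * (2 * u0 j.+1 - (u0 j + u0 j.+2))) +
  N.+1%:R^-1 * (\sum_(j < N) u1 j.+1 ^+ 2) <=
  C * \int[lebesgue_measure]_(t in `[0, T]) ((N.+1%:R * v (2 * N)%N t) ^+ 2).
Proof.
(* 27 is the loss of [low_mode_energy_ge]; 400 bounds the undesired amplitudes in [hF], and 24 the
   folded data energy in [hE]. *)
move=> T2; have C20 : 0 < 400 * 27 :> R by lra.
have [C [C0 hC]] := spectral_observability T2 C20.
exists (24 * 27 * C); split; first by lra.
move=> N oddN v vt sol u0 u1 l0 l1 b0 b1.
have [La [Lo roots]] := disp_roots_exist R N.
have [hLa hLo] := roots.
have [ends _ _ _ _] := sol; have [[v0 vN] [vt0 vtN]] := ends T.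
set n := N.+1%:R : R; have n0 : 0 < n by [].
pose c (k : 'I_N) := cos (wavenumber R N k / 2).
pose s (k : 'I_N) := sin (wavenumber R N k / 2).
have cs k : c k ^+ 2 + s k ^+ 2 = 1 by exact: cos2Dsin2.
have c1 k : c k ^+ 2 < 1 by have /andP[] := @cos_half_sqr_bounds R N k.
have s0 k : 0 <= s k ^+ 2 by exact: sqr_ge0.
pose X (k : 'I_N) := sine_coef N u0 k ^+ 2.
pose Y (k : 'I_N) := sine_coef N u1 k ^+ 2 / n ^+ 2.
have X0 k : 0 <= X k by exact: sqr_ge0.
have Y0 k : 0 <= Y k by rewrite divr_ge0 ?sqr_ge0.
pose ra k := mode_ratio (c k) (La k); pose ro k := mode_ratio (c k) (Lo k).
pose Ea k := 4 * ra k ^+ 2 * (X k + Y k / La k).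
pose Eo k := 4 * ro k ^+ 2 * (X k + Y k / Lo k).
pose wa k := frequency N (La k); pose wo k := frequency N (Lo k).
(* Amplitudes of the trace with time counted from T / 2. The factor 2 is 1/h times the 2 h of sine
   inversion, and the sign comes from sin (N eta). *)
pose osca (r : R) (w : R) (k : 'I_N) := 2 * (-1) ^+ k * r *
  (sine_coef N u0 k * cos (w * (T / 2)) - sine_coef N u1 k / w * sin (w * (T / 2))).
pose oscb (r : R) (w : R) (k : 'I_N) := 2 * (-1) ^+ k * r *
  (sine_coef N u0 k * sin (w * (T / 2)) + sine_coef N u1 k / w * cos (w * (T / 2))).
have oscE (r L : R) k : 0 < L -> osca r (frequency N L) k ^+ 2 + oscb r (frequency N L) k ^+ 2 =
   4 * r ^+ 2 * (X k + Y k / L).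
  move=> L0; have w2 : frequency N L ^+ 2 = L * n ^+ 2.
    by rewrite /frequency exprMn sqr_sqrtr // ltW.
  have w0 : frequency N L != 0 by rewrite gt_eqF // mulr_gt0 // sqrtr_gt0.
  rewrite (_ : Y k / L = sine_coef N u1 k ^+ 2 / frequency N L ^+ 2); last first.
    by rewrite w2 /Y; field; rewrite !gt_eqF.
  have t1 := cos2Dsin2 (frequency N L * (T / 2)).
  rewrite /osca /oscb; set a := cos _ in t1 *; set b := sin _ in t1 *.
  rewrite (_ : _ + _ = 4 * ((-1) ^+ k) ^+ 2 * r ^+ 2 * (X k * (a ^+ 2 + b ^+ 2) +
     sine_coef N u1 k ^+ 2 / frequency N L ^+ 2 * (a ^+ 2 + b ^+ 2))).
    by rewrite t1 sqrr_sign !mulr1.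
  by rewrite /X; field.
have low_s (k : 'I_N) : (2 * k.+1 < N.+1)%N -> s k ^+ 2 <= 1 / 2.
  move=> lk; have pi0 := pi_gt0 R.
  have xb : wavenumber R N k <= pi / 2.
    rewrite /wavenumber ler_pdivrMr // -/n.
    have : 2 * k.+1%:R <= n :> R by rewrite -natrM ler_nat ltnW.
    nra.
  have /andP[x0 _] := @wavenumber_bounds R N k.
  have cx : 0 <= cos (wavenumber R N k) by rewrite cos_ge0_pihalf //; lra.
  have := cos_half_sqr (wavenumber R N k); rewrite -/(c k); have := cs k; lra.
have low_La (k : 'I_N) : (2 * k.+1 < N.+1)%N -> La k < 5 / 2.
  move=> lk; have [_ _ _ h] := hLa k; apply: h; rewrite -/(c k).
  by have := cs k; have := low_s k lk; lra.
have revc (f : nat -> R) (k : 'I_N) : f 0%N = 0 -> f N.+1 = 0 -> bigrid_nodes N f ->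
   c k ^+ 2 * sine_coef N f (rev_ord k) = - s k ^+ 2 * sine_coef N f k.
  by move=> f0 fN bf; apply: bigrid_sine_coef => //; exact: ltn_ord.
have revsq (f : nat -> R) (k : 'I_N) : f 0%N = 0 -> f N.+1 = 0 -> bigrid_nodes N f ->
   (1 - s k ^+ 2) ^+ 2 * sine_coef N f (rev_ord k) ^+ 2 =
   (s k ^+ 2) ^+ 2 * sine_coef N f k ^+ 2.
  move=> f0 fN bf; rewrite -!exprMn (_ : 1 - s k ^+ 2 = c k ^+ 2); last by have := cs k; lra.
  by rewrite (revc f k f0 fN bf) mulNr sqrrN.
have midz (f : nat -> R) (k : 'I_N) : f 0%N = 0 -> f N.+1 = 0 -> bigrid_nodes N f ->
   rev_ord k = k -> sine_coef N f k = 0.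
  move=> f0 fN bf rk; have := revc f k f0 fN bf; rewrite rk => E.
  rewrite -[LHS]mul1r -(cs k) mulrDl E; ring.
have lowX (k : 'I_N) : (2 * k.+1 < N.+1)%N ->
    X (rev_ord k) <= 2 * s k ^+ 2 * X k /\ X (rev_ord k) <= X k.
  move=> lk; apply: bigrid_pair_le; rewrite ?s0 ?low_s //; exact: revsq.
have lowY (k : 'I_N) : (2 * k.+1 < N.+1)%N -> Y (rev_ord k) <= Y k.
  move=> lk; rewrite /Y ler_pM2r ?invr_gt0 ?exprn_gt0 //.
  have [] // := @bigrid_pair_le R (s k ^+ 2) (sine_coef N u1 k ^+ 2) (sine_coef N u1 (rev_ord k) ^+ 2).
  - by rewrite s0 low_s.
  - exact: sqr_ge0.
  - exact: sqr_ge0.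
  - exact: revsq.
have lowE (k : 'I_N) : (2 * k.+1 < N.+1)%N ->
    s k ^+ 2 * X k + Y k <= 27 * (sin (wavenumber R N k) ^+ 2 * Ea k).
  move=> lk; have [La0 _ PL _] := hLa k.
  rewrite (_ : sin (wavenumber R N k) = 2 * s k * c k); last first.
    have {1}-> : wavenumber R N k = wavenumber R N k / 2 + wavenumber R N k / 2 by lra.
    by rewrite sinD /s /c; ring.
  apply: low_mode_energy_ge => //; last exact: low_s.
  by rewrite La0 low_La.
(* The amplitudes the filter must damp. For low k only the optical part occurs, with its factor s^2;
   for the reflected index the bi-grid relation gives the decay. *)
pose F k := (if 4 < La k then Ea k else 0) + Eo k.
have ra6 (k : 'I_N) : 0 <= ra k <= 6.
  have [? ? PL _] := hLa k; apply: mode_ratio_bound => //; last exact: ltW.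
    by apply/andP; split; lra.
  by rewrite lt_eqF.
have ros (k : 'I_N) : 0 <= ro k <= 2 * s k ^+ 2.
  have [? ? PL] := hLo k; apply: mode_ratio_optical => //.
  by apply/andP; split; lra.
have Ea0 (k : 'I_N) : 0 <= Ea k.
  by have [? _ _ _] := hLa k; apply: mode_energy_ge0 => //; exact: ltW.
have Eo0 (k : 'I_N) : 0 <= Eo k.
  by have [? _ _] := hLo k; apply: mode_energy_ge0 => //; lra.
have F0 (k : 'I_N) : 0 <= F k by rewrite addr_ge0 //; case: ifP.
have Fmid (k : 'I_N) : rev_ord k = k -> F k = 0.
  move=> rk; have x0 : X k = 0 by rewrite /X midz // expr0n.
  have y0 : Y k = 0 by rewrite /Y midz // expr0n /= mul0r.
  by rewrite /F /Ea /Eo x0 y0 !mul0r !addr0 !mulr0; case: ifP; rewrite addr0.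
pose S := \sum_(k < N | La k < 5 / 2) sin (wavenumber R N k) ^+ 2 * Ea k.
have lowS (G : 'I_N -> R) (B : R) : 0 <= B ->
   (forall k : 'I_N, (2 * k.+1 < N.+1)%N -> G k <= B * (s k ^+ 2 * X k + Y k)) ->
   \sum_(k < N | (2 * k.+1 < N.+1)%N) G k <= B * 27 * S.
  move=> B0 hG; rewrite mulr_sumr big_mkcond [leRHS]big_mkcond /=.
  apply: ler_sum => k _; case: ifP => lk.
    rewrite low_La //; apply: (le_trans (hG k lk)); rewrite -mulrA.
    by apply: ler_wpM2l => //; exact: lowE.
  case: ifP => // _; apply: mulr_ge0; first exact: mulr_ge0.
  exact: mulr_ge0 (sqr_ge0 _) (Ea0 k).
have hF : \sum_k F k <= 400 * 27 * S.
  apply: (le_trans (sum_fold_rev F0 Fmid)); apply: lowS => [|k lk]; first lra.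
  have [lx1 lx2] := lowX k lk; have ly := lowY k lk; have ls := low_s k lk.
  have h1 : F k <= 8 * (s k ^+ 2 * X k) + 4 * Y k.
    rewrite /F ltNge (ltW (lt_trans (low_La k lk) _)) /=; last by lra.
    rewrite add0r /Eo; have [l12 _ _] := hLo k; have /andP[r0 r1] := ros k.
    have YL : Y k / Lo k <= Y k by rewrite ler_pdivrMr; have := Y0 k; nra.
    have YL0 : 0 <= Y k / Lo k by rewrite divr_ge0 //; lra.
    have sk := s0 k.
    have q1 : ro k ^+ 2 <= 2 * s k ^+ 2 by nra.
    have q2 : ro k ^+ 2 <= 1 by nra.
    have q3 : ro k ^+ 2 * X k <= 2 * s k ^+ 2 * X k by rewrite ler_wpM2r.
    have q4 : ro k ^+ 2 * (Y k / Lo k) <= Y k.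
      by have := sqr_ge0 (ro k); nra.
    rewrite mulrDr -!(mulrA 4); lra.
  have h2 : F (rev_ord k) <= 160 * (X (rev_ord k) + Y (rev_ord k)).
    set k' := rev_ord k; have xy := addr_ge0 (X0 k') (Y0 k').
    have e1 : (if 4 < La k' then Ea k' else 0) <= 144 * (X k' + Y k').
      case: ifP => h4; last by lra.
      have L1 : 1 <= La k' by lra.
      apply: (le_trans (mode_energy_le (ra6 k') (X0 k') (Y0 k') L1)).
      by apply: ler_wpM2r => //; lra.
    have e2 : Eo k' <= 16 * (X k' + Y k').
      have [l12 _ _] := hLo k'; have L1 : 1 <= Lo k' by lra.
      have r2 : 0 <= ro k' <= 2.
        have /andP[r0 r1] := ros k'; rewrite r0; have := cs k'; have := sqr_ge0 (c k'); lra.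
      apply: (le_trans (mode_energy_le r2 (X0 k') (Y0 k') L1)).
      by apply: ler_wpM2r => //; lra.
    rewrite /F; lra.
  have sx := mulr_ge0 (s0 k) (X0 k).
  have yk := Y0 k; lra.
have key := hC N La Lo roots (fun k => osca (ra k) (wa k) k)
   (fun k => oscb (ra k) (wa k) k) (fun k => osca (ro k) (wo k) k)
   (fun k => oscb (ro k) (wo k) k).
have SE : \sum_(k < N | La k < 5 / 2) sin (wavenumber R N k) ^+ 2 *
   (osca (ra k) (wa k) k ^+ 2 + oscb (ra k) (wa k) k ^+ 2) = S.
  by apply: eq_bigr => k _; rewrite oscE //; have [] := hLa k.
move: key; cbv zeta; rewrite SE => key.
have {}key := key _.
(* Parseval's identity; the discrete Laplacian multiplies the coefficient by 2 - 2 cos eta = 4 sin^2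
   (eta/2). *)
have lhsE : n * (\sum_(j < N) u0 j.+1 * (2 * u0 j.+1 - (u0 j + u0 j.+2))) +
  n^-1 * (\sum_(j < N) u1 j.+1 ^+ 2) = \sum_(k < N) (8 * (s k ^+ 2 * X k) + 2 * Y k).
  have p0 := sine_parseval N u0 (fun j => 2 * u0 j - (u0 j.-1 + u0 j.+1)).
  have p1 := sine_parseval N u1 u1.
  rewrite (_ : n * _ = 2 * (n / 2 * \sum_(j < N) u0 j.+1 *
     (2 * u0 j.+1 - (u0 j.+1.-1 + u0 j.+2)))); last by field.
  rewrite -p0 (_ : n^-1 * _ = 2 / n ^+ 2 * (n / 2 * \sum_(j < N) u1 j.+1 * u1 j.+1)); last first.
    under eq_bigr do rewrite expr2.
    by field; rewrite gt_eqF.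
  rewrite -p1 !mulr_sumr -big_split; apply: eq_bigr => k _ /=.
  congr (_ + _); last by rewrite /Y expr2; ring.
  have -> : sine_coef N (fun j => 2 * u0 j - (u0 j.-1 + u0 j.+1)) k =
    2 * sine_coef N u0 k - 2 * cos (wavenumber R N k) * sine_coef N u0 k.
    rewrite -(@sine_coef_laplace _ N k u0) // [sine_coef N (fun _ => _) k]sine_coef_shift.
    rewrite sine_coef_shift mulr_sumr -sumrB; apply: eq_bigr => j _ /=; ring.
  have := cos_half_sqr (wavenumber R N k); rewrite -/(c k) => <-.
  rewrite (_ : c k ^+ 2 = 1 - s k ^+ 2); last by have := cs k; lra.
  by rewrite /X; ring.
rewrite lhsE.
have hE : \sum_(k < N) (8 * (s k ^+ 2 * X k) + 2 * Y k) <= 24 * 27 * S.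
  apply: (le_trans (sum_fold_rev _ _)).
  - by move=> k; have := mulr_ge0 (s0 k) (X0 k); have := Y0 k; lra.
  - by move=> k rk; rewrite /X /Y !midz // expr0n /= mul0r !mulr0 addr0.
  - apply: lowS => [|k lk]; first lra.
    have [lx1 lx2] := lowX k lk; have ly := lowY k lk.
    have s1 : s (rev_ord k) ^+ 2 <= 1.
      by have := cs (rev_ord k); have := sqr_ge0 (c (rev_ord k)); lra.
    have sx : s (rev_ord k) ^+ 2 * X (rev_ord k) <= X (rev_ord k) by rewrite ler_piMl.
    have yk := Y0 k; lra.
apply: (le_trans hE); rewrite -[leRHS]mulrA; apply: ler_wpM2l; first lra.
have hyp : \sum_(k < N | 4 < La k) (osca (ra k) (wa k) k ^+ 2 + oscb (ra k) (wa k) k ^+ 2) +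
   \sum_(k < N) (osca (ro k) (wo k) k ^+ 2 + oscb (ro k) (wo k) k ^+ 2) <= 400 * 27 * S.
  have FE : \sum_k F k = \sum_(k < N | 4 < La k) Ea k + \sum_k Eo k.
    by rewrite [in RHS]big_mkcond -big_split.
  apply: le_trans hF; rewrite FE.
  rewrite le_eqVlt; apply/orP; left; apply/eqP; congr (_ + _).
    by apply: eq_bigr => k _; rewrite oscE //; have [] := hLa k.
  by apply: eq_bigr => k _; rewrite oscE //; have [] := hLo k; lra.
apply: (le_trans (key hyp)); rewrite ler_wpM2l ?(ltW C0) //.
set G := (X in Rintegral _ _ X).
pose f (t : R) := G (t + - (T / 2)).
have cG : continuous G.
  apply: continuous_mul; apply: continuous_add; exact: continuous_trig_sum.
have cf : continuous f.
  move=> t; apply: (@continuous_comp _ _ _ (fun x => x + - (T / 2)) G); last exact: cG.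
  by apply: continuousD; [exact: id|exact: cst_continuous].
have T2' : - (T / 2) <= T / 2 by lra.
have sh := Rintegral_shift (T / 2) T2' cf.
have -> : Rintegral lebesgue_measure `[- (T / 2), T / 2] G =
   \int[lebesgue_measure]_(t in `[- (T / 2), T / 2]) f (t + T / 2).
  by apply: eq_Rintegral => t _; rewrite /f addrK.
rewrite sh addNr (_ : T / 2 + T / 2 = T); last by lra.
rewrite le_eqVlt; apply/orP; left; apply/eqP; apply: eq_Rintegral => t.
rewrite inE /= in_itv /= => tT; rewrite /f /G; congr (_ ^+ 2).
have N0 : (N.-1 < N)%N by case: (N) oddN.
have NE : N.-1.+1 = N by rewrite prednK //; case: (N) oddN.
have := sine_inversion (fun j => v (2 * j)%N t) (Ordinal N0); rewrite /= NE => ->.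
rewrite mulrA (_ : n * (2 / n) = 2); last by field; rewrite gt_eqF.
rewrite /trig_sum -big_split mulr_sumr; apply: eq_bigr => k _ /=.
have [? ? PLa _] := hLa k; have [? ? PLo] := hLo k.
rewrite (@sine_coef_evolution R N k T (La k) (Lo k) v vt sol l0 l1 _ _ PLa PLo t tT);
  [|by apply/andP; split|by apply/andP; split].
rewrite sin_wavenumber_last -/(c k) -/(ra k) -/(ro k) -/(wa k) -/(wo k) -/u0 -/u1.
have shift (w : R) : (cos (w * (t - T)) = cos (w * (t - T / 2)) * cos (w * (T / 2)) +
     sin (w * (t - T / 2)) * sin (w * (T / 2))) *
   (sin (w * (t - T)) = sin (w * (t - T / 2)) * cos (w * (T / 2)) -
     cos (w * (t - T / 2)) * sin (w * (T / 2))).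
  rewrite (_ : w * (t - T) = w * (t - T / 2) - w * (T / 2)); last by field.
  by rewrite cosB sinB.
rewrite !shift /osca /oscb -!mulrN; ring.
Qed.

(** * Finite element matrices *)

Lemma integrable_setU_disjoint (R : realType) (A B : set R) (f : R -> R) :
  measurable A -> measurable B -> [disjoint A & B] ->
  (@lebesgue_measure R).-integrable A (EFin \o f) ->
  (@lebesgue_measure R).-integrable B (EFin \o f) ->
  (@lebesgue_measure R).-integrable (A `|` B) (EFin \o f).
Proof.
move=> mA mB AB /integrableP[mfA iA] /integrableP[mfB iB].
apply/integrableP; split; first exact/measurable_funU.
rewrite ge0_integral_setU //; first exact: lte_add_pinfty.
by apply: measurableT_comp => //; exact/measurable_funU.
Qed.

(** Agreement is assumed only inside the element because derivatives of basis functions are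
    arbitrary at the nodes. Half-open elements make the union disjoint. *)
Lemma integral_eq_on_interior (R : realType) (f g : R -> R) (a b : R) : a < b ->
  continuous g -> (forall x, a < x < b -> f x = g x) ->
  (@lebesgue_measure R).-integrable `]a, b] (EFin \o f) /\
  \int[lebesgue_measure]_(x in `]a, b]) f x =
  \int[lebesgue_measure]_(x in `[a, b]) g x.
Proof.
move=> ab cg fg.
have ig : (@lebesgue_measure R).-integrable `]a, b[ (EFin \o g).
  apply: (integrableS _ _ _ (@continuous_integrable _ g a b cg)) => //.
  exact: subset_itv_oo_cc.
have iF : (@lebesgue_measure R).-integrable `]a, b[ (EFin \o f).
  apply: eq_integrable ig => // x; rewrite inE /= in_itv /= => xab.
  by rewrite fg.
have E : [set` `]a, b]] = [set` `]a, b[] `|` [set b] :> set R.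
  by rewrite setUitv1.
split.
  rewrite E; apply: integrable_setU_disjoint => //.
    apply/disj_setPRL => x /= ->; rewrite in_itv /= ltxx andbF //.
  by apply: null_set_integrable => //; [exact: measurable_fun_set1|exact: lebesgue_measure_set1].
rewrite -Rintegral_itv_bndo_bndc //.
transitivity (\int[lebesgue_measure]_(x in `]a, b[) g x).
  by apply: eq_Rintegral => x; rewrite inE /= in_itv /= => xab; rewrite fg.
rewrite Rintegral_itv_obnd_cbnd // Rintegral_itv_bndo_bndc //.
apply: (integrableS _ _ _ (@continuous_integrable _ g a b cg)) => //.
exact: subset_itv_co_cc.
Qed.

Lemma Rintegral_elements (R : realType) (f : R -> R) (g : nat -> R -> R)
    (x : nat -> R) (n : nat) :
  (forall e, x e < x e.+1) -> (forall e, continuous (g e)) ->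
  (forall e t, (e < n)%N -> x e < t < x e.+1 -> f t = g e t) ->
  \int[lebesgue_measure]_(t in `[x 0%N, x n]) f t =
  \sum_(e < n) \int[lebesgue_measure]_(t in `[x e, x e.+1]) g e t.
Proof.
move=> x_lt cg.
have x_le e : x 0%N <= x e by elim: e => // e IH; apply: le_trans IH (ltW (x_lt e)).
(* Integrability is carried along the induction, since additivity over the next element requires
   it. *)
suff H : (forall e t, (e < n)%N -> x e < t < x e.+1 -> f t = g e t) ->
  (@lebesgue_measure R).-integrable `[x 0%N, x n] (EFin \o f) /\
  \int[lebesgue_measure]_(t in `[x 0%N, x n]) f t =
  \sum_(e < n) \int[lebesgue_measure]_(t in `[x e, x e.+1]) g e t.
  by move=> /H[].
elim: n => [|n IH] fg.
  rewrite big_ord0 set_itv1 Rintegral_set1; split => //.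
  by apply: null_set_integrable => //; [exact: measurable_fun_set1|exact: lebesgue_measure_set1].
have [|i1 e1] := IH; first by move=> e t en; apply: fg; exact: ltnW.
have [i2 e2] := integral_eq_on_interior (x_lt n) (cg n) (fg n ^~ (ltnSn n)).
have E : [set` `[x 0%N, x n.+1]] = [set` `[x 0%N, x n]] `|` [set` `]x n, x n.+1]] :> set R.
  by rewrite -itv_bndbnd_setU // bnd_simp ?x_le // ltW.
have dAB : [disjoint [set` `[x 0%N, x n]] & [set` `]x n, x n.+1]]].
  apply/disj_setPRL => t /=; rewrite !in_itv /= => /andP[h _] /andP[_ h2].
  by move: h; rewrite ltNge h2.
have iU : (@lebesgue_measure R).-integrable ([set` `[x 0%N, x n]] `|` [set` `]x n, x n.+1]]) (EFin \o f).
  exact: integrable_setU_disjoint.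
rewrite E; split => //.
by rewrite Rintegral_setU // e1 e2 big_ord_recr.
Qed.

(** Incidence of the assembly: index k/2 is the left end, midpoint or right end of element e for a =
    0, 1, 2. *)
Definition local_ind (R : nzRingType) (e k a : nat) : R := (k == 2 * e + a)%:R.

Lemma phi_half_element (R : realType) (N e k : nat) (y : R) :
  e%:R < y < e%:R + 1 ->
  phi_half N k (y / N.+1%:R) =
  local_ind R e k 0 * ((1 - (y - e%:R)) * (1 - 2 * (y - e%:R))) +
  local_ind R e k 1 * (4 * (y - e%:R) * (1 - (y - e%:R))) +
  local_ind R e k 2 * ((y - e%:R) * (2 * (y - e%:R) - 1)).
Proof.
move=> /andP[y0 y1].
have n0 : 0 < N.+1%:R :> R by [].
have cmp1 (s : R) : (xpt N s <= y / N.+1%:R) = (s <= y).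
  by rewrite /xpt /meshsize ler_pM2r ?invr_gt0.
have cmp2 (s : R) : (y / N.+1%:R <= xpt N s) = (y <= s).
  by rewrite /xpt /meshsize ler_pM2r ?invr_gt0.
rewrite /phi_half /local_ind; case: ifP => ok.
  rewrite /phi_mid !cmp1 !cmp2.
  have kE : k = (2 * k./2 + 1)%N by have := odd_double_half k; rewrite ok; lia.
  set j := k./2 in kE *.
  have -> : (k == 2 * e + 0)%N = false by apply/eqP; lia.
  have -> : (k == 2 * e + 2)%N = false by apply/eqP; lia.
  have -> : (k == 2 * e + 1)%N = (e == j) by apply/eqP/eqP; lia.
  case: (ltngtP e j) => ej.
  - have h : e%:R + 1 <= j%:R :> R by rewrite natr1 ler_nat.
    by rewrite ifF /= ?mulr0n ?mul0r ?addr0 //; apply/negbTE/negP => /andP[? ?]; lra.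
  - have h : j%:R + 1 <= e%:R :> R by rewrite natr1 ler_nat.
    by rewrite ifF /= ?mulr0n ?mul0r ?addr0 //; apply/negbTE/negP => /andP[? ?]; lra.
  - rewrite -ej ifT; last by apply/andP; split; lra.
    by rewrite /xpt /meshsize /= !mulr0n !mulr1n; field; rewrite gt_eqF.
rewrite /phi_node !cmp1 !cmp2.
have kE : k = (2 * k./2)%N by have := odd_double_half k; rewrite ok; lia.
set j := k./2 in kE *.
have -> : (k == 2 * e + 0)%N = (e == j) by apply/eqP/eqP; lia.
have -> : (k == 2 * e + 2)%N = (e.+1 == j) by apply/eqP/eqP; lia.
have -> : (k == 2 * e + 1)%N = false by apply/eqP; lia.
have [ej|ej] := eqVneq e.+1 j.
  have -> : (e == j) = false by apply/eqP; lia.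
  have jE : j%:R = e%:R + 1 :> R by rewrite -ej natr1.
  rewrite jE ifT; last by apply/andP; split; lra.
  by rewrite /xpt /meshsize /= !mulr0n !mulr1n; field; rewrite gt_eqF.
have [ej2|ej2] := eqVneq e j.
  have jE : j%:R = e%:R :> R by rewrite ej2.
  rewrite jE ifF; last by apply/negbTE/negP => /andP[? ?]; lra.
  rewrite ifT; last by apply/andP; split; lra.
  by rewrite /xpt /meshsize /= !mulr0n !mulr1n; field; rewrite gt_eqF.
rewrite /= !mulr0n !mul0r !addr0.
have [lt_ej|lt_ej] := ltnP e j.
  have h : e%:R + 2 <= j%:R :> R by rewrite -natrD ler_nat; lia.
  rewrite ifF; last by apply/negbTE/negP => /andP[? ?]; lra.
  by rewrite ifF //; apply/negbTE/negP => /andP[? ?]; lra.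
have h : j%:R + 1 <= e%:R :> R by rewrite natr1 ler_nat; lia.
rewrite ifF; last by apply/negbTE/negP => /andP[? ?]; lra.
by rewrite ifF //; apply/negbTE/negP => /andP[? ?]; lra.
Qed.

Lemma derive_phi_half_element (R : realType) (N e k : nat) (x : R) :
  e%:R < x * N.+1%:R < e%:R + 1 ->
  (phi_half N k)^`()%classic x =
  N.+1%:R * (local_ind R e k 0 * (4 * (x * N.+1%:R - e%:R) - 3) +
  local_ind R e k 1 * (4 - 8 * (x * N.+1%:R - e%:R)) +
  local_ind R e k 2 * (4 * (x * N.+1%:R - e%:R) - 1)).
Proof.
move=> xe; have n0 : 0 < N.+1%:R :> R by [].
have n1 : N.+1%:R != 0 :> R by rewrite gt_eqF.
pose q (z : R) := local_ind R e k 0 * ((1 - (z * N.+1%:R - e%:R)) * (1 - 2 * (z * N.+1%:R - e%:R))) +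
  local_ind R e k 1 * (4 * (z * N.+1%:R - e%:R) * (1 - (z * N.+1%:R - e%:R))) +
  local_ind R e k 2 * ((z * N.+1%:R - e%:R) * (2 * (z * N.+1%:R - e%:R) - 1)).
have dq : is_derive x 1 q (N.+1%:R * (local_ind R e k 0 * (4 * (x * N.+1%:R - e%:R) - 3) +
  local_ind R e k 1 * (4 - 8 * (x * N.+1%:R - e%:R)) +
  local_ind R e k 2 * (4 * (x * N.+1%:R - e%:R) - 1))).
  have h : is_derive x 1 (fun z : R => z * N.+1%:R - e%:R) N.+1%:R.
    by apply: is_derive_eq; rewrite /GRing.scale /=; ring.
  by apply: is_derive_eq; rewrite /GRing.scale /=; ring.
have near_q : \near x, q x = phi_half N k x.
  have xI : x \in `](e%:R / N.+1%:R), ((e%:R + 1) / N.+1%:R)[.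
    by rewrite in_itv /= ltr_pdivrMr // ltr_pdivlMr.
  have := near_in_itvoo xI; apply: filterS => z; rewrite in_itv /=.
  rewrite ltr_pdivrMr // ltr_pdivlMr // => zI.
  by rewrite -[z in RHS](mulfK n1) (@phi_half_element R N e k _ zI).
have := near_eq_is_derive near_q dq => d.
by rewrite derive1E; apply: derive_val.
Qed.

Lemma is_derive_element_coord (R : realType) (n e x : R) :
  is_derive x 1 (fun z : R => z * n - e) n.
Proof. by apply: is_derive_eq; rewrite /GRing.scale /=; ring. Qed.

Lemma element_quad_continuous (R : realType) (n e c0 c1 c2 d0 d1 d2 : R) :
  continuous (fun x : R => (c0 + c1 * (x * n - e) + c2 * (x * n - e) ^+ 2) *
     (d0 + d1 * (x * n - e) + d2 * (x * n - e) ^+ 2)).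
Proof.
have cs : continuous (fun z : R => z * n - e).
  exact: is_derive_continuous (is_derive_element_coord n e).
have cq (a b c : R) : continuous (fun x : R => a + b * (x * n - e) + c * (x * n - e) ^+ 2).
  apply: continuous_add; [apply: continuous_add|]; try exact: continuous_cst.
    by apply: continuous_mul; [exact: continuous_cst|exact: cs].
  by apply: continuous_mul; [exact: continuous_cst|exact: continuous_mul].
exact: continuous_mul.
Qed.

Lemma Rintegral_element_quad (R : realType) (n e c0 c1 c2 d0 d1 d2 : R) : 0 < n ->
  \int[lebesgue_measure]_(x in `[e / n, (e + 1) / n])
    ((c0 + c1 * (x * n - e) + c2 * (x * n - e) ^+ 2) *
     (d0 + d1 * (x * n - e) + d2 * (x * n - e) ^+ 2)) =
  n^-1 * (c0 * d0 + (c0 * d1 + c1 * d0) / 2 +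
          (c0 * d2 + c1 * d1 + c2 * d0) / 3 + (c1 * d2 + c2 * d1) / 4 +
          c2 * d2 / 5).
Proof.
move=> n0.
pose F (x : R) := n^-1 * (c0 * d0 * (x * n - e) + (c0 * d1 + c1 * d0) / 2 * (x * n - e) ^+ 2 +
    (c0 * d2 + c1 * d1 + c2 * d0) / 3 * (x * n - e) ^+ 3 +
    (c1 * d2 + c2 * d1) / 4 * (x * n - e) ^+ 4 + c2 * d2 / 5 * (x * n - e) ^+ 5).
have FE : F ((e + 1) / n) - F (e / n) = n^-1 * (c0 * d0 + (c0 * d1 + c1 * d0) / 2 +
          (c0 * d2 + c1 * d1 + c2 * d0) / 3 + (c1 * d2 + c2 * d1) / 4 + c2 * d2 / 5).
  by rewrite /F !divfK ?gt_eqF //; field; rewrite gt_eqF.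
rewrite -FE; apply: (@Rintegral_FTC _ _ F).
- by rewrite ler_pM2r ?invr_gt0 // lerDl.
- exact: element_quad_continuous.
- move=> x _; have h := is_derive_element_coord n e x.
  apply: is_derive_eq; rewrite /GRing.scale /=.
  by field; rewrite gt_eqF.
Qed.

Lemma element_nodes_lt (R : realType) (N e : nat) :
  e%:R / N.+1%:R < e.+1%:R / N.+1%:R :> R.
Proof. by rewrite ltr_pM2r ?invr_gt0 // ltr_nat. Qed.

Lemma element_mem (R : realType) (N e : nat) (t : R) :
  e%:R / N.+1%:R < t < e.+1%:R / N.+1%:R -> e%:R < t * N.+1%:R < e%:R + 1.
Proof. by rewrite ltr_pdivrMr // ltr_pdivlMr // natr1. Qed.

Lemma Rintegral_unit_elements (R : realType) (N : nat) (f : R -> R)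
    (c0 c1 c2 d0 d1 d2 : nat -> R) :
  (forall e (t : R), (e < N.+1)%N -> e%:R < t * N.+1%:R < e%:R + 1 ->
     f t = (c0 e + c1 e * (t * N.+1%:R - e%:R) + c2 e * (t * N.+1%:R - e%:R) ^+ 2) *
           (d0 e + d1 e * (t * N.+1%:R - e%:R) + d2 e * (t * N.+1%:R - e%:R) ^+ 2)) ->
  \int[lebesgue_measure]_(t in `[0, 1]) f t =
  \sum_(e < N.+1) N.+1%:R^-1 * (c0 e * d0 e + (c0 e * d1 e + c1 e * d0 e) / 2 +
          (c0 e * d2 e + c1 e * d1 e + c2 e * d0 e) / 3 +
          (c1 e * d2 e + c2 e * d1 e) / 4 + c2 e * d2 e / 5).
Proof.
move=> fE; have n0 : 0 < N.+1%:R :> R by [].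
have := @Rintegral_elements R f (fun e t =>
   (c0 e + c1 e * (t * N.+1%:R - e%:R) + c2 e * (t * N.+1%:R - e%:R) ^+ 2) *
           (d0 e + d1 e * (t * N.+1%:R - e%:R) + d2 e * (t * N.+1%:R - e%:R) ^+ 2))
   (fun e => e%:R / N.+1%:R) N.+1 (element_nodes_lt R N) _ _.
rewrite mul0r divff ?gt_eqF // => -> //; last 2 first.
- by move=> e; exact: element_quad_continuous.
- by move=> e t eN tI; apply: fE => //; exact: element_mem.
by apply: eq_bigr => e _; rewrite -[e.+1%:R]natr1 Rintegral_element_quad.
Qed.

Lemma sum_ord3 (V : nmodType) (F : 'I_3 -> V) :
  \sum_(a < 3) F a =
  F (@Ordinal 3 0 isT) + F (@Ordinal 3 1 isT) + F (@Ordinal 3 2 isT).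
Proof.
rewrite !big_ord_recr big_ord0 /= add0r.
by congr (F _ + F _ + F _); exact: val_inj.
Qed.

(** The quadratic element mass matrix times 30 / h; [stiff_local] is the element stiffness matrix
    times 3 h. *)
Definition mass_local (R : nzRingType) (a b : nat) : R :=
  nth 0 (nth [::] [:: [:: 4; 2; -1]; [:: 2; 16; 2]; [:: -1; 2; 4]] a) b.

Definition stiff_local (R : nzRingType) (a b : nat) : R :=
  nth 0 (nth [::] [:: [:: 7; -8; 1]; [:: -8; 16; -8]; [:: 1; -8; 7]] a) b.

Lemma mass_mxE (R : realType) (N : nat) (i k : 'I_(2 * N).+1) :
  mass_mx R N i k = (30 * N.+1%:R)^-1 * \sum_(e < N.+1) \sum_(a < 3) \sum_(b < 3)
    mass_local R a b * local_ind R e i.+1 a * local_ind R e k.+1 b.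
Proof.
rewrite mxE; have n1 : N.+1%:R != 0 :> R by rewrite pnatr_eq0.
pose I a e := local_ind R e i.+1 a; pose K a e := local_ind R e k.+1 a.
rewrite (@Rintegral_unit_elements R N _ (I 0%N)
  (fun e => 4 * I 1%N e - 3 * I 0%N e - I 2%N e)
  (fun e => 2 * I 0%N e - 4 * I 1%N e + 2 * I 2%N e) (K 0%N)
  (fun e => 4 * K 1%N e - 3 * K 0%N e - K 2%N e)
  (fun e => 2 * K 0%N e - 4 * K 1%N e + 2 * K 2%N e)).
  rewrite mulr_sumr; apply: eq_bigr => e _; rewrite !sum_ord3 /mass_local /= -/(I 0%N e) -/(I 1%N e) -/(I 2%N e).
  by rewrite -/(K 0%N e) -/(K 1%N e) -/(K 2%N e); field.
move=> e t _ te.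
rewrite -[t in phi_half _ _ t](mulfK n1) -[t in X in _ * X = _](mulfK n1).
rewrite !(@phi_half_element R N e _ _ te) -/(I 0%N e) -/(I 1%N e) -/(I 2%N e).
by rewrite -/(K 0%N e) -/(K 1%N e) -/(K 2%N e); ring.
Qed.

Lemma stiff_mxE (R : realType) (N : nat) (i k : 'I_(2 * N).+1) :
  stiff_mx R N i k = N.+1%:R / 3 * \sum_(e < N.+1) \sum_(a < 3) \sum_(b < 3)
    stiff_local R a b * local_ind R e i.+1 a * local_ind R e k.+1 b.
Proof.
rewrite mxE; have n1 : N.+1%:R != 0 :> R by rewrite pnatr_eq0.
pose n := N.+1%:R : R.
pose I a e := local_ind R e i.+1 a; pose K a e := local_ind R e k.+1 a.
rewrite (@Rintegral_unit_elements R N _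
  (fun e => n * (4 * I 1%N e - 3 * I 0%N e - I 2%N e))
  (fun e => n * (4 * I 0%N e - 8 * I 1%N e + 4 * I 2%N e)) (fun=> 0)
  (fun e => n * (4 * K 1%N e - 3 * K 0%N e - K 2%N e))
  (fun e => n * (4 * K 0%N e - 8 * K 1%N e + 4 * K 2%N e)) (fun=> 0)).
  rewrite mulr_sumr; apply: eq_bigr => e _; rewrite !sum_ord3 /stiff_local /= -/(I 0%N e) -/(I 1%N e) -/(I 2%N e).
  by rewrite -/(K 0%N e) -/(K 1%N e) -/(K 2%N e) /n; field.
move=> e t _ te; rewrite !(derive_phi_half_element _ te).
rewrite -/(I 0%N e) -/(I 1%N e) -/(I 2%N e) -/(K 0%N e) -/(K 1%N e) -/(K 2%N e) -/n.
ring.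
Qed.

(** The end indices 0 and 2N + 2 have no matrix column; [vanishing_ends] lets the boundary elements
    be treated like the others. *)
Lemma sum_local_ind (R : realType) (N e a : nat) (f : nat -> R) :
  (e <= N)%N -> (a <= 2)%N -> vanishing_ends N f ->
  \sum_(k < (2 * N).+1) local_ind R e k.+1 a * f k.+1 = f (2 * e + a)%N.
Proof.
move=> eN a2 [f0 fN]; have [E|E] := boolP (0 < 2 * e + a < 2 * N.+1)%N.
  have lt : ((2 * e + a).-1 < (2 * N).+1)%N by lia.
  rewrite (bigD1 (Ordinal lt)) //= big1 ?addr0 => [|k].
    have -> : (2 * e + a).-1.+1 = (2 * e + a)%N by lia.
    by rewrite /local_ind eqxx mul1r.
  rewrite -val_eqE /= => ke; rewrite /local_ind.
  have -> : (k.+1 == 2 * e + a)%N = false by apply/eqP; move/eqP: ke; lia.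
  by rewrite mul0r.
have -> : f (2 * e + a)%N = 0.
  have [->//|->//] : (2 * e + a = 0 \/ 2 * e + a = 2 * N.+1)%N by lia.
rewrite big1 // => k _; rewrite /local_ind.
have -> : (k.+1 == 2 * e + a)%N = false by apply/eqP; have := ltn_ord k; lia.
by rewrite mul0r.
Qed.

Lemma sum_element_ind (R : realType) (n j i a : nat) (X : nat -> R) :
  i = (2 * j + a)%N -> (j < n)%N ->
  \sum_(e < n) local_ind R e i a * X e = X j.
Proof.
move=> iE jn; rewrite (bigD1 (Ordinal jn)) //= big1 ?addr0 => [|e].
  by rewrite /local_ind iE eqxx mul1r.
rewrite -val_eqE /= => ej; rewrite /local_ind.
have -> : (i == 2 * e + a)%N = false by apply/eqP; move/eqP: ej; lia.
by rewrite mul0r.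
Qed.

Lemma sum_element_ind0 (R : realType) (n i a : nat) (X : nat -> R) :
  (forall e, i != 2 * e + a)%N -> \sum_(e < n) local_ind R e i a * X e = 0.
Proof.
by move=> h; rewrite big1 // => e _; rewrite /local_ind (negPf (h e)) mul0r.
Qed.

Lemma local_row (R : realType) (N i : nat) (f : nat -> R)
    (m : nat -> nat -> R) : vanishing_ends N f ->
  \sum_(k < (2 * N).+1) (\sum_(e < N.+1) \sum_(a < 3) \sum_(b < 3)
     m a b * local_ind R e i a * local_ind R e k.+1 b) * f k.+1 =
  \sum_(a < 3) \sum_(e < N.+1) local_ind R e i a *
     (\sum_(b < 3) m a b * f (2 * e + b)%N).
Proof.
move=> vf; under eq_bigr do rewrite mulr_suml.
rewrite exchange_big [RHS]exchange_big /=; apply: eq_bigr => e _.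
under eq_bigr do rewrite mulr_suml.
rewrite exchange_big; apply: eq_bigr => a _ /=.
under eq_bigr do rewrite mulr_suml.
rewrite exchange_big mulr_sumr; apply: eq_bigr => b _ /=.
rewrite -(@sum_local_ind R N e b f) //; last 2 first.
- by rewrite -ltnS.
- by rewrite -ltnS.
rewrite !mulr_sumr; apply: eq_bigr => k _; ring.
Qed.

Lemma local_row_node (R : realType) (N j : nat) (f : nat -> R)
    (m : nat -> nat -> R) : vanishing_ends N f -> (j < N)%N ->
  \sum_(k < (2 * N).+1) (\sum_(e < N.+1) \sum_(a < 3) \sum_(b < 3)
     m a b * local_ind R e (2 * j.+1) a * local_ind R e k.+1 b) * f k.+1 =
  m 0%N 0%N * f (2 * j.+1)%N + m 0%N 1%N * f (2 * j.+1).+1 +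
  m 0%N 2%N * f (2 * j.+2)%N +
  (m 2%N 0%N * f (2 * j)%N + m 2%N 1%N * f (2 * j).+1 + m 2%N 2%N * f (2 * j.+1)%N).
Proof.
move=> vf jN; rewrite local_row // sum_ord3 /=.
rewrite (@sum_element_ind R N.+1 j.+1 _ 0
  (fun e => \sum_(b < 3) m 0%N b * f (2 * e + b)%N)) //; last by rewrite addn0.
rewrite (@sum_element_ind0 R N.+1 _ 1
  (fun e => \sum_(b < 3) m 1%N b * f (2 * e + b)%N)); last by move=> e; lia.
rewrite (@sum_element_ind R N.+1 j _ 2
  (fun e => \sum_(b < 3) m 2%N b * f (2 * e + b)%N)) //; [|lia|lia].
rewrite !sum_ord3 /= !addn0 !addn1 !addn2.
rewrite (_ : (2 * j.+1).+2 = 2 * j.+2)%N; last by lia.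
rewrite (_ : (2 * j).+2 = 2 * j.+1)%N; last by lia.
ring.
Qed.

Lemma local_row_mid (R : realType) (N j : nat) (f : nat -> R)
    (m : nat -> nat -> R) : vanishing_ends N f -> (j <= N)%N ->
  \sum_(k < (2 * N).+1) (\sum_(e < N.+1) \sum_(a < 3) \sum_(b < 3)
     m a b * local_ind R e (2 * j).+1 a * local_ind R e k.+1 b) * f k.+1 =
  m 1%N 0%N * f (2 * j)%N + m 1%N 1%N * f (2 * j).+1 + m 1%N 2%N * f (2 * j.+1)%N.
Proof.
move=> vf jN; rewrite local_row // sum_ord3 /=.
rewrite (@sum_element_ind0 R N.+1 _ 0
  (fun e => \sum_(b < 3) m 0%N b * f (2 * e + b)%N)); last by move=> e; lia.
rewrite (@sum_element_ind R N.+1 j _ 1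
  (fun e => \sum_(b < 3) m 1%N b * f (2 * e + b)%N)) //; [|lia].
rewrite (@sum_element_ind0 R N.+1 _ 2
  (fun e => \sum_(b < 3) m 2%N b * f (2 * e + b)%N)); last by move=> e; lia.
rewrite !sum_ord3 /= !addn0 !addn1 !addn2.
rewrite (_ : (2 * j).+2 = 2 * j.+1)%N; last by lia.
ring.
Qed.

Section MatrixRows.
Variables (R : realType) (N : nat) (f : nat -> R) (i : 'I_(2 * N).+1) (j : nat).
Hypothesis vf : vanishing_ends N f.

Lemma mass_row_node : i.+1 = (2 * j.+1)%N ->
  \sum_k mass_mx R N i k * f k.+1 = (30 * N.+1%:R)^-1 * node_mass f j.
Proof.
move=> iE; have jN : (j < N)%N by have := ltn_ord i; lia.
under eq_bigr do rewrite mass_mxE iE -mulrA.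
rewrite -mulr_sumr; congr (_ * _).
by rewrite (local_row_node (mass_local R) vf jN) /mass_local /node_mass /=; ring.
Qed.

Lemma mass_row_mid : i.+1 = (2 * j).+1 ->
  \sum_k mass_mx R N i k * f k.+1 = (30 * N.+1%:R)^-1 * mid_mass f j.
Proof.
move=> iE; have jN : (j <= N)%N by have := ltn_ord i; lia.
under eq_bigr do rewrite mass_mxE iE -mulrA.
rewrite -mulr_sumr; congr (_ * _).
by rewrite (local_row_mid (mass_local R) vf jN) /mass_local /mid_mass /=; ring.
Qed.

Lemma stiff_row_node : i.+1 = (2 * j.+1)%N ->
  \sum_k stiff_mx R N i k * f k.+1 = N.+1%:R / 3 * node_stiff f j.
Proof.
move=> iE; have jN : (j < N)%N by have := ltn_ord i; lia.
under eq_bigr do rewrite stiff_mxE iE -[N.+1%:R / 3 * _ * _]mulrA.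
rewrite -mulr_sumr; congr (_ * _).
by rewrite (local_row_node (stiff_local R) vf jN) /stiff_local /node_stiff /=; ring.
Qed.

Lemma stiff_row_mid : i.+1 = (2 * j).+1 ->
  \sum_k stiff_mx R N i k * f k.+1 = N.+1%:R / 3 * mid_stiff f j.
Proof.
move=> iE; have jN : (j <= N)%N by have := ltn_ord i; lia.
under eq_bigr do rewrite stiff_mxE iE -[N.+1%:R / 3 * _ * _]mulrA.
rewrite -mulr_sumr; congr (_ * _).
by rewrite (local_row_mid (stiff_local R) vf jN) /stiff_local /mid_stiff /=; ring.
Qed.

End MatrixRows.

(** * Complex data *)

Local Open Scope complex_scope.

Lemma sum_nodes_mids (V : nmodType) (N : nat) (G : nat -> V) :
  \sum_(i < (2 * N).+1) G i.+1 =
  \sum_(j < N) G (2 * j.+1)%N + \sum_(j < N.+1) G (2 * j).+1.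
Proof.
elim: N => [|N IH]; first by rewrite big_ord0 add0r !big_ord1.
rewrite (_ : (2 * N.+1).+1 = (2 * N).+3)%N; last by lia.
rewrite big_ord_recr big_ord_recr /= IH [in RHS]big_ord_recr /=.
rewrite [X in _ = _ + X]big_ord_recr /= (_ : (2 * N).+2 = 2 * N.+1)%N; last by lia.
by rewrite -!addrA; congr (_ + _); rewrite addrCA.
Qed.

(** On piecewise linear data the midpoint rows vanish and the nodal rows reduce to the piecewise
    linear stiffness stencil. *)
Lemma stiff_form_linear (R : realType) (N : nat) (f : nat -> R) :
  vanishing_ends N f -> piecewise_linear N f ->
  \sum_(i < (2 * N).+1) f i.+1 * (\sum_k stiff_mx R N i k * f k.+1) =
  N.+1%:R * \sum_(j < N) f (2 * j.+1)%N *
    (2 * f (2 * j.+1)%N - (f (2 * j)%N + f (2 * j.+2)%N)).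
Proof.
move=> vf lf.
pose G (i : nat) := f i * (if odd i then 0
  else N.+1%:R * (2 * f i - (f i.-2 + f i.+2))).
transitivity (\sum_(i < (2 * N).+1) G i.+1); last first.
  rewrite (sum_nodes_mids N G) [X in _ + X]big1 => [|j _]; last first.
    by rewrite /G /= oddM /= mulr0.
  rewrite addr0 mulr_sumr; apply: eq_bigr => j _; rewrite /G oddM /=.
  rewrite (_ : (2 * j.+1).-2 = 2 * j)%N; last by lia.
  by rewrite (_ : (2 * j.+1).+2 = 2 * j.+2)%N; [ring|lia].
apply: eq_bigr => i _; rewrite /G; congr (_ * _).
have iN := ltn_ord i; case: ifPn => oi.
  have [j iE] : exists j, i.+1 = (2 * j).+1.
    by exists i./2; have := odd_double_half i; move: oi; rewrite /=; lia.
  rewrite (stiff_row_mid vf iE) /mid_stiff lf; last by lia.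
  by field.
have [j iE] : exists j, i.+1 = (2 * j.+1)%N.
  by exists i./2; have := odd_double_half i; move: oi; rewrite /=; lia.
rewrite (stiff_row_node vf iE) /node_stiff !lf; try lia.
rewrite iE (_ : (2 * j.+1).-2 = 2 * j)%N; last by lia.
by rewrite (_ : (2 * j.+1).+2 = 2 * j.+2)%N; [field|lia].
Qed.

Lemma sum_sqr_neighbours (R : realType) (N : nat) (u : nat -> R) :
  u 0%N = 0 -> u N.+1 = 0 ->
  \sum_(j < N.+1) (u j ^+ 2 + u j.+1 ^+ 2) = 2 * \sum_(j < N) u j.+1 ^+ 2.
Proof.
move=> u0 uN; rewrite big_split /= big_ord_recl [X in _ + X]big_ord_recr /=.
by rewrite u0 uN !expr0n /= addr0 add0r mulr2n mulrDl !mul1r.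
Qed.

(** Nodal rows contribute 1/3 of the lumped mass; midpoint rows contribute (u + u')^2 / 6 <= (u^2 +
    u'^2) / 3 per element, which sums to at most 2/3 of it. *)
Lemma mass_form_linear_le (R : realType) (N : nat) (f : nat -> R) :
  vanishing_ends N f -> piecewise_linear N f ->
  \sum_(i < (2 * N).+1) f i.+1 * (\sum_k mass_mx R N i k * f k.+1) <=
  N.+1%:R^-1 * \sum_(j < N) f (2 * j.+1)%N ^+ 2.
Proof.
move=> vf lf; have n0 : 0 < N.+1%:R :> R by [].
pose G (i : nat) := f i * ((30 * N.+1%:R)^-1 * (if odd i
  then 10 * (f i.-1 + f i.+1) else 10 * f i)).
have -> : \sum_(i < (2 * N).+1) f i.+1 * (\sum_k mass_mx R N i k * f k.+1) =
  \sum_(i < (2 * N).+1) G i.+1.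
  apply: eq_bigr => i _; rewrite /G; congr (_ * _).
  have iN := ltn_ord i; case: ifPn => oi.
    have [j iE] : exists j, i.+1 = (2 * j).+1.
      by exists i./2; have := odd_double_half i; move: oi; rewrite /=; lia.
    rewrite (mass_row_mid vf iE) /mid_mass lf; last by lia.
    by rewrite iE /= (_ : (2 * j).+2 = 2 * j.+1)%N; [field; rewrite gt_eqF|lia].
  have [j iE] : exists j, i.+1 = (2 * j.+1)%N.
    by exists i./2; have := odd_double_half i; move: oi; rewrite /=; lia.
  rewrite (mass_row_node vf iE) /node_mass !lf; try lia.
  by rewrite iE; field; rewrite gt_eqF.
rewrite (sum_nodes_mids N G).
pose u j := f (2 * j)%N.
have Ge (j : 'I_N) : G (2 * j.+1)%N = N.+1%:R^-1 * (u j.+1 ^+ 2 / 3).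
  by rewrite /G oddM /= /u; field; rewrite gt_eqF.
have Go (j : 'I_N.+1) : G (2 * j).+1 <= N.+1%:R^-1 * ((u j ^+ 2 + u j.+1 ^+ 2) / 3).
  rewrite /G /= oddM /= lf; last by rewrite -ltnS.
  rewrite (_ : (2 * j).+2 = 2 * j.+1)%N; last by lia.
  rewrite -/(u j) -/(u j.+1).
  rewrite (_ : _ / 2 * _ = N.+1%:R^-1 * ((u j + u j.+1) ^+ 2 / 6)).
    apply: ler_wpM2l; first by rewrite invr_ge0 ltW.
    by have := sqr_ge0 (u j - u j.+1); nra.
  by field; rewrite gt_eqF.
under eq_bigr do rewrite Ge.
apply: (@le_trans _ _ (\sum_(j < N) N.+1%:R^-1 * (u j.+1 ^+ 2 / 3) +
  \sum_(j < N.+1) N.+1%:R^-1 * ((u j ^+ 2 + u j.+1 ^+ 2) / 3))).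
  by rewrite lerD2l; apply: ler_sum => j _; exact: Go.
case: vf => f0 fN.
rewrite -!mulr_sumr -!mulr_suml sum_sqr_neighbours // -mulrDr.
by rewrite le_eqVlt; apply/orP; left; apply/eqP; congr (_ * _); field.
Qed.

(* Stands for the real and the imaginary part. *)
Definition real_linear (R : realType) (P : R[i] -> R) : Prop :=
  {morph P : x y / x + y} /\ forall (r : R) x, P (r%:C * x) = r * P x.

Lemma real_linear_Re (R : realType) : real_linear (@complex.Re R).
Proof. by split=> [[a b] [c d]|r [a b]] //=; rewrite mul0r subr0. Qed.

Lemma real_linear_Im (R : realType) : real_linear (@complex.Im R).
Proof. by split=> [[a b] [c d]|r [a b]] //=; rewrite mul0r addr0. Qed.

Lemma comp_halfS (R : realType) (N : nat) (F : cvec R N) (i : 'I_(2 * N).+1) :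
  comp_half F i.+1 = F i 0.
Proof. by rewrite /comp_half valK. Qed.

Lemma comp_half_out (R : realType) (N k : nat) (F : cvec R N) :
  (2 * N < k.-1)%N -> comp_half F k = 0.
Proof. by case: k => //= k Nk; rewrite insubF // ltnNge Nk. Qed.

Lemma half_indexP (R : realType) (N k : nat) :
  (exists i : 'I_(2 * N).+1, k = i.+1) \/ forall F : cvec R N, comp_half F k = 0.
Proof.
case: k => [|k]; first by right.
have [lt|le] := ltnP k (2 * N).+1; first by left; exists (Ordinal lt).
by right=> F; rewrite comp_half_out.
Qed.

Section RealParts.
Variables (R : realType) (N : nat) (P : R[i] -> R).
Hypothesis P_lin : real_linear P.
Implicit Types F : cvec R N.

Definition part F (k : nat) : R := P (comp_half F k).

Lemma real_linear0 : P 0 = 0.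
Proof. by have := P_lin.2 0 0; rewrite mulr0 mul0r. Qed.

Lemma real_linear_half x : P (x / 2) = P x / 2.
Proof.
rewrite mulrC (_ : 2^-1 = (2^-1)%:C) ?P_lin.2 1?mulrC //.
by rewrite fmorphV rmorph_nat.
Qed.

Lemma part_vanishing F : vanishing_ends N (part F).
Proof.
split; first exact: real_linear0.
by rewrite /part comp_half_out ?real_linear0 //; lia.
Qed.

Lemma part_cmulmx (A : 'M[R]_((2 * N).+1)) F i :
  P (cmulmx A F i 0) = \sum_k A i k * part F k.+1.
Proof.
rewrite /cmulmx mxE (big_morph P P_lin.1 real_linear0).
by apply: eq_bigr => k _; rewrite mxE P_lin.2 /part comp_halfS.
Qed.

Lemma part_linear F : linear_data F -> piecewise_linear N (part F).
Proof.
move=> lF j jN; rewrite /part -[comp_half F _.+1]/(comp_mid F j) lF //.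
by rewrite real_linear_half P_lin.1.
Qed.

Lemma part_bigrid F : bigrid_data F ->
  bigrid_nodes N (fun j => part F (2 * j)).
Proof.
move=> bF j jN; rewrite /part -[comp_half F _]/(comp_node F (2 * j).+1) bF //.
by rewrite real_linear_half P_lin.1.
Qed.

Lemma part_rows F G i :
  cmulmx (mass_mx R N) F + cmulmx (stiff_mx R N) G = 0 ->
  \sum_k mass_mx R N i k * part F k.+1 +
  \sum_k stiff_mx R N i k * part G k.+1 = 0.
Proof.
move=> /matrixP/(_ i 0); rewrite mxE [RHS]mxE => E.
by rewrite -!part_cmulmx -P_lin.1 E real_linear0.
Qed.

Lemma part_equations F G :
  cmulmx (mass_mx R N) F + cmulmx (stiff_mx R N) G = 0 ->
  (forall j, (j < N)%N ->
    node_mass (part F) j + 10 * N.+1%:R ^+ 2 * node_stiff (part G) j = 0) /\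
  (forall j, (j <= N)%N ->
    mid_mass (part F) j + 10 * N.+1%:R ^+ 2 * mid_stiff (part G) j = 0).
Proof.
move=> ode; have n0 : N.+1%:R != 0 :> R by [].
have scale (x y : R) : (30 * N.+1%:R)^-1 * x + N.+1%:R / 3 * y = 0 ->
    x + 10 * N.+1%:R ^+ 2 * y = 0.
  move=> E; transitivity (30 * N.+1%:R * ((30 * N.+1%:R)^-1 * x + N.+1%:R / 3 * y)).
    by field.
  by rewrite E mulr0.
split=> j jN; apply: scale.
  have lt : ((2 * j).+1 < (2 * N).+1)%N by lia.
  have iE : (Ordinal lt).+1 = (2 * j.+1)%N by rewrite /=; lia.
  by rewrite -(mass_row_node (part_vanishing F) iE)
    -(stiff_row_node (part_vanishing G) iE) part_rows.
have lt : (2 * j < (2 * N).+1)%N by lia.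
have iE : (Ordinal lt).+1 = (2 * j).+1 by [].
by rewrite -(mass_row_mid (part_vanishing F) iE)
  -(stiff_row_mid (part_vanishing G) iE) part_rows.
Qed.

Lemma part_fun_ind (Q : (R -> R) -> Prop) (U : R -> cvec R N) (k : nat) :
  Q (fun=> 0) -> (forall i, Q (fun t => P (U t i 0))) ->
  Q (fun t => part (U t) k).
Proof.
move=> Q0 QU; have [[i ->]|out] := half_indexP R N k.
  by under eq_fun do rewrite /part comp_halfS; exact: QU.
by under eq_fun do rewrite /part out real_linear0.
Qed.

Definition part_derive (U : R -> cvec R N) (t : R) (V : cvec R N) : Prop :=
  forall i, is_derive t 1 (fun s => P (U s i 0)) (P (V i 0)).

Lemma is_derive_part (U : R -> cvec R N) (t : R) (V : cvec R N) k :
  part_derive U t V -> is_derive t 1 (fun s => part (U s) k) (part V k).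
Proof.
move=> dU; have [[i ->]|out] := half_indexP R N k.
  by rewrite /part comp_halfS; under eq_fun do rewrite comp_halfS; exact: dU.
rewrite /part out real_linear0; under eq_fun do rewrite out real_linear0.
exact: is_derive_cst.
Qed.

Lemma part_solution (T : R) (U Ut Utt : R -> cvec R N) :
  (forall i, {within `[0, T], continuous (fun t => P (U t i 0))}) ->
  (forall i, {within `[0, T], continuous (fun t => P (Ut t i 0))}) ->
  (forall t, 0 < t < T -> part_derive U t (Ut t)) ->
  (forall t, 0 < t < T -> part_derive Ut t (Utt t)) ->
  (forall t, 0 < t < T ->
     cmulmx (mass_mx R N) (Utt t) + cmulmx (stiff_mx R N) (U t) = 0) ->
  real_solution N T (fun k t => part (U t) k) (fun k t => part (Ut t) k).
Proof.
move=> cU cUt dU dUt ode; split.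
- by move=> t; split; exact: part_vanishing.
- move=> k; apply: (@part_fun_ind (fun g => {within `[0, T], continuous g})) => //.
  exact: continuous_cst.
- move=> k; apply: (@part_fun_ind (fun g => {within `[0, T], continuous g})) => //.
  exact: continuous_cst.
- by move=> k t tT; apply: is_derive_part; exact: dU.
- move=> t tT; have [hn hm] := part_equations (ode t tT).
  exists (part (Utt t)); split => //; last exact: part_vanishing.
  by move=> k; apply: is_derive_part; exact: dUt.
Qed.

End RealParts.

Lemma Re_cdot (R : realType) (N : nat) (F G : cvec R N) :
  complex.Re (cdot F G) = \sum_i (complex.Re (G i 0) * complex.Re (F i 0) +
                                  complex.Im (G i 0) * complex.Im (F i 0)).
Proof.
rewrite /cdot (big_morph _ (@real_linear_Re R).1 (real_linear0 (@real_linear_Re R))).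
apply: eq_bigr => i _; case: (F i 0) (G i 0) => [a b] [c d] /=.
by rewrite mulrN opprK ![_ * c]mulrC ![_ * d]mulrC.
Qed.

Lemma Re_form (R : realType) (N : nat) (A : 'M[R]_((2 * N).+1)) (F : cvec R N) :
  let form (f : nat -> R) :=
    \sum_(i < (2 * N).+1) f i.+1 * (\sum_k A i k * f k.+1) in
  complex.Re (cdot (cmulmx A F) F) =
  form (part (@complex.Re R) F) + form (part (@complex.Im R) F).
Proof.
move=> form; rewrite Re_cdot big_split /=; congr (_ + _); apply: eq_bigr => i _.
  by rewrite (part_cmulmx (@real_linear_Re R)) /part comp_halfS.
by rewrite (part_cmulmx (@real_linear_Im R)) /part comp_halfS.
Qed.

Lemma observation_norm (R : realType) (N : nat) (F : cvec R N) : (0 < N)%N ->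
  cnorm_sq (cmulmx (obs_mx R N) F) =
  (N.+1%:R * part (@complex.Re R) F (2 * N)) ^+ 2 +
  (N.+1%:R * part (@complex.Im R) F (2 * N)) ^+ 2.
Proof.
move=> N0; have lt : ((2 * N).-1 < (2 * N).+1)%N by lia.
have row (P : R[i] -> R) : real_linear P -> forall i,
    P (cmulmx (obs_mx R N) F i 0) =
    if i == ord_max then - (N.+1%:R * part P F (2 * N)) else 0.
  move=> Pl i; rewrite (part_cmulmx Pl); case: eqP => [->|ni].
    rewrite (bigD1 (Ordinal lt)) //= big1 ?addr0 => [|k].
      rewrite mxE /= eqxx prednK ?eqxx /=; last by lia.
      by rewrite /meshsize invrK mulNr.
    rewrite -val_eqE mxE /= => kN; rewrite ifF ?mul0r // eqxx /=.
    by apply/eqP; move/eqP: kN; lia.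
  rewrite big1 // => k _; rewrite mxE ifF ?mul0r //.
  apply/negP => /andP[/eqP[iN] _]; apply: ni; exact: val_inj.
rewrite /cnorm_sq Re_cdot (bigD1 ord_max) //= big1 ?addr0 => [|i /negPf ni].
  rewrite (row _ (@real_linear_Re R)) (row _ (@real_linear_Im R)) eqxx.
  by rewrite !mulrNN !expr2.
rewrite (row _ (@real_linear_Re R)) (row _ (@real_linear_Im R)) ni.
by rewrite !mulr0 addr0.
Qed.

Lemma observation_normc (R : realType) (N : nat) (F : cvec R N) : (0 < N)%N ->
  Normc.normc (comp_node F N / (meshsize R N)%:C) ^+ 2 =
  cnorm_sq (cmulmx (obs_mx R N) F).
Proof.
move=> N0; rewrite observation_norm // /part /comp_node.
rewrite -fmorphV /meshsize invrK; case: (comp_half F _) => a b /=.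
by rewrite sqr_sqrtr ?addr_ge0 ?sqr_ge0 // !mulr0 subr0 add0r; ring.
Qed.

Definition nodal_energy (R : realType) (N : nat) (u0 u1 : nat -> R) : R :=
  N.+1%:R * (\sum_(j < N) u0 j.+1 * (2 * u0 j.+1 - (u0 j + u0 j.+2))) +
  N.+1%:R^-1 * (\sum_(j < N) u1 j.+1 ^+ 2).

Lemma energy_linear_le (R : realType) (N : nat) (U0 U1 : cvec R N) :
  linear_data U0 -> linear_data U1 ->
  energy U0 U1 <= 2^-1 *
    (nodal_energy N (fun j => part (@complex.Re R) U0 (2 * j))
                    (fun j => part (@complex.Re R) U1 (2 * j)) +
     nodal_energy N (fun j => part (@complex.Im R) U0 (2 * j))
                    (fun j => part (@complex.Im R) U1 (2 * j))).
Proof.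
move=> l0 l1; rewrite /energy /norm1_sq /norm0_sq !Re_form addrACA.
have lRe := @real_linear_Re R; have lIm := @real_linear_Im R.
apply: ler_wpM2l; first by rewrite invr_ge0.
apply: lerD; rewrite stiff_form_linear ?lerD2l ?mass_form_linear_le //;
  by [exact: part_vanishing|exact: part_linear].
Qed.

(** The solution is continuous only within [0, T], so integrability is obtained from continuity on
    the compact subspace. *)
Lemma real_solution_integrable (R : realType) (N : nat) (T a : R)
    (v vt : nat -> R -> R) (k : nat) : real_solution N T v vt ->
  (@lebesgue_measure R).-integrable `[0, T] (EFin \o (fun t => (a * v k t) ^+ 2)).
Proof.
move=> [_ cv _ _ _]; apply: continuous_compact_integrable.
  exact: segment_compact.
have c : continuous (fun t : subspace `[0, T] => a * v k t).
  by apply: continuous_mul; [exact: continuous_cst|exact: cv].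
exact: continuous_mul.
Qed.

Theorem theorem6p1 (R : realType) (T : R) (hT : 2 < T) :
  exists C : R, 0 < C /\
    forall (N : nat), odd N ->
    forall (U0 U1 : cvec R N), filtered_data (U0, U1) ->
    forall (U : R -> cvec R N), adjoint_solution T U0 U1 U ->
      energy U0 U1 <=
        C * \int[lebesgue_measure]_(t in `[0, T])
              cnorm_sq (cmulmx (obs_mx R N) (U t)) /\
      C * \int[lebesgue_measure]_(t in `[0, T])
            cnorm_sq (cmulmx (obs_mx R N) (U t)) =
        C * \int[lebesgue_measure]_(t in `[0, T])
              (Normc.normc (comp_node (U t) N / (meshsize R N)%:C) ^+ 2).
Proof.
have [C [C0 obs]] := real_observability hT.
(* The factor 1/2 is that of the energy; real and imaginary parts are two real solutions whose
   energies and observations add up. *)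
exists (2^-1 * C); split; first by rewrite mulr_gt0 // invr_gt0.
move=> N oN U0 U1 [[/= l0 g0] [/= l1 g1]] U [Ut [Utt [cU cUt dU dUt [ode [UT UtT]]]]].
have N0 : (0 < N)%N by case: N oN {U0 U1 l0 g0 l1 g1 U Ut Utt cU cUt dU dUt ode UT UtT}.
split; last by under [in RHS]eq_Rintegral do rewrite observation_normc //.
have sRe : real_solution N T (fun k t => part (@complex.Re R) (U t) k)
    (fun k t => part (@complex.Re R) (Ut t) k).
  apply: (part_solution (@real_linear_Re R) (Utt := Utt)) => //.
  - by move=> i; have [] := cU i.
  - by move=> i; have [] := cUt i.
  - by move=> t tT i; have [] := dU t tT i.
  - by move=> t tT i; have [] := dUt t tT i.
have sIm : real_solution N T (fun k t => part (@complex.Im R) (U t) k)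
    (fun k t => part (@complex.Im R) (Ut t) k).
  apply: (part_solution (@real_linear_Im R) (Utt := Utt)) => //.
  - by move=> i; have [] := cU i.
  - by move=> i; have [] := cUt i.
  - by move=> t tT i; have [] := dU t tT i.
  - by move=> t tT i; have [] := dUt t tT i.
apply: (le_trans (energy_linear_le l0 l1)); rewrite -mulrA.
apply: ler_wpM2l; first by rewrite invr_ge0.
under eq_Rintegral do rewrite observation_norm //.
rewrite RintegralD //; last 2 first.
- exact: (real_solution_integrable _ _ sRe).
- exact: (real_solution_integrable _ _ sIm).
rewrite mulrDr; apply: lerD.
  have lRe := @real_linear_Re R; have := obs N oN _ _ sRe; rewrite /= UT UtT.
  by apply; [exact: part_linear|exact: part_linear|exact: part_bigrid|exact: part_bigrid].
have lIm := @real_linear_Im R; have := obs N oN _ _ sIm; rewrite /= UT UtT.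
by apply; [exact: part_linear|exact: part_linear|exact: part_bigrid|exact: part_bigrid].
Qed.
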